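(* Let $\Phi:X\times\mathbb{R}\to X$ be a continuous flow on a compact, locally path connected metric space $X$ and let $\xi\in\check H^1(X;\mathbb{R})$ be a nonzero Čech cohomology class. The following two conditions are equivalent: (i) $R_\xi=\emptyset$, and there exist constants $\delta>0$, $T>1$ such that every homology class $z\in H_1(X;\mathbb{Z})$ associated to an arbitrary $(\delta,T)$-cycle $(x,t)$ with $x\in C_\xi=R-R_\xi$ satisfies $\langle\xi,z\rangle\le-1$; (ii) there exists a Lyapunov one-form for $(\Phi,\emptyset)$ representing the class $\xi$. If the class $\xi$ is integral, i.e. $\xi\in\check H^1(X;\mathbb{Z})$, then either of the conditions (i) and (ii) is equivalent to the existence of a continuous locally trivial fibration $p:X\to S^1\subset\mathbb{C}$ with the following properties: the function $t\mapsto\arg(p(x\cdot t))$ is differentiable, its derivative satisfies $$\frac{d}{dt}\arg(p(x\cdot t))<0\quad\text{for all }x\in X,\ t\in\mathbb{R},$$ and the cohomology class $p^*(\mu)\in\check H^1(X;\mathbb{Z})$ coincides with $\xi$, where $\mu\in\check H^1(S^1;\mathbb{Z})$ is the fundamental class of the circle $S^1$ oriented counterclockwise. In particular, for any $\theta\in S^1$ the set $K=p^{-1}(\theta)$ is a cross section of the flow $\Phi$.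
   Context: Write $x\cdot t=\Phi(x,t)$ and let $d$ be the metric of $X$. $R=R(\Phi)$ is the chain recurrent set. $\arg(p(x\cdot t))$ denotes a continuous branch of the argument along the trajectory. The class $\mu$ takes the value $1$ on the counterclockwise generator of $H_1(S^1;\mathbb{Z})$. A closed subset $K\subset X$ is a cross section of $\Phi$ if the flow map $K\times\mathbb{R}\to X$, $(x,t)\mapsto x\cdot t$, is a surjective local homeomorphism. Closed one-forms. A continuous closed one-form $\omega$ on $X$ is given by an open cover $\mathcal U$ of $X$ and continuous functions $\varphi_U:U\to\mathbb{R}$, $U\in\mathcal U$, such that for all $U,V\in\mathcal U$ the difference $\varphi_U|_{U\cap V}-\varphi_V|_{U\cap V}$ is locally constant (constant on each connected component of $U\cap V$); two such families are identified if their union again satisfies this condition. For a path $\gamma:[0,1]\to X$, $\int_\gamma\omega=\sum_{i=1}^N\left(\varphi_{U_i}(\gamma(t_i))-\varphi_{U_i}(\gamma(t_{i-1}))\right)$ for any subdivision $0=t_0<\dots<t_N=1$ with $\gamma([t_{i-1},t_i])\subset U_i\in\mathcal U$. The integral $\int_x^{x\cdot t}\omega$ is taken along the trajectory $\tau\mapsto x\cdot\tau$, $\tau\in[0,t]$. Closed one-forms are the global sections of the quotient sheaf $B_X=C_X/\mathbb{R}_X$ (continuous real functions modulo locally constant ones), and $[\omega]\in\check H^1(X;\mathbb{R})=H^1(X;\mathbb{R}_X)$ is the image of $\omega$ under the connecting homomorphism of $0\to\mathbb{R}_X\to C_X\to B_X\to0$. One says $\omega$ represents $\xi$ if $[\omega]=\xi$.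 The pairing $\langle\xi,z\rangle\in\mathbb{R}$ for $z\in H_1(X;\mathbb{Z})$ is $\int_\gamma\omega$, where $[\omega]=\xi$ and $\gamma$ is a loop (or singular cycle) representing $z$. Lyapunov one-form. A continuous closed one-form $\omega$ on $X$ is a Lyapunov one-form for $(\Phi,\emptyset)$ if $\int_x^{x\cdot t}\omega<0$ for every $x\in X$ and $t>0$. Chains. A $(\delta,T)$-chain from $x$ to $y$ is a sequence $x_0=x,x_1,\dots,x_N=y$ in $X$ with $t_1,\dots,t_N\in\mathbb{R}$ such that $t_i\ge T$ and $d(x_{i-1}\cdot t_i,x_i)<\delta$ for $1\le i\le N$. It is closed if $x=y$. A $(\delta,T)$-cycle is a pair $(x,t)\in X\times\mathbb{R}$ with $t\ge T$ and $d(x,x\cdot t)<\delta$, i.e. a closed chain with $N=1$. $R(\Phi)$ is the set of $x\in X$ such that for all $\delta>0$, $T\ge1$ there is a $(\delta,T)$-chain from $x$ to $x$. Scale and associated classes. A scale of $\xi$ is a pair $(\varepsilon,\delta_0)$ of positive numbers such that $\xi|_B=0$ for every ball $B\subset X$ of radius $2\varepsilon$, and any $x,y\in X$ with $d(x,y)<\delta_0$ can be joined by a path contained in a ball of radius $\varepsilon$. Fix a scale. A homology class $z\in H_1(X;\mathbb{Z})$ is associated with a closed $(\delta,T)$-chain if it is represented by the singular cycle obtained by concatenating the trajectory pieces from $x_{i-1}$ to $x_{i-1}\cdot t_i$ with paths $\sigma_i$ from $x_{i-1}\cdot t_i$ to $x_i$, each lying in some ball of radius $\varepsilon$. The number $\langle\xi,z\rangle$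 does not depend on the choice of the $\sigma_i$. The set $R_\xi$. $R_\xi=R_\xi(\Phi)$ is the set of $x\in X$ such that for any $0<\delta'<\delta_0$ and $T>1$ there is a $(\delta',T)$-chain from $x$ to $x$ with $\langle\xi,z\rangle=0$ for any homology class $z$ associated with this chain. *)

(* Defs.v *)
From HB Require Import structures.
From mathcomp Require Import all_boot all_order all_algebra.
From mathcomp Require Import generic_quotient.
From mathcomp Require Import all_classical all_reals all_analysis.
From mathcomp Require Import complex freeg.
Set Implicit Arguments.
Unset Strict Implicit.
Unset Printing Implicit Defensive.
Import Order.TTheory GRing.Theory Num.Theory.
Import numFieldNormedType.Exports.

Local Open Scope classical_set_scope.
Local Open Scope ring_scope.

Lemma cocycle_arith (A : zmodType) (e a h h' k k' bd bd' dd bb b'd' : A) :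
  bb + b'd' = bd' -> bd + dd = bd' -> e - dd = k' - k -> bb - a = h' - h ->
  e - a = h' + k' + b'd' - (h + k + bd).
Proof.
move=> E1 E2 Ek Eh.
have -> : e - a = (e - dd) + (bb - a) + (dd - bb).
  by rewrite addrAC !subrKA.
have -> : dd - bb = b'd' - bd.
  by apply/eqP; rewrite subr_eq addrAC eq_sym subr_eq addrC E1 -E2 addrC.
by rewrite Ek Eh [_ - _ + (_ - _)]addrC [h' - h + _]addrACA -opprD addrACA -opprD.
Qed.

Section Cech.
Variable (X : topologicalType).

Definition open_cover (C : set (set X)) : Prop :=
  C `<=` open /\ \bigcup_(U in C) U = setT.

(* A function on [D] is represented by a total function, whose values outside
   [D] are irrelevant. *)
Definition locally_constant (T : Type) (D : set X) (f : X -> T) : Prop :=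
  forall x, D x -> \forall y \near x, D y -> f y = f x.

Variable (A : zmodType).

(* Cech 1-cocycles with values in the sheaf of locally constant [A]-valued
   functions: [cval U V] is a section over [U `&` V], for [U] and [V] in the
   cover. *)
Record cocycle := Cocycle {
  ccover : set (set X) ;
  cval : set X -> set X -> X -> A ;
  ccover_open : open_cover ccover ;
  cval_locally_constant : forall U V, ccover U -> ccover V ->
    locally_constant (U `&` V) (cval U V) ;
  cval_cocycle : forall U V W x, ccover U -> ccover V -> ccover W ->
    U x -> V x -> W x -> cval U V x + cval V W x = cval U W x }.

HB.instance Definition _ := gen_eqMixin cocycle.
HB.instance Definition _ := gen_choiceMixin cocycle.

(* The two cocycles differ by the coboundary of [h] on a common refinement [C],
   with refinement maps [a] and [b]. *)
Definition cohomologous (c c' : cocycle) : Prop :=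
  exists (C : set (set X)) (a b : set X -> set X) (h : set X -> X -> A),
  [/\ open_cover C,
      forall W, C W -> [/\ ccover c (a W), ccover c' (b W),
                          W `<=` a W `&` b W & locally_constant W (h W)]
    & forall W W' x, C W -> C W' -> W x -> W' x ->
        cval c' (b W) (b W') x - cval c (a W) (a W') x = h W' x - h W x].

Lemma cval_id (c : cocycle) U x : ccover c U -> U x -> cval c U U x = 0.
Proof.
move=> cU Ux; have := cval_cocycle cU cU cU Ux Ux Ux.
by move/eqP; rewrite -subr_eq0 addrK => /eqP.
Qed.

Lemma locally_constant_sub (T : Type) (D E : set X) (f : X -> T) :
  E `<=` D -> locally_constant D f -> locally_constant E f.
Proof.
by move=> ED fD x Ex; apply: filterS (fD x (ED _ Ex)) => y + Ey; apply; exact: ED.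
Qed.

Lemma locally_constantD (D : set X) (f g : X -> A) :
  locally_constant D f -> locally_constant D g ->
  locally_constant D (fun x => f x + g x).
Proof.
move=> fD gD x Dx; apply: filterS2 (fD x Dx) (gD x Dx) => y fy gy Dy.
by rewrite fy // gy.
Qed.

Lemma cohomologous_refl c : cohomologous c c.
Proof.
exists (ccover c), id, id, (fun _ _ => 0); split.
- exact: ccover_open.
- by move=> W cW; split => // x _; near=> y.
- by move=> *; rewrite !subrr.
Unshelve. all: by end_near. Qed.

Lemma cohomologous_sym c c' : cohomologous c c' -> cohomologous c' c.
Proof.
move=> [C [a [b [h [oC Cab Ch]]]]].
exists C, b, a, (fun W x => - h W x); split => //.
  move=> W /Cab[? ? WI lh]; split => //; first by rewrite setIC.
  by move=> x /lh; apply: filterS => y hy /hy ->.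
by move=> W W' x CW CW' Wx W'x; rewrite -opprB Ch // opprB opprK addrC.
Qed.

Lemma cohomologous_trans c1 c2 c3 :
  cohomologous c1 c2 -> cohomologous c2 c3 -> cohomologous c1 c3.
Proof.
move=> [C [a [b [h [[oC covC] Cab Ch]]]]] [D [d [e [k [[oD covD] Dde Dk]]]]].
pose P (W : set X) := [set p : set X * set X | [/\ C p.1, D p.2 & p.1 `&` p.2 = W]].
pose q W := xget (set0, set0) (P W).
pose E := [set W | exists p, P W p].
have qP W : E W -> P W (q W) by move=> [p Pp]; exact: xgetPex (ex_intro _ p Pp).
exists E, (fun W => a (q W).1), (fun W => e (q W).2).
exists (fun W x => h (q W).1 x + k (q W).2 x + cval c2 (b (q W).1) (d (q W).2) x).
have subE W x : E W -> W x -> (q W).1 x /\ (q W).2 x.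
  by move=> /qP[_ _ {1}<-].
split.
- split; first by move=> W [[U V] [/= CU DV <-]]; apply: openI; [exact: oC|exact: oD].
  apply/seteqP; split => // x _.
  have : (\bigcup_(U in C) U) x by rewrite covC.
  have : (\bigcup_(U in D) U) x by rewrite covD.
  by move=> [V DV Vx] [U CU Ux]; exists (U `&` V) => //; exists (U, V).
- move=> W EW; have [Cq Dq _] := qP _ EW.
  have [c1a c2b sab lh] := Cab _ Cq; have [c2d c3e sde lk] := Dde _ Dq.
  split=> //.
    by move=> x /(subE _ _ EW)[/sab[? _] /sde[_ ?]].
  apply: locally_constantD; last first.
    apply: locally_constant_sub (cval_locally_constant c2b c2d).
    by move=> x /(subE _ _ EW)[/sab[_ ?] /sde[? _]].
  apply: locally_constantD.
    by apply: locally_constant_sub lh => x /(subE _ _ EW)[].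
  by apply: locally_constant_sub lk => x /(subE _ _ EW)[].
- move=> W W' x EW EW' Wx W'x.
  have [Cq Dq _] := qP _ EW; have [Cq' Dq' _] := qP _ EW'.
  have [q1 q2] := subE _ _ EW Wx; have [q1' q2'] := subE _ _ EW' W'x.
  have [_ c2b sab _] := Cab _ Cq; have [c2d _ sde _] := Dde _ Dq.
  have [_ c2b' sab' _] := Cab _ Cq'; have [c2d' _ sde' _] := Dde _ Dq'.
  have [_ bx] := sab _ q1; have [dx _] := sde _ q2.
  have [_ bx'] := sab' _ q1'; have [dx' _] := sde' _ q2'.
  have := Ch _ _ _ Cq Cq' q1 q1'; have := Dk _ _ _ Dq Dq' q2 q2'.
  have := cval_cocycle c2b c2d c2d' bx dx dx'.
  have := cval_cocycle c2b c2b' c2d' bx bx' dx'.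
  by move=> E1 E2 Ek Eh; exact: (cocycle_arith E1 E2 Ek Eh).
Qed.

Definition cohomologous_rel : rel cocycle :=
  fun c c' => `[< cohomologous c c' >].

Lemma cohomologous_rel_refl : reflexive cohomologous_rel.
Proof. by move=> c; apply/asboolP; exact: cohomologous_refl. Qed.

Lemma cohomologous_rel_sym : symmetric cohomologous_rel.
Proof.
by move=> c c'; apply/asboolP/asboolP; exact: cohomologous_sym.
Qed.

Lemma cohomologous_rel_trans : transitive cohomologous_rel.
Proof.
by move=> c2 c1 c3 /asboolP c12 /asboolP c23; apply/asboolP;
  exact: cohomologous_trans c12 c23.
Qed.

Canonical cohomologous_equiv : equiv_rel cocycle :=
  EquivRel cohomologous_rel
    cohomologous_rel_refl cohomologous_rel_sym cohomologous_rel_trans.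

Definition cech1 := {eq_quot cohomologous_equiv}%qT.

Definition cech_class (c : cocycle) : cech1 := \pi_cech1%qT c.

Lemma zero_cover : open_cover [set setT].
Proof.
split=> [_ ->|]; first exact: openT.
by apply/seteqP; split => // x _; exists setT.
Qed.

Lemma zero_locally_constant (D : set X) : locally_constant D (fun=> 0 : A).
Proof. by move=> x _; near=> y.
Unshelve. all: by end_near. Qed.

Definition cocycle0 : cocycle :=
  @Cocycle [set setT] (fun _ _ _ => 0) zero_cover
    (fun U V _ _ => @zero_locally_constant (U `&` V))
    (fun U V W x _ _ _ _ _ _ => addr0 0).

Definition cech0 : cech1 := cech_class cocycle0.

End Cech.

Section Pullback.
Variables (X Y : topologicalType) (A : zmodType) (f : continuousType X Y).
Variable (c : cocycle Y A).

Definition pull_cover : set (set X) := [set f @^-1` U | U in ccover c].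

Definition pull_index (V : set X) : set Y :=
  xget set0 [set U | ccover c U /\ f @^-1` U = V].

Lemma pull_indexP V : pull_cover V ->
  ccover c (pull_index V) /\ f @^-1` (pull_index V) = V.
Proof. move=> [U cU UV].
exact: (@xgetPex _ set0 [set U | ccover c U /\ f @^-1` U = V]
  (ex_intro _ U (conj cU UV))). Qed.

Lemma pull_index_mem V x : pull_cover V -> V x -> pull_index V (f x).
Proof. by move=> /pull_indexP[_ {1}<-]. Qed.

Lemma pull_cover_open : open_cover pull_cover.
Proof.
have [oc cov] := ccover_open c; split.
  move=> _ [U cU <-]; apply: open_comp; last exact: oc.
  by move=> x _; exact: cts_fun.
apply/seteqP; split => // x _.
have : (\bigcup_(U in ccover c) U) (f x) by rewrite cov.
by move=> [U cU Ufx]; exists (f @^-1` U) => //; exists U.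
Qed.

Lemma pull_locally_constant U V : pull_cover U -> pull_cover V ->
  locally_constant (U `&` V)
    (fun x => cval c (pull_index U) (pull_index V) (f x)).
Proof.
move=> cU cV x [Ux Vx].
have [iU _] := pull_indexP cU; have [iV _] := pull_indexP cV.
have /= := cval_locally_constant iU iV
  (conj (pull_index_mem cU Ux) (pull_index_mem cV Vx)).
move=> /(@cts_fun _ _ f x) nf.
have {}nf : \forall y \near x, pull_index U (f y) /\ pull_index V (f y) ->
    cval c (pull_index U) (pull_index V) (f y) =
    cval c (pull_index U) (pull_index V) (f x) by exact: nf.
by apply: filterS nf => y + [Uy Vy]; apply; split; exact: pull_index_mem.
Qed.

Lemma pull_cocycle U V W x :
  pull_cover U -> pull_cover V -> pull_cover W -> U x -> V x -> W x ->
  cval c (pull_index U) (pull_index V) (f x) +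
  cval c (pull_index V) (pull_index W) (f x) =
  cval c (pull_index U) (pull_index W) (f x).
Proof.
move=> cU cV cW Ux Vx Wx.
have [iU _] := pull_indexP cU; have [iV _] := pull_indexP cV.
have [iW _] := pull_indexP cW.
by apply: cval_cocycle => //; exact: pull_index_mem.
Qed.

Definition cocycle_pullback : cocycle X A :=
  Cocycle pull_cover_open pull_locally_constant pull_cocycle.

End Pullback.

Definition cech_pullback (X Y : topologicalType) (A : zmodType)
    (f : continuousType X Y) (xi : cech1 Y A) : cech1 X A :=
  cech_class (cocycle_pullback f (repr xi)).

Definition set_val_continuous (X : topologicalType) (B : set X) :
    continuous (set_val : B -> X) := @initial_continuous B X set_val.

Definition cech_restrict (X : topologicalType) (A : zmodType) (B : set X)
    (xi : cech1 X A) : cech1 B A :=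
  cech_pullback (mkcts (@set_val_continuous X B)) xi.

Section IntegralClasses.
Variables (X : topologicalType) (R : realType) (c : cocycle X int).

Definition real_val (U V : set X) (x : X) : R := (cval c U V x)%:~R.

Lemma real_locally_constant U V : ccover c U -> ccover c V ->
  locally_constant (U `&` V) (real_val U V).
Proof.
move=> cU cV x /(cval_locally_constant cU cV).
by apply: filterS => y cy /cy; rewrite /real_val => ->.
Qed.

Lemma real_cocycle U V W x : ccover c U -> ccover c V -> ccover c W ->
  U x -> V x -> W x -> real_val U V x + real_val V W x = real_val U W x.
Proof.
by move=> *; rewrite /real_val -intrD cval_cocycle.
Qed.

Definition cocycle_real : cocycle X R :=
  Cocycle (ccover_open c) real_locally_constant real_cocycle.

End IntegralClasses.

(* The coefficient map H^1(X; Z) -> H^1(X; R). *)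
Definition cech_real (X : topologicalType) (R : realType)
    (xi : cech1 X int) : cech1 X R :=
  cech_class (cocycle_real R (repr xi)).

Section ClosedForms.
Variables (R : realType) (X : topologicalType).

Record closed_form := ClosedForm {
  fcover : set (set X) ;
  fphi : set X -> X -> R ;
  fcover_open : open_cover fcover ;
  fphi_continuous : forall U x, fcover U -> U x -> {for x, continuous (fphi U)} ;
  fphi_locally_constant : forall U V, fcover U -> fcover V ->
    locally_constant (U `&` V) (fun x => fphi U x - fphi V x) }.

Variable w : closed_form.

Lemma form_locally_constant U V : fcover w U -> fcover w V ->
  locally_constant (U `&` V) (fun x => fphi w V x - fphi w U x).
Proof. by rewrite setIC => cU cV; exact: fphi_locally_constant. Qed.

Lemma form_cocycleP U V W x : fcover w U -> fcover w V -> fcover w W ->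
  U x -> V x -> W x ->
  (fphi w V x - fphi w U x) + (fphi w W x - fphi w V x) =
  fphi w W x - fphi w U x.
Proof. by move=> *; rewrite addrC subrKA. Qed.

Definition form_cocycle : cocycle X R :=
  Cocycle (fcover_open w) form_locally_constant form_cocycleP.

(* The connecting homomorphism of 0 -> R_X -> C_X -> B_X -> 0, with the
   convention that the coboundary of (phi_U) is phi_V - phi_U on U `&` V. *)
Definition form_class : cech1 X R := cech_class form_cocycle.

(* [v] is the sum computing the integral of [w] along [g], a path on [0, 1], for
   some subdivision. *)
Definition integral_sum (g : R -> X) (v : R) : Prop :=
  exists (N : nat) (t : nat -> R) (U : nat -> set X),
  [/\ t 0%N = 0, t N = 1,
      forall i, (i < N)%N -> t i < t i.+1,
      forall i, (i < N)%N -> fcover w (U i) /\ g @` `[t i, t i.+1] `<=` U i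
    & v = \sum_(i < N) (fphi w (U i) (g (t i.+1)) - fphi w (U i) (g (t i)))].

Definition integral (g : R -> X) : R := xget 0 (integral_sum g).

End ClosedForms.

Section Simplices.
Variable (R : realType).

Definition std_simplex (n : nat) : set 'rV[R]_n.+1 :=
  [set v | (forall i, 0 <= v 0 i) /\ \sum_i v 0 i = 1].

Arguments std_simplex : clear implicits.

Definition face_row (n : nat) (i : 'I_n.+2) (v : 'rV[R]_n.+1) : 'rV[R]_n.+2 :=
  \row_j (if unlift i j is Some k then v 0 k else 0).

Lemma face_row_simplex n (i : 'I_n.+2) (v : 'rV[R]_n.+1) :
  std_simplex n v -> std_simplex n.+1 (face_row i v).
Proof.
move=> [v0 v1]; split=> [j|].
  by rewrite mxE; case: unliftP.
rewrite (bigD1_ord i) //= mxE unlift_none add0r -[RHS]v1.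
by apply: eq_bigr => k _; rewrite mxE liftK.
Qed.

Definition face_map (n : nat) (i : 'I_n.+2) (v : std_simplex n) :
    std_simplex n.+1 :=
  exist _ (face_row i (val v)) (mem_set (face_row_simplex i (set_mem (valP v)))).

Lemma face_map_continuous n (i : 'I_n.+2) : continuous (@face_map n i).
Proof.
apply: continuous_comp_initial => v.
have -> : set_val \o @face_map n i = @face_row n i \o set_val by [].
apply: continuous_comp; first exact: initial_continuous.
move=> B [P Pv PB].
pose Q (a : 'I_1) (k : 'I_n.+1) := P a (fintype.lift i k).
exists Q.
  move=> a k; have := Pv a (fintype.lift i k).
  by rewrite mxE liftK ord1.
move=> u Qu; apply: PB => a j; rewrite mxE.
case: unliftP => [k ->|ji]; first by have := Qu a k; rewrite ord1.
apply: nbhs_singleton; have := Pv a j.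
by rewrite mxE ji unlift_none.
Qed.

Definition face (n : nat) (i : 'I_n.+2) :
    continuousType (std_simplex n) (std_simplex n.+1) :=
  mkcts (@face_map_continuous n i).

Definition edge_row (s : R) : 'rV[R]_2 :=
  \row_j (if j == 0 then 1 - s else s).

Lemma edge0_simplex : edge_row 0 \in std_simplex 1.
Proof.
apply/mem_set; split=> [i|]; first by rewrite mxE; case: ifP => //; rewrite subr0.
by rewrite big_ord_recl big_ord1 !mxE /= subr0 addr0.
Qed.

(* The parametrization of the standard 1-simplex by [0, 1] (constant outside). *)
Definition edge (s : R) : std_simplex 1 :=
  insubd (Sub (edge_row 0) edge0_simplex : std_simplex 1) (edge_row s).

End Simplices.

Arguments std_simplex : clear implicits.

Section SingularHomology.
Variables (R : realType) (X : topologicalType).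

Definition simplex (n : nat) := continuousType (std_simplex R n) X.

Definition chain (n : nat) := {freeg (simplex n) / int}.

Definition simplex_face (n : nat) (i : 'I_n.+2) (s : simplex n.+1) : simplex n :=
  [the continuousType _ _ of s \o face R i].

Definition boundary (n : nat) : chain n.+1 -> chain n :=
  fglift (fun s => \sum_(i < n.+2) (-1) ^+ i *: << simplex_face i s >>).

Definition cycle1 := {c : chain 1 | boundary c == 0}.

HB.instance Definition _ := Choice.on cycle1.

Definition homologous (c c' : cycle1) : Prop :=
  exists b : chain 2, val c - val c' = boundary b.

Definition homologous_rel : rel cycle1 := fun c c' => `[< homologous c c' >].

Lemma boundaryB n : {morph @boundary n : b b' / b - b'}.
Proof. exact: lift_is_additive. Qed.

Lemma boundary0 n : @boundary n 0 = 0.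
Proof. by rewrite -[0 in LHS](subrr 0) boundaryB subrr. Qed.

Lemma homologous_rel_refl : reflexive homologous_rel.
Proof. by move=> c; apply/asboolP; exists 0; rewrite boundary0 subrr. Qed.

Lemma homologous_rel_sym : symmetric homologous_rel.
Proof.
by move=> c c'; apply/asboolP/asboolP => -[b cb]; exists (0 - b);
  rewrite boundaryB boundary0 -cb sub0r opprB.
Qed.

Lemma homologous_rel_trans : transitive homologous_rel.
Proof.
move=> c2 c1 c3 /asboolP[b cb] /asboolP[b' cb']; apply/asboolP.
exists (b - (0 - b')).
by rewrite !boundaryB boundary0 -cb -cb' sub0r opprK subrKA.
Qed.

Canonical homologous_equiv : equiv_rel cycle1 :=
  EquivRel homologous_rel
    homologous_rel_refl homologous_rel_sym homologous_rel_trans.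

Definition H1 := {eq_quot homologous_equiv}%qT.

Definition represented_by (z : H1) (c : chain 1) : Prop :=
  exists2 cy : cycle1, \pi_H1%qT cy = z & val cy = c.

Definition simplex_path (s : simplex 1) : R -> X := fun t => s (edge t).

Definition chain_integral (w : closed_form R X) (c : chain 1) : R :=
  \sum_(s <- dom c) integral w (simplex_path s) *~ coeff s c.

(* The value of the pairing does not depend on the choice of [w] and [c]. *)
Definition pairing (xi : cech1 X R) (z : H1) : R :=
  xget 0 [set v | exists (w : closed_form R X) (c : chain 1),
    [/\ form_class w = xi, represented_by z c & v = chain_integral w c]].

End SingularHomology.

Section Dynamics.
Variables (R : realType) (X : metricType R).

Definition is_path (g : R -> X) (x y : X) : Prop :=
  [/\ {within `[0, 1], continuous g}, g 0 = x & g 1 = y].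

Definition locally_path_connected : Prop :=
  forall (x : X) (U : set X), nbhs x U ->
  exists V : set X, [/\ open V, V x, V `<=` U &
    forall y z, V y -> V z ->
      exists2 g, is_path g y z & g @` `[0, 1] `<=` V].

Variable (Phi : X * R -> X).

Definition is_flow : Prop :=
  [/\ continuous Phi, forall x, Phi (x, 0) = x
    & forall x s t, Phi (Phi (x, s), t) = Phi (x, s + t)].

(* The points of the chain are [xs 0], ..., [xs N] and its times are [ts 1],
   ..., [ts N]; other values are irrelevant. The condition 0 < N excludes the
   empty chain from a point to itself. *)
Definition is_chain (delta T : R) (N : nat) (xs : nat -> X) (ts : nat -> R)
    (x y : X) : Prop :=
  [/\ (0 < N)%N, xs 0%N = x, xs N = y
    & forall i, (i < N)%N ->
        T <= ts i.+1 /\ mdist (Phi (xs i, ts i.+1)) (xs i.+1) < delta].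

Definition is_delta_cycle (delta T : R) (x : X) (t : R) : Prop :=
  T <= t /\ mdist x (Phi (x, t)) < delta.

Definition chain_recurrent : set X :=
  [set x | forall delta T, 0 < delta -> 1 <= T ->
    exists N xs ts, is_chain delta T N xs ts x x].

(* [tau i] is the trajectory from [xs i] to [Phi (xs i, ts i.+1)], and [sig i]
   is a path from the latter point to [xs i.+1]. *)
Definition associated (eps : R) (N : nat) (xs : nat -> X) (ts : nat -> R)
    (z : H1 R X) : Prop :=
  exists tau sig : nat -> simplex R X 1,
  [/\ forall i, (i < N)%N -> forall s, 0 <= s <= 1 ->
        simplex_path (tau i) s = Phi (xs i, s * ts i.+1),
      forall i, (i < N)%N ->
        is_path (simplex_path (sig i)) (Phi (xs i, ts i.+1)) (xs i.+1) /\
        exists b, simplex_path (sig i) @` `[0, 1] `<=` ball b eps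
    & represented_by z (\sum_(i < N) (<< tau i >> + << sig i >>))].

(* A (delta, T)-cycle is a closed chain with N = 1. *)
Definition associated_cycle (eps : R) (x : X) (t : R) (z : H1 R X) : Prop :=
  associated eps 1 (fun=> x) (fun=> t) z.

Variable (xi : cech1 X R).

Definition is_scale (eps delta0 : R) : Prop :=
  [/\ 0 < eps, 0 < delta0,
      forall b : X, cech_restrict (ball b (2 * eps)) xi = cech0 _ R
    & forall x y : X, mdist x y < delta0 ->
        exists (g : R -> X) (b : X),
          is_path g x y /\ g @` `[0, 1] `<=` ball b eps].

(* The scale ([eps], [delta0]) enters through [associated] and the bound on
   [delta']. *)
Definition R_xi (eps delta0 : R) : set X :=
  [set x | forall delta' T, 0 < delta' -> delta' < delta0 -> 1 < T ->
    exists N xs ts, is_chain delta' T N xs ts x x /\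
      forall z, associated eps N xs ts z -> pairing xi z = 0].

Definition C_xi (eps delta0 : R) : set X :=
  chain_recurrent `\` R_xi eps delta0.

Definition trajectory_integral (w : closed_form R X) (x : X) (t : R) : R :=
  integral w (fun s => Phi (x, s * t)).

Definition is_lyapunov_form (w : closed_form R X) : Prop :=
  forall x t, 0 < t -> trajectory_integral w x t < 0.

End Dynamics.

Section Circle.
Variable (R : realType).

Definition Cplx : numFieldType := R[i]%C.

Definition circle : set Cplx := [set z | `|z| = 1].

Definition expi (a : R) : Cplx := (cos a +i* sin a)%C.

Definition counterclockwise_generator (z : H1 R circle) : Prop :=
  exists2 s : simplex R circle 1, represented_by z << s >> &
    forall t, 0 <= t <= 1 -> val (simplex_path s t) = expi (2 * pi * t).

(* The class in H^1(S^1; Z) with value 1 on the counterclockwise generator of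
   H_1(S^1; Z), which exists and is unique. *)
Definition fundamental_class : cech1 circle int :=
  xget (cech0 _ _) [set mu | forall z,
    counterclockwise_generator z -> pairing (cech_real R mu) z = 1].

End Circle.

Arguments circle : clear implicits.
Arguments fundamental_class : clear implicits.

Definition homeomorphism (X Y : topologicalType) (f : X -> Y) : Prop :=
  continuous f /\
  exists g : Y -> X, [/\ continuous g, cancel f g & cancel g f].

Definition locally_trivial (X Y : topologicalType) (p : X -> Y) : Prop :=
  forall y, exists V : set Y, [/\ open V, V y &
    exists (F : topologicalType) (h : (p @^-1` V : set X) -> (V : Type) * F),
      homeomorphism h /\ forall x, val (h x).1 = p (val x)].

Definition local_homeomorphism (X Y : topologicalType) (f : X -> Y) : Prop :=
  forall x, exists U : set X, [/\ open U, U x, open (f @` U) &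
    exists g : Y -> X, [/\ {within U, continuous f},
      {within f @` U, continuous g} & forall y, U y -> g (f y) = y]].

Definition cross_section (R : realType) (X : metricType R) (Phi : X * R -> X)
    (K : set X) : Prop :=
  let f := fun z : (K : Type) * R => Phi (val z.1, z.2) in
  [/\ closed K, forall y, exists z, f z = y & local_homeomorphism f].

(* Continuous branches of the argument along a trajectory exist and differ by a
   constant, so it is enough to ask that some branch [a] be differentiable
   with negative derivative. *)
Definition arg_decreasing (R : realType) (X : metricType R) (Phi : X * R -> X)
    (p : X -> circle R) : Prop :=
  forall x : X, exists a : R -> R,
  [/\ continuous a, forall t, val (p (Phi (x, t))) = expi (a t),
      forall t, derivable a t 1 & forall t, derive1 a t < 0].

(* Main.v *)
(* Integrating a form w representing xi along trajectories gives a jointly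
   continuous cocycle A(x,t), and everything is governed by its sign. Replacing w
   by w + df, with f(x) the mean of A(x,s) over 0 <= s <= T, turns the derivative
   of A(x,.) at t into A(x.t,T)/T; hence a Lyapunov form exists (and may be taken
   smooth along trajectories) as soon as A(.,T) < 0 for one T, and by compactness
   as soon as every A(x,.) falls below -1. Condition (i) forces this: if A(x,.)
   stays above -1, then so does A(y,.) for some omega-limit point y of x, which is
   chain recurrent, while each almost-return of y closes up to a cycle on which
   xi is at most -1. Conversely a Lyapunov form tends to -infinity uniformly along
   trajectories, and the short closing paths contribute little.
   For integral xi the local primitives of w can be chosen to differ by integers,
   so their exponentials glue to a map to the circle; conversely the angle form
   of a fibration is a Lyapunov form. As A(x,.) decreases from +infinity to
   -infinity, the time at which it takes a given value depends continuously on x,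
   which gives the local trivializations and the cross sections. *)
Require Import Defs.
From HB Require Import structures.
From mathcomp Require Import all_boot all_order all_algebra.
From mathcomp Require Import generic_quotient ring lra.
From mathcomp Require Import all_classical all_reals all_analysis.
From mathcomp Require Import complex freeg.
(* MathComp-Analysis has an [integral] of its own. *)
Import Defs.
Set Implicit Arguments.
Unset Strict Implicit.
Unset Printing Implicit Defensive.
Import Order.TTheory GRing.Theory Num.Theory.
Import numFieldNormedType.Exports.

Local Open Scope classical_set_scope.
Local Open Scope ring_scope.

(** * Integration of closed one-forms along paths *)

Section Continuity.

(** The integral, the pairing and the fundamental class are values picked by [xget], and each needs
    its own uniqueness argument. For the integral it is local: two functions with the same local
    increments differ by a constant. For the pairing it is invariance under exact forms and
    boundaries; its default value 0 also lets condition (i) produce a closed form in the class,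
    since a value at most -1 is not the default. For the fundamental class, an integral class on the
    circle with value 1 on the generator must be the class of the angle.

    Closing paths lie in balls of radius [eps] but can be long, so their integrals are not small a
    priori. On balls of radius [2 * eps] the form has a primitive, so only the end points matter,
    and shrinking [delta] makes the integrals small: at most 1/2 when decay is deduced from (i),
    which leaves -1/2; at most 1 in the converse, against a decay of -2.

    Averaging serves twice: it produces the Lyapunov form, and it makes a given one, whose integrals
    merely decrease, differentiable along trajectories before it is turned into a fibration. *)

Lemma continuous_pair (T U V : topologicalType) (f : T -> U) (g : T -> V) :
  continuous f -> continuous g -> continuous (fun x => (f x, g x)).
Proof. by move=> cf cg x; apply: cvg_pair => /=; [exact: cf | exact: cg]. Qed.

Lemma continuous_slicel (T U V : topologicalType) (F : T * U -> V) (u : U) :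
  continuous F -> continuous (fun t => F (t, u)).
Proof.
move=> cF t; apply: (@continuous_comp _ _ _ (fun t => (t, u)) F); last exact: cF.
apply: continuous_pair; first by move=> ?; exact: cvg_id.
exact: cst_continuous.
Qed.

Lemma continuous_slicer (T U V : topologicalType) (F : T * U -> V) (t : T) :
  continuous F -> continuous (fun u => F (t, u)).
Proof.
move=> cF u; apply: (@continuous_comp _ _ _ (fun u => (t, u)) F); last exact: cF.
apply: continuous_pair; first exact: cst_continuous.
by move=> ?; exact: cvg_id.
Qed.

End Continuity.

Section LocallyConstant.
Context (R : realType).

Lemma within_itv_near (X : topologicalType) (a b : R) (g : R -> X) (t : R)
    (U : set X) :
  {within `[a, b], continuous g} -> a <= t <= b -> nbhs (g t) U ->
  \forall s \near t, a <= s <= b -> U (g s).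
Proof.
move=> /subspace_continuousP cg tab Ugt.
have tab' : t \in `[a, b] by rewrite in_itv.
have : \forall s \near t, s \in `[a, b] -> U (g s).
  exact: cg t tab' _ Ugt.
by apply: filterS => s Us sab; apply: Us; rewrite in_itv.
Qed.

(** Retraction of the line onto [[a, b]]: composing with it turns continuity within the segment into
    continuity on the whole line. *)
Definition clamp (a b t : R) : R := Num.max a (Num.min b t).

Lemma clamp_itv (a b t : R) : a <= b -> a <= clamp a b t <= b.
Proof.
by move=> ab; rewrite /clamp le_max lexx /= ge_max ab /= ge_min lexx.
Qed.

Lemma clamp_id (a b t : R) : a <= t <= b -> clamp a b t = t.
Proof.
by case/andP => ta tb; rewrite /clamp (min_idPr tb) (max_idPr ta).
Qed.

Lemma clamp_continuous (a b : R) : continuous (clamp a b).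
Proof.
move=> t; apply: continuous_max; first exact: cvg_cst.
by apply: continuous_min; [exact: cvg_cst | exact: cvg_id].
Qed.

(** The indicator [d] of the set where [f] takes the value [f a] has derivative 0, hence is
    constant. As [T] is arbitrary, this connectedness argument also applies to propositions. *)
Lemma locally_constant_cst (T : Type) (f : R -> T) (a b : R) :
  (forall t, \forall s \near t, f s = f t) -> f a = f b.
Proof.
move=> f_lc; pose d t : R := if pselect (f t = f a) then 1 else 0.
have dE t : f t = f a -> d t = 1 by rewrite /d; case: pselect.
suff : d b = d a.
  by rewrite (dE a erefl) /d; case: pselect => // _ /esym/eqP; rewrite oner_eq0.
apply: is_derive_0_is_cst => t.
have dt : \forall s \near t, d s = d t.
  by near=> s; rewrite /d (_ : f s = f t) //; near: s; exact: f_lc.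
apply: near_eq_is_derive (is_derive_cst (d t) t 1).
by apply: filterS dt => s ->.
Unshelve. all: by end_near. Qed.

Lemma locally_constant_segment (T : Type) (f : R -> T) (a b : R) :
  a <= b ->
  (forall t, a <= t <= b -> \forall s \near t, a <= s <= b -> f s = f t) ->
  f a = f b.
Proof.
move=> ab f_lc.
have aab : a <= a <= b by rewrite lexx ab.
have bab : a <= b <= b by rewrite lexx ab.
have := @locally_constant_cst _ (f \o clamp a b) a b.
rewrite /= !clamp_id //; apply => t.
have : \forall s \near t, a <= clamp a b s <= b ->
    f (clamp a b s) = f (clamp a b t).
  exact: @clamp_continuous a b t _ (f_lc _ (clamp_itv t ab)).
by apply: filterS => s; apply; exact: clamp_itv.
Qed.

End LocallyConstant.

Section PathIntegral.
Context (R : realType) (X : topologicalType) (w : closed_form R X).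
Implicit Types (g : R -> X) (f : R -> R).

(** A primitive of the form pulled back along [g], characterized locally so that integrals can be
    compared without subdivisions. *)
Definition path_primitive g f := forall t U,
  0 <= t <= 1 -> fcover w U -> U (g t) ->
  \forall s \near t, 0 <= s <= 1 -> f s - f t = fphi w U (g s) - fphi w U (g t).

Lemma form_cover x : exists2 U, fcover w U & U x.
Proof.
have [_ cov] := fcover_open w.
by have : (\bigcup_(U in fcover w) U) x by rewrite cov.
Qed.

Lemma form_nbhs U x : fcover w U -> U x -> nbhs x U.
Proof.
by move=> cU Ux; apply: open_nbhs_nbhs; split=> //;
  have [oc _] := fcover_open w; exact: oc.
Qed.

Lemma form_transition U V x : fcover w U -> fcover w V -> U x -> V x ->
  \forall y \near x, fphi w U y - fphi w U x = fphi w V y - fphi w V x.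
Proof.
move=> cU cV Ux Vx.
have UVn : nbhs x (U `&` V) by apply: filterI; exact: form_nbhs.
have := fphi_locally_constant cU cV (conj Ux Vx); apply: filterS2 UVn.
by move=> y UVy /(_ UVy); lra.
Qed.

(** Lebesgue number argument: by compactness one [n] serves all base points [t], so pieces of length
    [1 / n] are mapped into single members of the cover. *)
Lemma uniform_subdivision g : {within `[0, 1], continuous g} ->
  exists (n : nat) (U : nat -> set X), (0 < n)%N /\
  forall i, (i < n)%N -> fcover w (U i) /\
    forall t, i%:R / n%:R <= t <= i.+1%:R / n%:R -> U i (g t).
Proof.
move=> cg.
have /compact_near_coveringP cov := @segment_compact R 0 1.
pose P (n : nat) (t : R) := exists2 U, fcover w U &
  forall s, 0 <= s <= 1 -> `|t - s| <= n.+1%:R^-1 -> U (g s).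
have : \forall n \near \oo, `[0, 1] `<=` P n.
  apply: cov => t t01; have {}t01 : 0 <= t <= 1 by move: t01; rewrite /= in_itv.
  have [U cU Ut] := form_cover (g t).
  have /nbhs_ballP[e /= e0 eU] := within_itv_near cg t01 (form_nbhs cU Ut).
  exists (ball t (e / 2), [set n | (n.+1%:R^-1 : R) < e / 2]) => /=.
    split; first by apply: nbhsx_ballx; rewrite divr_gt0.
    have e2 : 0 < e / 2 by rewrite divr_gt0.
    exact: near_infty_natSinv_lt (PosNum e2).
  move=> [t' n] /= [tt' ne]; exists U => // s s01 ts; apply: eU => //.
  rewrite /ball /= in tt' *.
  by rewrite -(subrKA t') (le_lt_trans (ler_normD _ _))// (splitr e) ltrD// (le_lt_trans ts).
move=> [n _ nP]; exists n.+1.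
have {}nP t : 0 <= t <= 1 -> P n t.
  by move=> t01; apply: (nP n (leqnn n)); rewrite /= in_itv.
have n0 : 0 < n.+1%:R :> R by rewrite ltr0n.
have iP (i : nat) : exists U, (i < n.+1)%N -> fcover w U /\
    forall t, i%:R / n.+1%:R <= t <= i.+1%:R / n.+1%:R -> U (g t).
  have [i_n|] := ltnP i n.+1; last by exists set0.
  have i01 : 0 <= (i%:R / n.+1%:R : R) <= 1.
    by rewrite ler_pdivlMr // mul0r ler0n ler_pdivrMr // mul1r ler_nat ltnW.
  have [U cU gU] := nP _ i01; exists U => _; split => // t /andP[it ti].
  apply: gU.
    case/andP: i01 => i0 _; rewrite (le_trans i0 it) /= (le_trans ti)//.
    by rewrite ler_pdivrMr // mul1r ler_nat.
  rewrite distrC ger0_norm ?subr_ge0// lerBlDr (le_trans ti)//.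
  by rewrite -natr1 mulrDl mul1r addrC.
by have [U UP] := choice iP; exists U.
Qed.

End PathIntegral.

Section PathIntegralTheory.
Context (R : realType) (X : topologicalType) (w : closed_form R X).
Implicit Types (g : R -> X) (f : R -> R).

Lemma subdivision_itv (t : nat -> R) (N : nat) :
  t 0%N = 0 -> t N = 1 -> (forall i, (i < N)%N -> t i < t i.+1) ->
  forall i s, (i < N)%N -> t i <= s <= t i.+1 -> 0 <= s <= 1.
Proof.
move=> t0 tN tlt.
have t_le i j : (i <= j <= N)%N -> t i <= t j.
  elim: j => [|j IH]; first by rewrite leqn0 => /andP[/eqP ->].
  rewrite leq_eqVlt => /andP[/predU1P[->//|ij] jN].
  by rewrite (le_trans (IH _)) ?(ltW (tlt _ _)) // -ltnS ij ltnW.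
move=> i s iN /andP[is1 is2]; rewrite -t0 -tN.
have i0 : t 0%N <= t i by apply: t_le; exact: ltnW.
have i1 : t i.+1 <= t N by apply: t_le; rewrite iN leqnn.
by rewrite (le_trans i0) // (le_trans is2).
Qed.

Lemma integral_sum_exists g : {within `[0, 1], continuous g} ->
  exists v, integral_sum w g v.
Proof.
move=> /(uniform_subdivision w)[n [U [n0 Ug]]].
have n0' : 0 < n%:R :> R by rewrite ltr0n.
exists (\sum_(i < n) (fphi w (U i) (g (i.+1%:R / n%:R)) -
  fphi w (U i) (g (i%:R / n%:R)))), n, (fun i => i%:R / n%:R), U.
split=> [|||i /Ug[cU gU]|//].
- by rewrite mul0r.
- by rewrite divff // gt_eqF.
- by move=> i _; rewrite ltr_pM2r ?invr_gt0 // ltr_nat.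
- by split=> // _ [t + <-]; rewrite /= in_itv; exact: gU.
Qed.

(** On a piece mapped into [U i], [f] minus the local primitive is locally constant, so the sum
    telescopes to the increment of [f]. This is the independence of the subdivision behind
    [integral]. *)
Lemma path_primitive_integral_sum g f v :
  path_primitive w g f -> integral_sum w g v -> v = f 1 - f 0.
Proof.
move=> fP [N [t [U [t0 tN tlt Ut ->]]]].
have ts01 := subdivision_itv t0 tN tlt.
have -> : f 1 - f 0 = f (t N) - f (t 0%N) by rewrite t0 tN.
rewrite -(telescope_sumr (fun i => f (t i))) // big_mkord.
apply: eq_bigr => -[i iN] _ /=.
have [cU gU] := Ut i iN.
have gUt s : t i <= s <= t i.+1 -> U i (g s).
  by move=> ts; apply: gU; exists s => //; rewrite /= in_itv.
suff : f (t i) - fphi w (U i) (g (t i)) = f (t i.+1) - fphi w (U i) (g (t i.+1)).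
  by lra.
have titi : t i <= t i.+1 by rewrite ltW // tlt.
apply: (@locally_constant_segment _ _
  (fun s => f s - fphi w (U i) (g s))) => // s ts.
have := fP s (U i) (ts01 _ _ iN ts) cU (gUt _ ts).
by apply: filterS => r + tr; move=> /(_ (ts01 _ _ iN tr)); lra.
Qed.

(** Built piece by piece: past [c j] the primitive continues as the local primitive on [U j],
    shifted to agree at [c j]. At the junction both sides must be checked, hence the three cases. *)
Lemma path_primitive_exists g : {within `[0, 1], continuous g} ->
  exists f, path_primitive w g f.
Proof.
move=> cg; have [n [U [n0 Ug]]] := uniform_subdivision w cg.
have n0' : 0 < n%:R :> R by rewrite ltr0n.
pose c (j : nat) : R := j%:R / n%:R.
have c01 j : (j <= n)%N -> 0 <= c j <= 1.
  by move=> jn; rewrite ler_pdivlMr // mul0r ler0n ler_pdivrMr // mul1r ler_nat.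
suff : forall j, (j <= n)%N -> exists f, forall t V,
    0 <= t <= c j -> fcover w V -> V (g t) ->
    \forall s \near t, 0 <= s <= c j ->
      f s - f t = fphi w V (g s) - fphi w V (g t).
  by move=> /(_ n (leqnn n)); rewrite /c divff ?gt_eqF.
elim=> [_|j IH jn].
  exists (fun _ => 0) => t V; rewrite /c mul0r => t0 _ _; near=> s => s0.
  have -> : s = t by apply/eqP; rewrite eq_le; lra.
  by rewrite !subrr.
have [f fP] := IH (ltnW jn).
have [cU gU] := Ug j jn.
have cj : c j <= c j.+1 by rewrite ler_pM2r ?invr_gt0 // ler_nat.
have [/andP[c0 c1] /andP[c0' c1']] := (c01 j (ltnW jn), c01 j.+1 jn).
pose p := fphi w (U j).
exists (fun s => if s <= c j then f s else f (c j) + (p (g s) - p (g (c j)))).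
move=> t V t01 cV Vt.
have gUt s : c j <= s <= c j.+1 -> U j (g s) by exact: gU.
have trans : c j <= t -> \forall s \near t, 0 <= s <= 1 ->
    fphi w V (g s) - fphi w V (g t) = p (g s) - p (g t).
  move=> ct.
  have gt01 : 0 <= t <= 1 by lra.
  apply: (@within_itv_near _ _ 0 1 g t
    [set y | fphi w V y - fphi w V (g t) = p y - p (g t)]) => //.
  by apply: form_transition => //; apply: gUt; lra.
have [tc|ct|tc] := ltgtP t (c j).
- have t0c : 0 <= t <= c j by lra.
  near=> s => s01.
  have sc : s < c j by near: s; exact: lt_nbhsl.
  rewrite (ltW sc); have : 0 <= s <= c j by lra.
  by near: s; exact: fP.
- near=> s => s01.
  have sc : c j < s by near: s; exact: lt_nbhsr.
  rewrite leNgt sc /= (_ : fphi w V (g s) - _ = p (g s) - p (g t)); first by lra.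
  have : 0 <= s <= 1 by lra.
  by near: s; apply: trans; exact: ltW.
- have t0c : 0 <= t <= c j by lra.
  near=> s => s01.
  have [sc|cs] := leP s (c j).
    have : 0 <= s <= c j by lra.
    by near: s; exact: fP.
  rewrite (_ : fphi w V (g s) - _ = p (g s) - p (g t)); first by rewrite tc; lra.
  have : 0 <= s <= 1 by lra.
  by near: s; apply: trans; rewrite tc.
Unshelve. all: by end_near. Qed.

Lemma path_primitive_integral g f : {within `[0, 1], continuous g} ->
  path_primitive w g f -> integral w g = f 1 - f 0.
Proof.
move=> cg fP; have [v vP] := integral_sum_exists cg.
apply: path_primitive_integral_sum fP _.
exact: (@xgetPex _ 0 (integral_sum w g) (ex_intro _ v vP)).
Qed.

Lemma integral_sum_integral g v : {within `[0, 1], continuous g} ->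
  integral_sum w g v -> integral w g = v.
Proof.
move=> cg gv; have [f fP] := path_primitive_exists cg.
by rewrite (path_primitive_integral cg fP) (path_primitive_integral_sum fP gv).
Qed.

Lemma integral_sum_ext g h v : (forall t, 0 <= t <= 1 -> g t = h t) ->
  integral_sum w g v -> integral_sum w h v.
Proof.
move=> gh [N [t [U [t0 tN tlt Ut ->]]]]; exists N, t, U.
have ts01 := subdivision_itv t0 tN tlt.
have ghE i s : (i < N)%N -> t i <= s <= t i.+1 -> g s = h s.
  by move=> iN si; apply: gh; exact: ts01 si.
have ts i : (i < N)%N -> t i <= t i.+1 by move=> iN; rewrite ltW ?tlt.
split=> // [i iN|].
  have [cU gU] := Ut i iN; split=> // _ [s + <-]; rewrite /= in_itv => /= si.
  by rewrite -(ghE i) //; apply: gU; exists s => //; rewrite /= in_itv.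
apply: eq_bigr => -[i iN] _ /=.
by rewrite !(ghE i) ?lexx ?ts.
Qed.

Lemma eq_integral_path g h : (forall t, 0 <= t <= 1 -> g t = h t) ->
  integral w g = integral w h.
Proof.
move=> gh; congr xget; apply/seteqP; split => v; apply: integral_sum_ext => //.
by move=> t t01; rewrite gh.
Qed.

End PathIntegralTheory.

(** * Dependence of the integral on parameters *)

Section ParametricIntegral.
Context (R : realType) (X : topologicalType) (w : closed_form R X).

(** Tube lemma: compactness of the segment makes the neighbourhood of [y0] uniform in [t]. *)
Lemma near_segment (Y : topologicalType) (F : Y * R -> X) (y0 : Y)
    (a b : R) (U : set X) : continuous F -> open U ->
  (forall t, a <= t <= b -> U (F (y0, t))) ->
  \forall y \near y0, forall t, a <= t <= b -> U (F (y, t)).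
Proof.
move=> cF oU UF.
have /compact_near_coveringP cov := @segment_compact R a b.
have H : forall t, `[a, b]%classic t ->
    \forall t' \near t & y \near y0, U (F (y, t')).
  move=> t; rewrite /= in_itv => /= tab.
  have := cF (y0, t) _ (open_nbhs_nbhs (conj oU (UF t tab))).
  move=> [[P Q] /= [Py Qt] PQ]; exists (Q, P) => // -[t' y] [/= Qt' Py'].
  exact: (PQ (y, t')).
have Hn : nbhs y0 [set y | `[a, b] `<=` [set t | U (F (y, t))]].
  exact: cov Y (nbhs y0) (fun y t => U (F (y, t))) _ H.
by apply: filterS Hn => y Hy t tab; apply: (Hy t); rewrite /= in_itv.
Qed.

(* A subdivision adapted to the path at [y0] is adapted to the paths at nearby
   [y], so the difference of the two sums telescopes. *)
Lemma near_integral (Y : topologicalType) (F : Y * R -> X) (y0 : Y)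
    (U V : set X) : continuous F ->
  fcover w U -> U (F (y0, 1)) -> fcover w V -> V (F (y0, 0)) ->
  \forall y \near y0,
    integral w (fun s => F (y, s)) - integral w (fun s => F (y0, s)) =
    (fphi w U (F (y, 1)) - fphi w U (F (y0, 1))) -
    (fphi w V (F (y, 0)) - fphi w V (F (y0, 0))).
Proof.
move=> cF cU Uy0 cV Vy0.
have cg y : {within `[0, 1], continuous (fun s => F (y, s))}.
  by apply: continuous_subspaceT; exact: continuous_slicer.
have [n [W [n0 Wg]]] := uniform_subdivision w (cg y0).
have n0' : 0 < n%:R :> R by rewrite ltr0n.
pose c (j : nat) : R := j%:R / n%:R.
have tube : \forall y \near y0, forall i : 'I_n,
    forall t, c i <= t <= c i.+1 -> W i (F (y, t)).
  apply: (@filter_forall _ _ (fun (i : 'I_n) y =>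
    forall t, c i <= t <= c i.+1 -> W i (F (y, t)))) => i.
  have [cW gW] := Wg i (ltn_ord i).
  apply: (@near_segment Y F y0 (c i) (c i.+1) (W i)) => //.
  have [oc _] := fcover_open w; exact: oc.
have IE y : (forall i : 'I_n, forall t, c i <= t <= c i.+1 -> W i (F (y, t))) ->
    integral w (fun s => F (y, s)) =
    \sum_(i < n) (fphi w (W i) (F (y, c i.+1)) - fphi w (W i) (F (y, c i))).
  move=> Wy; apply: integral_sum_integral => //; exists n, c, W; split => //.
  - by rewrite /c mul0r.
  - by rewrite /c divff // gt_eqF.
  - by move=> i _; rewrite ltr_pM2r ?invr_gt0 // ltr_nat.
  - move=> i iN; split; first by have [] := Wg i iN.
    by move=> _ [t + <-]; rewrite /= in_itv; exact: (Wy (Ordinal iN)).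
have c0 : c 0%N = 0 by rewrite /c mul0r.
have cn : c n = 1 by rewrite /c divff // gt_eqF.
pose d (A : set X) j y := fphi w A (F (y, c j)) - fphi w A (F (y0, c j)).
have trans A B j : fcover w A -> fcover w B ->
    A (F (y0, c j)) -> B (F (y0, c j)) -> \forall y \near y0, d A j y = d B j y.
  move=> cA cB Ay By; have := form_transition cA cB Ay By.
  exact: (@continuous_slicel _ _ _ F (c j) cF y0).
(* Quantifying over the set [T] used at the right end lets the induction pass from [W j] to any
   other member of the cover: near [y0] the two local primitives have the same increments. *)
suff H j : (j <= n)%N -> forall T, fcover w T -> T (F (y0, c j)) ->
    \forall y \near y0,
      \sum_(i < j) (d (W i) i.+1 y - d (W i) i y) = d T j y - d V 0%N y.
  rewrite -cn in Uy0.
  near=> y; rewrite !IE.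
  - rewrite -sumrB; transitivity (d U n y - d V 0%N y).
      rewrite -(near (H n (leqnn n) U cU Uy0) y) //.
      by apply: eq_bigr => i _; rewrite /d; lra.
    by rewrite /d c0 cn.
  - by move=> i; have [] := Wg i (ltn_ord i).
  - by near: y; exact: tube.
elim: j => [_ T cT Ty|j IH jn T cT Ty].
  rewrite c0 in Ty.
  have := trans T V 0%N cT cV; rewrite c0 => /(_ Ty Vy0).
  by apply: filterS => y ->; rewrite big_ord0 subrr.
have [cW gW] := Wg j jn.
have cj : c j <= c j.+1 by rewrite ler_pM2r ?invr_gt0 // ler_nat.
have Wj : W j (F (y0, c j)) by apply: gW; rewrite lexx cj.
have Wj1 : W j (F (y0, c j.+1)) by apply: gW; rewrite lexx cj.
have := IH (ltnW jn) (W j) cW Wj; apply: filterS2 (trans T (W j) j.+1 cT cW Ty Wj1).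
by move=> y -> IHy; rewrite big_ord_recr /= IHy; lra.
Unshelve. all: by end_near. Qed.

Lemma integral_param_continuous (Y : topologicalType) (F : Y * R -> X) :
  continuous F -> continuous (fun y => integral w (fun s => F (y, s))).
Proof.
move=> cF y0; have [U cU Uy] := form_cover w (F (y0, 1)).
have [V cV Vy] := form_cover w (F (y0, 0)).
have cFt t : continuous (fun y => F (y, t)).
  exact: continuous_slicel.
pose h y := integral w (fun s => F (y0, s)) +
  ((fphi w U (F (y, 1)) - fphi w U (F (y0, 1))) -
    (fphi w V (F (y, 0)) - fphi w V (F (y0, 0)))).
have hI : \forall y \near y0, h y = integral w (fun s => F (y, s)).
  have := near_integral cF cU Uy cV Vy.
  by apply: filterS => y; rewrite /h; lra.
have hy0 : h y0 = integral w (fun s => F (y0, s)) by rewrite /h !subrr addr0.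
suff hc : h @ y0 --> h y0.
  by rewrite hy0 in hc; apply: cvg_trans hc; exact: near_eq_cvg.
apply: cvgD; first exact: cvg_cst.
by apply: cvgB; (apply: cvgB; last exact: cvg_cst);
  apply: (@continuous_comp _ _ _ (fun y => F (y, _))); [exact: cFt
  | exact: fphi_continuous | exact: cFt | exact: fphi_continuous].
Qed.

End ParametricIntegral.

(** * Cech classes of closed one-forms *)

Section ZmodIdentities.
Context (A : zmodType).

Lemma coboundary_shift (h h' d e f g : A) :
  h' - h = d - g -> h + (d + e) - (g + f) = h' + e - f.
Proof.
move=> /eqP; rewrite eq_sym subr_eq => /eqP ->.
by rewrite !addrA [h + h']addrC addrK [h' + g + e]addrAC addrKA.
Qed.

Lemma coboundary_diff (h p q r s : A) :
  q - s = h + (p + q) - (r + s) - (h + p - r).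
Proof.
apply/eqP; rewrite eq_sym subr_eq addrA; apply/eqP.
by rewrite addrACA -opprD [s + r]addrC [q + _]addrC.
Qed.

End ZmodIdentities.

Section CechBridges.
Context (X : topologicalType) (A : zmodType).
Implicit Types (c : cocycle X A).

Definition bridge c c' (k : set X -> set X -> X -> A) :=
  (forall U U', ccover c U -> ccover c' U' ->
     locally_constant (U `&` U') (k U U')) /\
  (forall U V U' V' x, ccover c U -> ccover c V -> ccover c' U' ->
     ccover c' V' -> U x -> V x -> U' x -> V' x ->
     cval c' U' V' x - cval c U V x = k V V' x - k U U' x).

Lemma cocycle_cover c x : exists2 U, ccover c U & U x.
Proof.
have [_ cov] := ccover_open c.
by have : (\bigcup_(U in ccover c) U) x by rewrite cov.
Qed.

Lemma cocycle_nbhs c U x : ccover c U -> U x -> nbhs x U.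
Proof.
move=> cU Ux; apply: open_nbhs_nbhs; split=> //.
by have [oc _] := ccover_open c; exact: oc.
Qed.

Lemma locally_constant_near (T : Type) (D : set X) (f : X -> T) x :
  locally_constant D f -> D x -> nbhs x D -> \forall y \near x, f y = f x.
Proof. by move=> fD Dx; apply: filterS2 (fD x Dx) => y /[apply]. Qed.

Lemma near_locally_constant (T : Type) (D : set X) (f : X -> T) :
  (forall x, D x -> \forall y \near x, f y = f x) -> locally_constant D f.
Proof. by move=> fD x /fD; apply: filterS. Qed.

Lemma cohomologousP c c' : cohomologous c c' <-> exists k, bridge c c' k.
Proof.
split=> [[C [a [b [h [[oC covC] Cab Ch]]]]]|[k [klc kE]]].
  have /choice[W WP] (x : X) : exists W, C W /\ W x.
    have : (\bigcup_(W in C) W) x by rewrite covC.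
    by move=> [W CW Wx]; exists W.
  have Ca V : C V -> ccover c (a V) by case/Cab.
  have Cb V : C V -> ccover c' (b V) by case/Cab.
  have aW V x : C V -> V x -> a V x by case/Cab => _ _ + _ => /[apply] -[].
  have bW V x : C V -> V x -> b V x by case/Cab => _ _ + _ => /[apply] -[].
  (* The cochain [h V] carried over to the pair [U], [U'] by the two cocycles; [k'E] shows that the
     choice of [V] does not matter. *)
  pose k' V U U' x := h V x + cval c' (b V) U' x - cval c (a V) U x.
  have k'E V V' U U' x : C V -> C V' -> V x -> V' x -> ccover c U ->
      ccover c' U' -> U x -> U' x -> k' V U U' x = k' V' U U' x.
    move=> CV CV' Vx V'x cU cU' Ux U'x; rewrite /k'.
    rewrite -(cval_cocycle (Ca _ CV) (Ca _ CV') cU (aW _ _ CV Vx) (aW _ _ CV' V'x) Ux).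
    rewrite -(cval_cocycle (Cb _ CV) (Cb _ CV') cU' (bW _ _ CV Vx) (bW _ _ CV' V'x) U'x).
    by apply: coboundary_shift; rewrite Ch.
  exists (fun U U' x => k' (W x) U U' x); rewrite /bridge; split.
    move=> U U' cU cU'; apply: near_locally_constant => x [Ux U'x].
    have [CW Wx] := WP x.
    have nW : nbhs x (W x) by apply: open_nbhs_nbhs; split => //; exact: oC.
    have [_ _ _ hW] := Cab _ CW.
    have h1 := locally_constant_near hW Wx nW.
    have nU := cocycle_nbhs cU Ux; have nU' := cocycle_nbhs cU' U'x.
    have na := cocycle_nbhs (Ca _ CW) (aW _ _ CW Wx).
    have nb := cocycle_nbhs (Cb _ CW) (bW _ _ CW Wx).
    have h2 : \forall y \near x, cval c' (b (W x)) U' y = cval c' (b (W x)) U' x.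
      apply: (locally_constant_near (cval_locally_constant (Cb _ CW) cU')).
        by split=> //; exact: bW.
      exact: filterI.
    have h3 : \forall y \near x, cval c (a (W x)) U y = cval c (a (W x)) U x.
      apply: (locally_constant_near (cval_locally_constant (Ca _ CW) cU)).
        by split=> //; exact: aW.
      exact: filterI.
    near=> y; have [CWy Wy] := WP y.
    rewrite (@k'E (W y) (W x)) //.
    - have e1 : h (W x) y = h (W x) x by near: y.
      have e2 : cval c' (b (W x)) U' y = cval c' (b (W x)) U' x by near: y.
      have e3 : cval c (a (W x)) U y = cval c (a (W x)) U x by near: y.
      by rewrite /k' e1 e2 e3.
    - exact: (near nW y).
    - exact: (near nU y).
    - exact: (near nU' y).
  move=> U V U' V' x cU cV cU' cV' Ux Vx U'x V'x.
  have [CW Wx] := WP x; rewrite /k'.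
  rewrite -(cval_cocycle (Ca _ CW) cU cV (aW _ _ CW Wx) Ux Vx).
  rewrite -(cval_cocycle (Cb _ CW) cU' cV' (bW _ _ CW Wx) U'x V'x).
  exact: coboundary_diff.
(* Conversely, the intersections form the refinement. Different pairs may have the same
   intersection, so [q] picks one. *)
pose P (W : set X) := [set p : set X * set X |
  [/\ ccover c p.1, ccover c' p.2 & p.1 `&` p.2 = W]].
pose q W := xget (set0, set0) (P W).
pose E := [set W | exists p, P W p].
have qP W : E W -> P W (q W) by move=> [p Pp]; exact: xgetPex (ex_intro _ p Pp).
have qW W x : E W -> W x -> (q W).1 x /\ (q W).2 x.
  by move=> /qP[_ _ {1}<-].
exists E, (fun W => (q W).1), (fun W => (q W).2).
exists (fun W x => k (q W).1 (q W).2 x); split.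
- split.
    move=> W [[U V] [/= cU cV <-]].
    by apply: openI; [apply: (ccover_open c).1 | apply: (ccover_open c').1].
  apply/seteqP; split => // x _.
  have [U cU Ux] := cocycle_cover c x; have [V cV Vx] := cocycle_cover c' x.
  by exists (U `&` V) => //; exists (U, V).
- move=> W EW; have [c1 c2 _] := qP _ EW; split => //.
    by move=> x /(qW _ _ EW).
  by apply: locally_constant_sub (klc _ _ c1 c2) => x /(qW _ _ EW).
- move=> W W' x EW EW' Wx W'x.
  have [c1 c2 _] := qP _ EW; have [c1' c2' _] := qP _ EW'.
  have [? ?] := qW _ _ EW Wx; have [? ?] := qW _ _ EW' W'x.
  exact: kE.
Unshelve. all: by end_near. Qed.

Lemma cech_classP c c' : cech_class c = cech_class c' <-> cohomologous c c'.
Proof. by split=> [/eqquotP/asboolP|?] //; apply/eqquotP/asboolP. Qed.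

Lemma cech_class_repr (xi : cech1 X A) : cech_class (repr xi) = xi.
Proof. exact: reprK. Qed.

End CechBridges.

Section CechFunctoriality.

Lemma cohomologous_pullback (X Y : topologicalType) (A : zmodType)
    (f : continuousType X Y) (c c' : cocycle Y A) :
  cohomologous c c' ->
  cohomologous (cocycle_pullback f c) (cocycle_pullback f c').
Proof.
move=> /cohomologousP[k [klc kE]]; apply/cohomologousP.
exists (fun V V' x => k (pull_index f c V) (pull_index f c' V') (f x)); split.
  move=> V V' cV cV'; apply: near_locally_constant => x [Vx V'x].
  have [iV _] := pull_indexP cV; have [iV' _] := pull_indexP cV'.
  have Ix := pull_index_mem cV Vx; have I'x := pull_index_mem cV' V'x.
  have : \forall z \near f x, k (pull_index f c V) (pull_index f c' V') z =
      k (pull_index f c V) (pull_index f c' V') (f x).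
    apply: (locally_constant_near (klc _ _ iV iV')) => //.
    by apply: filterI; [exact: cocycle_nbhs iV Ix | exact: cocycle_nbhs iV' I'x].
  exact: (@cts_fun _ _ f x).
move=> U V U' V' x cU cV cU' cV' Ux Vx U'x V'x /=.
by apply: kE; solve [exact: (pull_indexP cU).1 | exact: (pull_indexP cV).1
  | exact: (pull_indexP cU').1 | exact: (pull_indexP cV').1
  | exact: pull_index_mem].
Qed.

Lemma cech_pullback_class (X Y : topologicalType) (A : zmodType)
    (f : continuousType X Y) (c : cocycle Y A) :
  cech_pullback f (cech_class c) = cech_class (cocycle_pullback f c).
Proof.
apply/cech_classP/cohomologous_pullback/cech_classP.
exact: cech_class_repr.
Qed.

Lemma cech_real_class (X : topologicalType) (R : realType) (c : cocycle X int) :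
  cech_real R (cech_class c) = cech_class (cocycle_real R c).
Proof.
apply/cech_classP/cohomologousP.
have /cech_classP/cohomologousP[k [klc kE]] := cech_class_repr (cech_class c).
exists (fun U V x => (k U V x)%:~R); split.
  by move=> U V cU cV x Ux; apply: filterS (klc U V cU cV x Ux) => y ky /ky ->.
by move=> *; rewrite /= /real_val -!intrB kE.
Qed.

End CechFunctoriality.

Section FormClasses.
Context (R : realType) (X : topologicalType).
Implicit Types (w : closed_form R X) (c : cocycle X R) (f : X -> R).

Definition near_primitive w f x := forall U, fcover w U -> U x ->
  \forall y \near x, f y - f x = fphi w U y - fphi w U x.

Lemma near_primitiveW w f x U : fcover w U -> U x ->
  (\forall y \near x, f y - f x = fphi w U y - fphi w U x) ->
  near_primitive w f x.
Proof.
move=> cU Ux fU V cV Vx; apply: filterS2 fU (form_transition cU cV Ux Vx).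
by move=> y -> ->.
Qed.

Lemma near_primitive_continuous w f x :
  near_primitive w f x -> {for x, continuous f}.
Proof.
have [U cU Ux] := form_cover w x; move=> /(_ U cU Ux) fU.
suff hc : f x - fphi w U x + fphi w U y @[y --> x] -->
    f x - fphi w U x + fphi w U x.
  rewrite subrK in hc; apply: cvg_trans hc; apply: near_eq_cvg.
  by apply: filterS fU => y; lra.
by apply: cvgD; [exact: cvg_cst | exact: fphi_continuous].
Qed.

(* Adding to the local primitives of [w] the cochain that trivializes the
   difference of the two cocycles gives local primitives whose jumps are
   exactly [c]. *)
Lemma form_classP w c : form_class w = cech_class c <->
  exists psi : set X -> X -> R,
    (forall U x, ccover c U -> U x -> near_primitive w (psi U) x) /\
    (forall U V x, ccover c U -> ccover c V -> U x -> V x ->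
       cval c U V x = psi V x - psi U x).
Proof.
split=> [/cech_classP/cohomologousP[k [klc kE]]|[psi [psiP psiE]]].
  have /choice[W WP] (x : X) : exists W, fcover w W /\ W x.
    by have [W cW Wx] := form_cover w x; exists W.
  pose psi V x := fphi w (W x) x + k (W x) V x.
  have psiE' V U x : ccover c V -> V x -> fcover w U -> U x ->
      psi V x = fphi w U x + k U V x.
    move=> cV Vx cU Ux; have [cW Wx] := WP x; rewrite /psi.
    have := kE (W x) U V V x cW cU cV cV Wx Ux Vx Vx.
    by rewrite cval_id //=; lra.
  exists psi; split=> [V x cV Vx|U V x cU cV Ux Vx].
    move=> U cU Ux.
    have nU := form_nbhs cU Ux; have nV := cocycle_nbhs cV Vx.
    have kn : \forall y \near x, k U V y = k U V x.
      by apply: (locally_constant_near (klc U V cU cV)) => //; exact: filterI.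
    near=> y.
    have Uy : U y by near: y.
    have Vy : V y by near: y.
    have ky : k U V y = k U V x by near: y.
    by rewrite (psiE' V U y) // (psiE' V U x) // ky; lra.
  have [cW Wx] := WP x; rewrite /psi.
  have := kE (W x) (W x) U V x cW cW cU cV Wx Wx Ux Vx.
  by rewrite /= subrr; lra.
apply/cech_classP/cohomologousP.
exists (fun U V x => psi V x - fphi w U x); split=> [U V cU cV|].
  apply: near_locally_constant => x [Ux Vx].
  by apply: filterS (psiP V x cV Vx U cU Ux) => y; lra.
move=> U V U' V' x cU cV cU' cV' Ux Vx U'x V'x /=.
by rewrite (psiE U' V') //; lra.
Unshelve. all: by end_near. Qed.

(** This is [w' - w = df], expressed through local primitives. *)
Definition near_form_difference w w' f := forall x U U',
  fcover w U -> U x -> fcover w' U' -> U' x -> \forall y \near x,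
    f y - f x = (fphi w' U' y - fphi w' U' x) - (fphi w U y - fphi w U x).

(** The form [w] has local primitives [psi] with the same jumps as those of [w'], so the differences
    agree on overlaps and glue to [f]. *)
Lemma form_class_difference w w' : form_class w = form_class w' ->
  exists f, near_form_difference w w' f.
Proof.
move=> /form_classP[psi [psiP psiE]].
have /choice[W WP] (x : X) : exists W, fcover w' W /\ W x.
  by have [W cW Wx] := form_cover w' x; exists W.
pose f x := fphi w' (W x) x - psi (W x) x.
have fE V x : fcover w' V -> V x -> f x = fphi w' V x - psi V x.
  move=> cV Vx; have [cW Wx] := WP x.
  by have := psiE (W x) V x cW cV Wx Vx; rewrite /f /=; lra.
exists f => x U U' cU Ux cU' U'x.
apply: filterS2 (psiP U' x cU' U'x U cU Ux) (form_nbhs cU' U'x) => y e U'y.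
by rewrite (fE U') // (fE U' x) //; lra.
Qed.

(** A trivialization [k] of the restricted cocycle, added to local primitives of [w] with jumps [c],
    removes the jumps, so the sums glue over [B]. Openness of [B] turns neighbourhoods in the
    subspace into neighbourhoods in [X]; the value 0 outside [B] is a default. *)
Lemma restrict_primitive w (B : set X) : open B ->
  cech_restrict B (form_class w) = cech0 B R ->
  exists f, forall x, B x -> near_primitive w f x.
Proof.
set c := repr (form_class w) => oB /cech_classP/cohomologousP[k [klc kE]].
have /form_classP[psi [psiP psiE]] : form_class w = cech_class c.
  by rewrite cech_class_repr.
pose i : continuousType B X := mkcts (@set_val_continuous X B).
have /choice[V VP] (x : B) : exists V, pull_cover i c V /\ V x.
  by have [V cV Vx] := cocycle_cover (cocycle_pullback i c) x; exists V.
pose g (x : B) := psi (pull_index i c (V x)) (val x) + k (V x) setT x.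
have gE (x : B) W : pull_cover i c W -> W x ->
    g x = psi (pull_index i c W) (val x) + k W setT x.
  move=> cW Wx; have [cV Vx] := VP x.
  have := kE (V x) W setT setT x cV cW erefl erefl Vx Wx I I.
  rewrite /= (psiE (pull_index i c (V x)) (pull_index i c W)).
  - by rewrite /g; lra.
  - exact: (pull_indexP cV).1.
  - exact: (pull_indexP cW).1.
  - exact: pull_index_mem cV Vx.
  - exact: pull_index_mem cW Wx.
pose f x := if pselect (B x) is left Bx then g (exist _ x (mem_set Bx)) else 0.
have fE x (Bx : B x) : f x = g (exist _ x (mem_set Bx)).
  by rewrite /f; case: pselect => // Bx'; congr g; exact: val_inj.
exists f => x Bx.
pose x' : B := exist _ x (mem_set Bx).
have [cV Vx] := VP x'.
have [cI _] := pull_indexP cV.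
have Ix : pull_index i c (V x') x by exact: (pull_index_mem cV Vx).
have [U cU Ux] := form_cover w x; apply: (near_primitiveW cU Ux).
have kn : \forall y \near x', k (V x') setT y = k (V x') setT x' /\ V x' y.
  have nV : nbhs x' (V x') by exact: (@cocycle_nbhs _ _ (cocycle_pullback i c)).
  apply: (@filterI _ (nbhs x') _ [set y | k (V x') setT y = k (V x') setT x'] (V x')) => //.
  apply: (locally_constant_near (klc (V x') setT cV erefl)) => //.
  by apply: filterI => //; exact: filterT.
have [N [oN Nx NV]] : exists N, [/\ open N, N x & forall y (By : B y), N y ->
    k (V x') setT (exist _ y (mem_set By)) = k (V x') setT x' /\
    V x' (exist _ y (mem_set By))].
  move: (kn : nbhs x' [set y | k (V x') setT y = k (V x') setT x' /\ V x' y]).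
  rewrite nbhsE => -[_ [[N oN <-] Nx] Nk].
  by exists N; split => // y By Ny; exact: (Nk (exist _ y (mem_set By))).
have nN : nbhs x (N `&` B) by apply: open_nbhs_nbhs; split => //; exact: openI.
apply: filterS2 nN (psiP _ x cI Ix U cU Ux) => y [Ny By] e.
have [ky Vy] := NV y By Ny.
by rewrite (fE y By) (fE x Bx) !(gE _ (V x')) //= ky; lra.
Qed.

End FormClasses.

(** * The pairing with singular homology *)

Section FreeLift.
Context (K : choiceType) (M : lmodType int) (f : K -> M).

HB.instance Definition _ :=
  GRing.isZmodMorphism.Build {freeg K / int} M (fglift f) (lift_is_additive f).

Lemma fgliftZ (k : int) (c : {freeg K / int}) :
  fglift f (k *: c) = k *: fglift f c.
Proof. by rewrite -[k]intz !scaler_int raddfMz. Qed.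

Lemma fglift_sumE (c : {freeg K / int}) :
  fglift f c = \sum_(x <- dom c) coeff x c *: f x.
Proof.
by rewrite -{1}[c]freeg_sumE raddf_sum /=; apply: eq_bigr => x _; exact: liftU.
Qed.

Lemma fglift1 (x : K) : fglift f << x >> = f x.
Proof. by rewrite liftU scale1r. Qed.

End FreeLift.

Lemma fglift_comp (K L : choiceType) (M : lmodType int) (f : K -> M)
    (g : L -> {freeg K / int}) (c : {freeg L / int}) :
  fglift f (fglift g c) = fglift (fun x => fglift f (g x)) c.
Proof.
rewrite (fglift_sumE g) raddf_sum [RHS]fglift_sumE.
by apply: eq_bigr => x _; exact: fgliftZ.
Qed.

Section ChainIntegral.
Context (R : realType) (X : topologicalType).
Implicit Types (w : closed_form R X).

Lemma chain_integralE w (c : chain R X 1) :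
  chain_integral w c =
  fglift (fun s : simplex R X 1 => integral w (simplex_path s) : ssrint.zmodule R) c.
Proof. by rewrite fglift_sumE; apply: eq_bigr => s _; rewrite scalezrE. Qed.

Lemma edge_val (t : R) : 0 <= t <= 1 -> val (edge t) = edge_row t.
Proof.
move=> /andP[t0 t1]; rewrite /edge insubdK //; apply/mem_set; split.
  by move=> i; rewrite mxE; case: ifP => // _; rewrite subr_ge0.
by rewrite big_ord_recl big_ord1 !mxE /= subrK.
Qed.

Lemma row_continuous (T : topologicalType) n (f : T -> 'rV[R]_n) :
  (forall j, continuous (fun t => f t ord0 j)) -> continuous f.
Proof.
move=> cf t B [P Pv PB].
have H : \forall s \near t, forall ij : 'I_1 * 'I_n, P ij.1 ij.2 (f s ij.1 ij.2).
  apply: (@filter_forall _ _ (fun ij s => P ij.1 ij.2 (f s ij.1 ij.2))) => -[i j].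
  rewrite /= (ord1 i); apply: (cf j t); exact: Pv.
by apply: filterS H => s Hs; apply: PB => i j; exact: (Hs (i, j)).
Qed.

Lemma simplex_continuous (T : topologicalType) n (f : T -> std_simplex R n) :
  (forall j, continuous (fun t => val (f t) ord0 j)) -> continuous f.
Proof.
by move=> cf; apply: continuous_comp_initial => t; exact: row_continuous.
Qed.

Lemma simplex_coord_continuous n (j : 'I_n.+1) :
  continuous (fun v : std_simplex R n => val v ord0 j).
Proof.
move=> v.
apply: (@continuous_comp _ _ _ (set_val : std_simplex R n -> _)
  (fun u : 'rV[R]_n.+1 => u ord0 j)).
  exact: initial_continuous.
exact: coord_continuous.
Qed.

(** Outside [[0, 1]], [edge] falls back to the initial vertex, so it jumps after 1; [clamp] repairs
    this. *)
Lemma edge_clamp_continuous :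
  continuous (fun t => edge (clamp 0 1 t) : std_simplex R 1).
Proof.
apply: simplex_continuous => j.
have -> : (fun t => val (edge (clamp 0 1 t) : std_simplex R 1) ord0 j) =
    (fun t => if j == 0 then 1 - clamp 0 1 t else clamp 0 1 t).
  by apply/funext => t; rewrite edge_val ?clamp_itv // mxE.
case: (j == 0); last exact: clamp_continuous.
by move=> t; apply: cvgB; [exact: cvg_cst | exact: clamp_continuous].
Qed.

Lemma within_itv_ext (Y : topologicalType) (a b : R) (g h : R -> Y) :
  continuous h -> (forall t, a <= t <= b -> g t = h t) ->
  {within `[a, b], continuous g}.
Proof.
move=> ch gh; apply: (@subspace_eq_continuous _ _ _ h).
  by move=> t; rewrite inE /= in_itv => /gh.
exact: continuous_subspaceT.
Qed.

Lemma within_clamp_continuous (Y : topologicalType) (a b : R) (g : R -> Y) :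
  a <= b -> {within `[a, b], continuous g} -> continuous (g \o clamp a b).
Proof.
move=> ab cg t U gU.
have H := within_itv_near cg (clamp_itv t ab) gU.
have Hn : \forall s \near t, a <= clamp a b s <= b -> U (g (clamp a b s)).
  exact: @clamp_continuous _ a b t _ H.
by apply: filterS Hn => s; apply; exact: clamp_itv.
Qed.

Lemma simplex_path_continuous (s : simplex R X 1) :
  {within `[0, 1], continuous (simplex_path s)}.
Proof.
apply: (@within_itv_ext _ 0 1 _ (fun t => s (edge (clamp 0 1 t)))).
  move=> t; apply: (@continuous_comp _ _ _ (fun t => edge (clamp 0 1 t)) s).
    exact: edge_clamp_continuous.
  exact: cts_fun.
by move=> t t01; rewrite clamp_id.
Qed.

Lemma path_simplex (g : R -> X) : {within `[0, 1], continuous g} ->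
  exists s : simplex R X 1, forall t, 0 <= t <= 1 -> simplex_path s t = g t.
Proof.
move=> cg; pose f (v : std_simplex R 1) := (g \o clamp 0 1) (val v ord0 1).
have cf : continuous f.
  move=> v; apply: (@continuous_comp _ _ _ (fun v : std_simplex R 1 => val v ord0 1)
    (g \o clamp 0 1)).
    exact: simplex_coord_continuous.
  exact: within_clamp_continuous.
exists (mkcts cf : continuousType _ _) => t t01.
transitivity (g (clamp 0 1 (val (edge t) ord0 1))) => //.
by rewrite edge_val // mxE /= clamp_id.
Qed.

Lemma simplex0_eq (u v : std_simplex R 0) : u = v.
Proof.
have one (x : std_simplex R 0) : val x ord0 ord0 = 1.
  by have [_] := set_mem (valP x); rewrite big_ord1.
apply: val_inj; apply/rowP => j; rewrite ord1.
by rewrite (one u) (one v).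
Qed.

End ChainIntegral.

Section Pairing.
Context (R : realType) (X : topologicalType).
Implicit Types (w : closed_form R X).

Lemma vertex_simplex : (const_mx 1 : 'rV[R]_1) \in std_simplex R 0.
Proof.
by apply/mem_set; split=> [i|]; rewrite ?big_ord1 mxE.
Qed.

Definition vertex : std_simplex R 0 := exist _ (const_mx 1) vertex_simplex.

Lemma boundary1 (s : simplex R X 1) :
  boundary (<< s >> : chain R X 1) =
  << simplex_face ord0 s >> - << simplex_face ord_max s >>.
Proof.
rewrite /boundary fglift1 big_ord_recl big_ord1 expr0 scale1r.
rewrite expr1 scaleN1r; congr (_ - << simplex_face _ _ >>).
exact: val_inj.
Qed.

Lemma simplex_face0E (s : simplex R X 1) v :
  simplex_face ord0 s v = simplex_path s 1.
Proof.
rewrite /simplex_path /=; congr (s _); apply: val_inj.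
rewrite edge_val ?lexx ?ler01 //= ; apply/rowP => j; rewrite !mxE.
case: unliftP => [k ->|->]; last by rewrite eqxx subrr.
by rewrite ord1 -[v](simplex0_eq vertex) /= mxE.
Qed.

Lemma simplex_face1E (s : simplex R X 1) v :
  simplex_face ord_max s v = simplex_path s 0.
Proof.
rewrite /simplex_path /=; congr (s _); apply: val_inj.
rewrite edge_val ?lexx ?ler01 //= ; apply/rowP => j; rewrite !mxE.
case: unliftP => [k ->|->] //.
by rewrite ord1 -[v](simplex0_eq vertex) /= mxE subr0.
Qed.

(** Stokes for the exact form [df]: its integral over a 1-cycle vanishes. *)
Lemma fglift_boundary (f : X -> R) (c : chain R X 1) :
  fglift (fun s : simplex R X 0 => f (s vertex) : ssrint.zmodule R) (boundary c) =
  fglift (fun s : simplex R X 1 =>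
    f (simplex_path s 1) - f (simplex_path s 0) : ssrint.zmodule R) c.
Proof.
rewrite /boundary fglift_comp; congr (fglift _ c); apply/funext => s.
have := boundary1 s; rewrite /boundary fglift1 => ->.
by rewrite raddfB /= !fglift1 simplex_face0E simplex_face1E.
Qed.

Lemma integral_form_difference w w' f (g : R -> X) :
  near_form_difference w w' f -> {within `[0, 1], continuous g} ->
  integral w' g - integral w g = f (g 1) - f (g 0).
Proof.
move=> ff cg; have [p pP] := path_primitive_exists w cg.
rewrite (path_primitive_integral cg pP).
rewrite (@path_primitive_integral _ _ w' g (fun t => p t + f (g t))) //; first lra.
move=> t U' t01 cU' U't; have [U cU Ut] := form_cover w (g t).
have H1 := pP t U t01 cU Ut.
have H2 := @within_itv_near _ _ 0 1 g t
  [set y | f y - f (g t) = (fphi w' U' y - fphi w' U' (g t)) -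
    (fphi w U y - fphi w U (g t))] cg t01 (ff _ _ _ cU Ut cU' U't).
by apply: filterS2 H1 H2 => s + + s01 => /(_ s01) + /(_ s01) /=; lra.
Qed.

Lemma chain_integral_class w w' (c : chain R X 1) :
  form_class w = form_class w' -> boundary c = 0 ->
  chain_integral w c = chain_integral w' c.
Proof.
move=> /form_class_difference[f ff] c0.
have f0 : \sum_(s <- dom c)
    (f (simplex_path s 1) - f (simplex_path s 0)) *~ coeff s c = 0.
  have := fglift_boundary f c; rewrite c0 raddf0 fglift_sumE => /esym e.
  by rewrite -[RHS]e; apply: eq_bigr => s _; rewrite scalezrE.
apply/esym/eqP; rewrite -subr_eq0 -sumrB; apply/eqP; rewrite -[RHS]f0.
apply: eq_bigr => s _.
rewrite -mulrzBl; congr (_ *~ _).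
apply: (@integral_form_difference w w' f (simplex_path s) ff).
exact: (@simplex_path_continuous R X s).
Qed.

Definition triangle_row (v u : R) : 'rV[R]_3 :=
  \row_j (if j == 0 :> nat then 1 - u else if j == 1 :> nat then u * (1 - v) else u * v).

(* [triangle (v, u)] is [(1 - u, u (1 - v), u v)]: the unit square with the side
   [u = 0] collapsed to a vertex, whose other three sides are the faces. *)
Lemma triangle_simplex v u :
  triangle_row (clamp 0 1 v) (clamp 0 1 u) \in std_simplex R 2.
Proof.
have /andP[v0 v1] := clamp_itv v (@ler01 R).
have /andP[u0 u1] := clamp_itv u (@ler01 R).
apply/mem_set; split.
  move=> j; rewrite mxE; case: ifP => _; first by rewrite subr_ge0.
  by case: ifP => _; rewrite mulr_ge0 // subr_ge0.
rewrite !big_ord_recl big_ord0 !mxE /= addr0; lra.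
Qed.

Definition triangle (z : R * R) : std_simplex R 2 :=
  exist _ (triangle_row (clamp 0 1 z.1) (clamp 0 1 z.2))
    (triangle_simplex z.1 z.2).

Lemma triangle_continuous : continuous triangle.
Proof.
have c1 : continuous (fun z : R * R => clamp 0 1 z.1).
  move=> z; apply: (@continuous_comp _ _ _ fst (clamp 0 1)); first exact: cvg_fst.
  exact: clamp_continuous.
have c2 : continuous (fun z : R * R => clamp 0 1 z.2).
  move=> z; apply: (@continuous_comp _ _ _ snd (clamp 0 1)); first exact: cvg_snd.
  exact: clamp_continuous.
apply: simplex_continuous => j.
have -> : (fun z : R * R => val (triangle z) ord0 j) = (fun z : R * R =>
    if j == 0 :> nat then 1 - clamp 0 1 z.2
    else if j == 1 :> nat then clamp 0 1 z.2 * (1 - clamp 0 1 z.1)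
    else clamp 0 1 z.2 * clamp 0 1 z.1).
  by apply/funext => z; rewrite /= mxE.
case: (j == 0 :> nat) => [z|].
  by apply: cvgB; [exact: cvg_cst | exact: c2].
case: (j == 1 :> nat) => z; last by apply: cvgM; [exact: c2 | exact: c1].
apply: cvgM; first exact: c2.
by apply: cvgB; [exact: cvg_cst | exact: c1].
Qed.

Lemma simplex_path_face (s : simplex R X 2) (i : 'I_3) (t v u : R) :
  0 <= t <= 1 -> 0 <= v <= 1 -> 0 <= u <= 1 ->
  face_row i (edge_row t) = triangle_row v u ->
  simplex_path (simplex_face i s) t = s (triangle (v, u)).
Proof.
move=> t01 v01 u01 e; rewrite /simplex_path /=; congr (s _).
by apply: val_inj; rewrite /= edge_val // e !clamp_id.
Qed.

Lemma face_rowE (i : 'I_3) (t : R) : face_row i (edge_row t) =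
  if i == 0 :> nat then triangle_row t 1
  else if i == 1 :> nat then triangle_row 1 t else triangle_row 0 t.
Proof.
apply/rowP => j; case: i => -[|[|[|//]]] i3; rewrite /= !mxE;
  case: unliftP => [k ->|->] /=; rewrite ?mxE /=.
all: try by case: k => -[|[|//]] ?; rewrite /= ?subrr ?subr0 ?mul1r ?mulr1 ?mulr0.
all: by rewrite ?subrr ?subr0 ?mul1r ?mulr1 ?mulr0.
Qed.

Lemma integral_triangle w (s : simplex R X 2) :
  integral w (simplex_path (simplex_face (inord 0) s)) -
  integral w (simplex_path (simplex_face (inord 1) s)) +
  integral w (simplex_path (simplex_face (inord 2) s)) = 0.
Proof.
pose F z := s (triangle z).
have cF : continuous F.
  by move=> z; apply: continuous_comp; [exact: triangle_continuous | exact: cts_fun].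
pose I v := integral w (fun u => F (v, u)).
have F0 v v' : F (v, 0) = F (v', 0).
  congr (s _); apply: val_inj; apply/rowP => j; rewrite /= !mxE.
  by rewrite clamp_id ?lexx ?ler01 // !mul0r.
(* The integral along the segment from the collapsed vertex is a primitive of
   [w] along the opposite face. *)
have IP : path_primitive w (fun v => F (v, 1)) I.
  move=> v U v01 cU Uv; have [V cV Vv] := form_cover w (F (v, 0)).
  apply: filterS (near_integral cF cU Uv cV Vv) => v' + _.
  by rewrite /I => ->; rewrite (F0 v' v); lra.
have /path_primitive_integral/(_ IP) : {within `[0, 1], continuous (fun v => F (v, 1))}.
  by apply: continuous_subspaceT; exact: continuous_slicel.
have -> : integral w (fun v => F (v, 1)) =
    integral w (simplex_path (simplex_face (inord 0) s)).
  apply: eq_integral_path => t t01; apply/esym/simplex_path_face => //.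
    by rewrite ler01 lexx.
  by rewrite face_rowE inordK.
have -> : I 1 = integral w (simplex_path (simplex_face (inord 1) s)).
  apply: eq_integral_path => t t01; apply/esym/simplex_path_face => //.
    by rewrite ler01 lexx.
  by rewrite face_rowE inordK.
have -> : I 0 = integral w (simplex_path (simplex_face (inord 2) s)).
  apply: eq_integral_path => t t01; apply/esym/simplex_path_face => //.
    by rewrite ler01 lexx.
  by rewrite face_rowE inordK.
by lra.
Qed.

Lemma chain_integral_boundary w (b : chain R X 2) :
  chain_integral w (boundary b) = 0.
Proof.
rewrite chain_integralE /boundary fglift_comp fglift_sumE big1 // => s _.
rewrite !big_ord_recl big_ord0 addr0 expr0 scale1r.
rewrite !raddfD /= !fgliftZ !fglift1.
have := integral_triangle w s.
rewrite (_ : inord 0 = ord0); last by apply: val_inj; rewrite /= inordK.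
rewrite (_ : inord 1 = fintype.lift ord0 ord0); last by apply: val_inj; rewrite /= inordK.
rewrite (_ : inord 2 = fintype.lift ord0 (fintype.lift ord0 ord0)); last first.
  by apply: val_inj; rewrite /= inordK.
rewrite expr1 sqrrN expr1n scaleN1r scale1r addrA => H.
rewrite -!scalerDr; transitivity (coeff s b *: (0 : ssrint.zmodule R)).
  by congr (_ *: _); exact: H.
exact: scaler0.
Qed.

(** Justifies the choice in [pairing]: another form of the class differs by an exact form, another
    cycle by a boundary, and neither changes the integral. *)
Lemma pairing_chain_integral w (z : H1 R X) c :
  represented_by z c -> pairing (form_class w) z = chain_integral w c.
Proof.
move=> zc; rewrite /pairing.
set S := (X in xget 0 X).
have Sw : S (chain_integral w c) by exists w, c.
have [w' [c' [ww' [cy' zcy' cc'] ->]]] := xgetPex 0 (ex_intro _ _ Sw).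
have [cy zcy cyc] := zc.
have c0 : boundary c = 0 by rewrite -cyc; exact/eqP/(valP cy).
rewrite (chain_integral_class ww'); last by rewrite -cc'; exact/eqP/(valP cy').
have : \pi_(H1 R X)%qT cy' = \pi_(H1 R X)%qT cy by rewrite zcy zcy'.
move=> /eqquotP/asboolP[b]; rewrite cc' cyc => /eqP.
rewrite subr_eq => /eqP ->; rewrite chain_integralE raddfD /= -!chain_integralE.
by rewrite chain_integral_boundary add0r.
Qed.

(** The choice in [pairing] returns 0 when no closed form represents the class. *)
Lemma pairing_form (xi : cech1 X R) (z : H1 R X) : pairing xi z <> 0 ->
  exists w : closed_form R X, form_class w = xi.
Proof.
move=> xiz; apply: contrapT => nw; apply: xiz; apply: xgetPN => v [w [c [wxi _ _]]].
by apply: nw; exists w.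
Qed.

End Pairing.

(** * Trajectory integrals and associated homology classes *)

Section TrajectoryIntegral.
Context (R : realType) (X : metricType R) (Phi : X * R -> X).
Context (Phi_flow : is_flow Phi).
Context (w : closed_form R X).

Let Phi_cts : continuous Phi. Proof. by case: Phi_flow. Qed.
Let Phi0 x : Phi (x, 0) = x. Proof. by case: Phi_flow => _ ->. Qed.
Let PhiD x s t : Phi (Phi (x, s), t) = Phi (x, s + t).
Proof. by case: Phi_flow => _ _ ->. Qed.

Local Notation A := (trajectory_integral Phi w).

(** The trajectory rescaled to [[0, 1]], with its duration as a parameter: this gives continuity
    jointly in the point and the time. *)
Let F (z : (X * R) * R) := Phi (z.1.1, z.2 * z.1.2).

Let F_continuous : continuous F.
Proof.
move=> z; apply: (@continuous_comp _ _ _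
  (fun z : (X * R) * R => (z.1.1, z.2 * z.1.2)) Phi); last exact: Phi_cts.
apply: continuous_pair z => z.
  by apply: (@continuous_comp _ _ _ fst fst); exact: cvg_fst.
apply: cvgM; first exact: cvg_snd.
by apply: (@continuous_comp _ _ _ fst snd); [exact: cvg_fst | exact: cvg_snd].
Qed.

Lemma trajectory_integral_continuous : continuous (fun z : X * R => A z.1 z.2).
Proof. exact: (@integral_param_continuous _ _ w _ F F_continuous). Qed.

Lemma near_trajectory_integral x0 t0 U V :
  fcover w U -> U (Phi (x0, t0)) -> fcover w V -> V x0 ->
  \forall z \near (x0, t0), A z.1 z.2 - A x0 t0 =
    (fphi w U (Phi z) - fphi w U (Phi (x0, t0))) -
    (fphi w V z.1 - fphi w V x0).
Proof.
move=> cU Ux cV Vx.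
have F1 (z : X * R) : F (z, 1) = Phi z by rewrite /F /= mul1r -surjective_pairing.
have F0 (z : X * R) : F (z, 0) = z.1 by rewrite /F /= mul0r.
have := @near_integral _ _ w _ F (x0, t0) U V F_continuous cU.
rewrite F1 F0 => /(_ Ux cV Vx); apply: filterS => z.
by rewrite F1 F0.
Qed.

Lemma trajectory_primitive x t0 U : fcover w U -> U (Phi (x, t0)) ->
  \forall t \near t0, A x t - A x t0 = fphi w U (Phi (x, t)) - fphi w U (Phi (x, t0)).
Proof.
move=> cU Ux; have [V cV Vx] := form_cover w x.
have H := near_trajectory_integral cU Ux cV Vx.
have : \forall t \near t0, A x t - A x t0 =
    (fphi w U (Phi (x, t)) - fphi w U (Phi (x, t0))) - (fphi w V x - fphi w V x).
  by apply: (@cvg_pair _ _ _ (nbhs t0) (nbhs x) (nbhs t0) _ _ _ (cst x) id) H;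
    [exact: cvg_cst | exact: cvg_id].
by apply: filterS => t ->; rewrite subrr subr0.
Qed.

Lemma trajectory_integral0 x : A x 0 = 0.
Proof.
have cg : {within `[0, 1], continuous (fun s : R => Phi (x, s * 0))}.
  apply: (@within_itv_ext _ _ 0 1 _ (cst x)); first exact: cst_continuous.
  by move=> t _; rewrite mulr0 Phi0.
rewrite /trajectory_integral (path_primitive_integral (w := w) (f := cst 0) cg) /=.
  by rewrite subrr.
by move=> t U _ _ _; near=> s => _; rewrite !mulr0 !subrr.
Unshelve. all: by end_near. Qed.

(** Functions with the same local increments differ by a constant on the whole line; negative times
    are included, and the cocycle identity [trajectory_integralD] follows. *)
Lemma trajectory_integral_unique x (a : R -> R) :
  (forall t0 U, fcover w U -> U (Phi (x, t0)) -> \forall t \near t0,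
    a t - a t0 = fphi w U (Phi (x, t)) - fphi w U (Phi (x, t0))) ->
  forall t, A x t = a t - a 0.
Proof.
move=> aP t.
suff : A x t - a t = A x 0 - a 0 by rewrite trajectory_integral0; lra.
apply: (@locally_constant_cst _ _ (fun t => A x t - a t)) => t0.
have [U cU Ux] := form_cover w (Phi (x, t0)).
apply: filterS2 (aP t0 U cU Ux) (trajectory_primitive cU Ux) => s; lra.
Qed.

Lemma trajectory_integralD x s t : A x (s + t) = A x s + A (Phi (x, s)) t.
Proof.
rewrite (@trajectory_integral_unique (Phi (x, s)) (fun t => A x (s + t))).
  by rewrite addr0; lra.
move=> t0 U cU; rewrite PhiD => Ux.
have H := trajectory_primitive cU Ux.
have cs : (fun t => s + t) @ t0 --> s + t0.
  by apply: cvgD; [exact: cvg_cst | exact: cvg_id].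
have {}H : \forall t \near t0, A x (s + t) - A x (s + t0) =
    fphi w U (Phi (x, s + t)) - fphi w U (Phi (x, s + t0)) by exact: cs H.
by apply: filterS H => r; rewrite PhiD.
Qed.

End TrajectoryIntegral.

HB.instance Definition _ (R : realType) (X : topologicalType) (n : nat) :=
  GRing.isZmodMorphism.Build (chain R X n.+1) (chain R X n)
    (@boundary R X n) (@boundaryB R X n).

Lemma boundary_path (R : realType) (X : topologicalType) (s : simplex R X 1) (k : X -> simplex R X 0) :
  (forall x v, k x v = x) -> boundary (<< s >> : chain R X 1) =
  << k (simplex_path s 1) >> - << k (simplex_path s 0) >>.
Proof.
move=> kP; rewrite boundary1; congr (<< _ >> - << _ >>).
  by apply/continuousEP => v; rewrite simplex_face0E kP.
by apply/continuousEP => v; rewrite simplex_face1E kP.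
Qed.

Section AssociatedClasses.
Context (R : realType) (X : metricType R) (Phi : X * R -> X).
Context (Phi_flow : is_flow Phi).

Lemma trajectory_path_continuous x t :
  {within `[0, 1], continuous (fun s => Phi (x, s * t))}.
Proof.
have cPhi : continuous Phi by case: Phi_flow.
have H : continuous ((fun u => Phi (x, u)) \o (fun s : R => s * t)).
  move=> s; apply: continuous_comp; last exact: continuous_slicer.
  by apply: cvgM; [exact: cvg_id | exact: cvg_cst].
exact: continuous_subspaceT.
Qed.

Lemma associated_pairing (w : closed_form R X) eps N xs ts z :
  associated Phi eps N xs ts z -> exists sig : nat -> R -> X,
    (forall i, (i < N)%N ->
      is_path (sig i) (Phi (xs i, ts i.+1)) (xs i.+1) /\
      exists b, sig i @` `[0, 1] `<=` ball b eps) /\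
    pairing (form_class w) z =
    \sum_(i < N) (trajectory_integral Phi w (xs i) (ts i.+1) + integral w (sig i)).
Proof.
move=> [tau [sig [tauP sigP zc]]]; exists (fun i => simplex_path (sig i)).
split; first exact: sigP.
rewrite (pairing_chain_integral _ zc) chain_integralE raddf_sum /=.
apply: eq_bigr => i _; rewrite raddfD /= !fglift1; congr (_ + _).
apply: eq_integral_path => t t01.
by rewrite tauP.
Qed.

(** Without such a class, conditions on all associated classes could hold vacuously. The boundary
    telescopes to the difference of the two ends of the chain, which coincide. *)
Lemma associated_exists eps N xs ts : xs N = xs 0%N ->
  (forall i, (i < N)%N -> exists g b,
    is_path g (Phi (xs i, ts i.+1)) (xs i.+1) /\ g @` `[0, 1] `<=` ball b eps) ->
  exists z : H1 R X, associated Phi eps N xs ts z.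
Proof.
move=> xsN sigP.
have /choice[tau tauP] (i : nat) : exists t : simplex R X 1,
    forall s, 0 <= s <= 1 -> simplex_path t s = Phi (xs i, s * ts i.+1).
  have [t tP] := path_simplex (@trajectory_path_continuous (xs i) (ts i.+1)).
  by exists t => s s01; exact: tP.
have /choice[sig sigE] (i : nat) : exists t : simplex R X 1, (i < N)%N ->
    is_path (simplex_path t) (Phi (xs i, ts i.+1)) (xs i.+1) /\
    exists b, simplex_path t @` `[0, 1] `<=` ball b eps.
  have [iN|] := ltnP i N; last by exists (tau 0%N).
  have [g [b [[cg g0 g1] gb]]] := sigP i iN.
  have [t tg] := path_simplex cg; exists t => _; split.
    split; first exact: simplex_path_continuous.
      by rewrite tg ?g0 ?lexx ?ler01.
    by rewrite tg ?g1 ?lexx ?ler01.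
  exists b => _ [s s01 <-]; apply: gb; exists s => //.
  by rewrite tg //; move: s01; rewrite /= in_itv.
pose k (x : X) : simplex R X 0 := mkcts (@cst_continuous _ _ x).
pose c : chain R X 1 := \sum_(i < N) (<< tau i >> + << sig i >>).
have c0 : boundary c == 0.
  rewrite /c raddf_sum /=.
  pose V i : chain R X 0 := << k (xs i) >>.
  transitivity (\sum_(0 <= i < N) (V i.+1 - V i) == 0); last first.
    by rewrite telescope_sumr // /V xsN subrr eqxx.
  congr (_ == _); rewrite big_mkord; apply: eq_bigr => i _.
  have [[_ s0 s1] _] := sigE i (ltn_ord i).
  have H s := @boundary_path R X s k (fun _ _ => erefl).
  have -> : boundary (<< tau i >> + << sig i >>) =
      boundary << tau i >> + boundary << sig i >> by exact: raddfD.
  rewrite !H s0 s1 !tauP ?lexx ?ler01 // mul1r mul0r.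
  have -> : Phi (xs i, 0) = xs i by case: Phi_flow => _ ->.
  by rewrite addrC subrKA.
pose cy : cycle1 R X := exist (fun c : chain R X 1 => boundary c == 0) c c0.
exists (\pi_(H1 R X)%qT cy), tau, sig; split; last by exists cy.
  by move=> i _; exact: tauP.
exact: sigE.
Qed.

End AssociatedClasses.

Lemma metric_ball_open (R : realType) (X : metricType R) (x : X) (r : R) :
  open (ball x r).
Proof.
rewrite openE => y; rewrite ballEmdist /= => xy; apply/nbhs_ballP.
exists (r - mdist x y); first by rewrite /= subr_gt0.
move=> z; rewrite !ballEmdist /= => yz.
by have := metric_triangle x y z; lra.
Qed.

Lemma integral_near_primitive (R : realType) (X : topologicalType)
    (w : closed_form R X) (B : set X) (f : X -> R) (g : R -> X) :
  (forall x, B x -> near_primitive w f x) -> {within `[0, 1], continuous g} ->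
  (forall t, 0 <= t <= 1 -> B (g t)) -> integral w g = f (g 1) - f (g 0).
Proof.
move=> fB cg gB.
apply: (@path_primitive_integral _ _ w g (fun t => f (g t))) => //.
move=> t U t01 cU Ut.
exact: (@within_itv_near _ _ 0 1 g t
  [set y | f y - f (g t) = fphi w U y - fphi w U (g t)] cg t01 (fB _ (gB t t01) U cU Ut)).
Qed.

Lemma compact_uniform (R : realType) (X : metricType R) (Q : X -> R -> Prop) :
  compact [set: X] -> (forall x r s, 0 < s <= r -> Q x r -> Q x s) ->
  (forall x, exists2 r, 0 < r & forall y, ball x r y -> Q y r) ->
  exists2 r, 0 < r & forall x, Q x r.
Proof.
move=> /compact_near_coveringP cov Qle Qx.
have H : \forall r \near 0^'+, [set: X] `<=` Q ^~ r.
  apply: cov => x _; have [r r0 rQ] := Qx x.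
  exists (ball x r, [set s | 0 < s <= r]) => /=.
    split; first exact: nbhsx_ballx.
    near=> s; apply/andP; split; near: s; first exact: nbhs_right_gt.
    exact: nbhs_right_le.
  by move=> [y s] [/= xy sr]; apply: (Qle _ r) => //; exact: rQ.
near (0 : R)^'+ => r.
exists r; first by near: r; exact: nbhs_right_gt.
by move=> x; exact: (near H r).
Unshelve. all: by end_near. Qed.

(** However long the path, a primitive on the ball reduces its integral to values at two close end
    points. Uniformity in the centre [b] and in the start [x] takes two applications of
    compactness. *)
Lemma small_path_integral (R : realType) (X : metricType R) (w : closed_form R X)
    (eps eta : R) : compact [set: X] -> 0 < eps -> 0 < eta ->
  (forall b : X, cech_restrict (ball b (2 * eps)) (form_class w) = cech0 _ R) ->
  exists2 r, 0 < r & forall (b x y : X) g, is_path g x y ->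
    g @` `[0, 1] `<=` ball b eps -> mdist x y < r -> `|integral w g| <= eta.
Proof.
move=> cX eps0 eta0 w0.
pose Q b x r := forall y g, is_path g x y ->
  g @` `[0, 1] `<=` ball b eps -> mdist x y < r -> `|integral w g| <= eta.
suff [r r0 rQ] : exists2 r, 0 < r & forall b, forall x, Q b x r.
  by exists r => // b x y g; exact: rQ.
have Qle b x r s : 0 < s <= r -> Q b x r -> Q b x s.
  move=> /andP[_ sr] Qr y g gP gb xy; apply: (Qr y g) => //.
  exact: lt_le_trans sr.
apply: compact_uniform => // [b r s sr Qr x|b]; first exact: Qle (Qr x).
suff [r r0 rQ] : exists2 r, 0 < r & forall x, forall b', ball b r b' -> Q b' x r.
  by exists r => // b' bb' x; exact: rQ.
apply: (@compact_uniform _ _ (fun x r => forall b', ball b r b' -> Q b' x r)) => //.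
  move=> x r s sr Qr b' bb'; apply: (Qle _ _ r) => //; apply: Qr.
  by apply: le_ball bb'; case/andP: sr.
move=> x; have eps2 : 0 < eps / 2 by rewrite divr_gt0.
(* If [x] is at distance at least [2 * eps] from [b], no path starting within [eps / 2] of [x] fits
   in an [eps]-ball centred within [eps / 2] of [b]: the claim is vacuous. *)
have [bx|bx] := ltP (mdist b x) (2 * eps); last first.
  exists (eps / 2) => // x' xx' b' bb' y g [cg g0 g1] gb.
  have : ball b' eps x'.
    by apply: gb; exists 0 => //; rewrite /= in_itv /= lexx ler01.
  rewrite !ballEmdist /= in xx' bb' * => b'x'.
  have := metric_triangle b b' x; have := metric_triangle b' x' x.
  rewrite (metric_sym x' x) => h1 h2; exfalso; lra.
have [|f fB] := @restrict_primitive _ _ w (ball b (2 * eps)) _ (w0 b).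
  exact: metric_ball_open.
have : {for x, continuous f}.
  by apply: near_primitive_continuous; apply: fB; rewrite ballEmdist.
move=> /cvgrPdist_lt/(_ (eta / 2)); rewrite divr_gt0 // => /(_ isT).
move=> /nbhs_ballP[rho /= rho0 frho].
have rho2 : 0 < rho / 2 by rewrite divr_gt0.
pose r := Num.min (rho / 2) (eps / 2).
have r_rho : r <= rho / 2 by rewrite /r ge_min lexx.
have r_eps : r <= eps / 2 by rewrite /r ge_min lexx orbT.
exists r; first by rewrite lt_min rho2.
move=> x' xx' b' bb' y g [cg g0 g1] gb x'y.
rewrite (@integral_near_primitive _ _ w (ball b (2 * eps)) f) //; last first.
  move=> t t01; have : ball b' eps (g t).
    by apply: gb; exists t => //; rewrite /= in_itv.
  rewrite !ballEmdist /= in bb' * => b't.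
  by have := metric_triangle b b' (g t); lra.
rewrite g0 g1.
have fx' : `|f x - f x'| < eta / 2.
  by apply: frho; apply: le_ball xx'; lra.
have fy : `|f x - f y| < eta / 2.
  apply: frho; rewrite !ballEmdist /= in xx' *.
  by have := metric_triangle x x' y; lra.
have -> : f y - f x' = (f x - f x') - (f x - f y) by lra.
by rewrite (le_trans (ler_normB _ _)) //; lra.
Qed.

(** * Recurrence and averaging *)

Lemma le_bound_norm (R : realType) (x : R) : x <= (Num.bound `|x|)%:R.
Proof. by rewrite (le_trans (ler_norm _)) // ltW // archi_boundP. Qed.

Section Recurrence.
Context (R : realType) (X : metricType R) (Phi : X * R -> X).
Context (Phi_flow : is_flow Phi).
Context (X_compact : compact [set: X]).

Let Phi_cts : continuous Phi. Proof. by case: Phi_flow. Qed.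
Let PhiD x s t : Phi (Phi (x, s), t) = Phi (x, s + t).
Proof. by case: Phi_flow => _ _ ->. Qed.

Lemma sequence_cluster (u : nat -> X) :
  exists y : X, forall U N, nbhs y U -> exists2 n, (N <= n)%N & U (u n).
Proof.
have [|y [_ yP]] := @X_compact (u @ \oo) _; first exact: filterT.
exists y => U N yU.
have [|z [[n /= Nn <-] Uz]] := yP (u @` [set n | (N <= n)%N]) U _ yU.
  by exists N => // n Nn; exists n.
by exists n.
Qed.

(** The point [p] is fixed before [S]: two visits to the same small ball, far apart in time, make a
    cycle based on the orbit of [y], where [A y] can be followed, rather than at [p]. *)
Lemma flow_returns y (delta : R) : 0 < delta ->
  exists p, forall S : R, exists s : R, [/\ S <= s, 0 <= s & mdist p (Phi (y, s)) < delta].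
Proof.
move=> delta0; have [p pP] := sequence_cluster (fun n => Phi (y, n%:R)).
exists p => S.
have [N SN] : exists N : nat, S <= N%:R.
  by exists (Num.bound `|S|); exact: le_bound_norm.
have [n Nn pn] := pP _ N (nbhsx_ballx p _ delta0).
exists n%:R; split=> //; first by rewrite (le_trans SN) // ler_nat.
by rewrite ballEmdist in pn.
Qed.

(* [y] is an omega-limit point of [x], and so is [Phi (y, t)]; such points are
   chain recurrent, by jumping to the orbit of [x] and back. *)
Lemma omega_limit_chain_recurrent x (s : nat -> R) y :
  (forall n, n%:R <= s n) ->
  (forall U N, nbhs y U -> exists2 n, (N <= n)%N & U (Phi (x, s n))) ->
  forall t, chain_recurrent Phi (Phi (y, t)).
Proof.
move=> sn yP t delta T delta0 T1.
have nearPhi r : \forall z \near y, mdist (Phi (y, r)) (Phi (z, r)) < delta.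
  have H : \forall z \near y, ball (Phi (y, r)) delta (Phi (z, r)).
    exact: (@continuous_slicel _ _ _ Phi r Phi_cts y _
      (nbhsx_ballx (Phi (y, r)) _ delta0)).
  by apply: filterS H => z; rewrite ballEmdist.
have [n _ [n1 n2]] := yP _ 0%N (filterI (nearPhi t) (nearPhi (t + T))).
(* Late enough for the second leg of the chain, of duration [s m - s n - T], to last at least
   [T]. *)
pose N := Num.bound `|s n + T + T|.
have [m Nm m1] := yP _ N (nearPhi t).
have sm : s n + T + T <= s m.
  by rewrite (le_trans _ (sn m)) // (le_trans (le_bound_norm _)) // ler_nat.
pose x1 := Phi (Phi (x, s n), t + T).
exists 2%N, (fun i => if i == 1%N then x1 else Phi (y, t)).
exists (fun i => if i == 1%N then T else s m - s n - T).
split => // -[|[|//]] _ /=.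
  by split=> //; rewrite PhiD.
split; first lra.
rewrite /x1 !PhiD (_ : s n + (t + T + _) = s m + t); last by lra.
by rewrite metric_sym -PhiD.
Qed.

Lemma chain_recurrent_orbit (x : X) :
  exists y, forall t, chain_recurrent Phi (Phi (y, t)).
Proof.
have [y yP] := sequence_cluster (fun n => Phi (x, n%:R)).
by exists y; apply: (@omega_limit_chain_recurrent x (fun n => n%:R)).
Qed.

Context (w : closed_form R X).
Local Notation A := (trajectory_integral Phi w).

(** If every time past [n] failed, [A x] could be lowered by 1 again and again, below [m]. The
    descent starts at [n.+1] to stay where the lower bound holds. *)
Lemma almost_minimum_at_infinity x (m : R) (n : nat) :
  (forall t, 1 <= t -> m <= A x t) ->
  exists2 s : R, n%:R <= s & forall t : R, 0 <= t -> A x s - 1 <= A x (s + t).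
Proof.
move=> Am; apply: contrapT => nex.
have H (k : nat) : exists2 s : R, n.+1%:R <= s & A x s <= A x n.+1%:R - k%:R.
  elim: k => [|k [s ns As]]; first by exists n.+1%:R => //; rewrite subr0.
  apply: contrapT => nex'; apply: nex; exists s.
    by rewrite (le_trans _ ns) // ler_nat.
  move=> t t0; rewrite leNgt; apply/negP => st; apply: nex'.
  exists (s + t); first by rewrite (le_trans ns) // lerDl.
  by rewrite -[k.+1%:R]natr1; lra.
have [s ns As] := H (Num.bound `|A x n.+1%:R - m|).+1.
have := Am s; rewrite (le_trans _ ns) ?ler1n // => /(_ isT) ms.
by have := le_bound_norm (A x n.+1%:R - m); move: As; rewrite -[(Num.bound _).+1%:R]natr1; lra.
Qed.

(* Otherwise [A x] is bounded below on [1, +oo[; times where it is almost minimal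
   accumulate at a recurrent [y] with [A y t >= -1] for all [t >= 0], although
   every return of the orbit of [y] to a small ball costs at least 1/2. *)
Lemma escape_of_recurrent_decay (delta T : R) : 0 < delta ->
  (forall x t, chain_recurrent Phi x -> is_delta_cycle Phi delta T x t ->
     A x t <= - 2^-1) ->
  forall x, exists2 t : R, 1 <= t & A x t < - 1.
Proof.
move=> delta0 decay x; apply: contrapT => nex.
have Ax (t : R) : 1 <= t -> - 1 <= A x t.
  by move=> t1; rewrite leNgt; apply/negP => At; apply: nex; exists t.
have /choice[s sP] (n : nat) : exists s : R, n%:R <= s /\
    forall t : R, 0 <= t -> A x s - 1 <= A x (s + t).
  by have [s ns As] := almost_minimum_at_infinity n Ax; exists s.
have sn n : n%:R <= s n by case: (sP n).
have [y yP] := sequence_cluster (fun n => Phi (x, s n)).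
have yR := omega_limit_chain_recurrent sn yP.
(* A drop below -1 from [y] would persist from some [Phi (x, s n)] close to [y], against the almost
   minimality at [s n]. *)
have Ay (t : R) : 0 <= t -> - 1 <= A y t.
  move=> t0; rewrite leNgt; apply/negP => At.
  have cA : continuous (fun z => A z t).
    exact: (@continuous_slicel _ _ _ (fun z : X * R => A z.1 z.2) t
      (@trajectory_integral_continuous _ _ _ Phi_flow w)).
  have := cA y _ (lt_nbhsl At) => /(yP _ 0%N)[n _ /=].
  have [_ /(_ t t0)] := sP n; rewrite (trajectory_integralD Phi_flow); lra.
have delta2 : 0 < delta / 2 by rewrite divr_gt0.
have [p pP] := flow_returns y delta2.
have [s0 [_ s00 ps0]] := pP 0.
have H (k : nat) : exists r : R, [/\ 0 <= r, mdist p (Phi (y, r)) < delta / 2 &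
    A y r <= A y s0 - k%:R * 2^-1].
  elim: k => [|k [r [r0 pr Ar]]]; first by exists s0; rewrite mul0r subr0.
  have [q [rq q0 pq]] := pP (r + T).
  exists q; split=> //.
  have : A (Phi (y, r)) (q - r) <= - 2^-1.
    apply: decay; first exact: yR.
    split; first lra.
    rewrite PhiD subrKC (le_lt_trans (metric_triangle _ p _)) // (splitr delta).
    by rewrite ltrD // metric_sym.
  have := trajectory_integralD Phi_flow w y r (q - r).
  rewrite subrKC => ->; rewrite -[k.+1%:R]natr1. lra.
have [r [r0 _ Ar]] := H (Num.bound `|(A y s0 + 1) * 2|).+1.
have := Ay r r0.
by have := le_bound_norm ((A y s0 + 1) * 2); move: Ar; rewrite -natr1; lra.
Qed.

End Recurrence.

(** * Adding an exact form, and averaging along the flow *)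

Section ShiftForm.
Context (R : realType) (X : topologicalType) (w : closed_form R X) (f : X -> R).
Context (f_cts : continuous f).

Definition shift_phi (U : set X) (x : X) : R := fphi w U x + f x.

Lemma shift_continuous U x : fcover w U -> U x ->
  {for x, continuous (shift_phi U)}.
Proof. by move=> cU Ux; apply: cvgD; [exact: fphi_continuous | exact: f_cts]. Qed.

Lemma shift_locally_constant U V : fcover w U -> fcover w V ->
  locally_constant (U `&` V) (fun x => shift_phi U x - shift_phi V x).
Proof.
move=> cU cV x UVx; apply: filterS (fphi_locally_constant cU cV UVx) => y e /e.
by rewrite /shift_phi; lra.
Qed.

Definition shift_form : closed_form R X :=
  ClosedForm (fcover_open w) shift_continuous shift_locally_constant.

Lemma shift_form_class : form_class shift_form = form_class w.
Proof.
apply/form_classP; exists shift_phi; split=> [U x cU Ux|U V x *].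
  by apply: (@near_primitiveW _ _ shift_form _ _ U) => //; near=> y.
by rewrite /= /shift_phi; lra.
Unshelve. all: by end_near. Qed.

Lemma shift_form_difference : near_form_difference w shift_form f.
Proof.
move=> x U U' cU Ux cU' U'x; apply: filterS (form_transition cU cU' Ux U'x) => y.
by rewrite /= /shift_phi; lra.
Qed.

End ShiftForm.

Arguments shift_form {R X} w {f} f_cts.

(** Integration starts at -1 so that 0 is an interior point and the derivative there is
    two-sided. *)
Lemma continuous_antiderivative (R : realType) (a : R -> R) : continuous a ->
  exists B : R -> R, forall t : R, - 1 < t -> is_derive t (1 : R) B (a t).
Proof.
move=> ca.
pose B x := (\int[lebesgue_measure]_(t in `[(- 1)%R, x]) a t)%R.
suff BP (t : R) : - 1 < t -> derivable B t 1 /\ derive1 B t = a t.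
  exists B => t /BP[dB B'E]; move: (B) dB B'E => b db b'E.
  by split=> //; rewrite -derive1E.
move=> t1; apply: (@continuous_FTC1_closed R a (- 1) t (t + 1) _ _ t1 (ca t)).
  by rewrite ltrDl.
apply: continuous_compact_integrable; first exact: segment_compact.
exact: continuous_subspaceT.
Qed.

Lemma is_derive_translate (R : realType) (f : R -> R) (t s d : R) :
  is_derive (t + s) (1 : R) f d -> is_derive s (1 : R) (fun r => f (t + r)) d.
Proof.
move=> fd; rewrite -[d]mulr1.
apply: (@is_derive1_comp _ f (fun r => t + r)) => //.
by rewrite -[1 in X in is_derive _ _ _ X]add0r; apply: is_deriveD.
Qed.

Lemma is_derive_increment (R : realType) (h dh : R -> R) (T : R) : 0 <= T ->
  (forall s : R, 0 <= s <= T -> is_derive s (1 : R) h (dh s)) ->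
  exists2 c, 0 <= c <= T & h T - h 0 = dh c * T.
Proof.
move=> T0 hd.
have [||c] := @MVT_segment R h dh 0 T T0.
- by move=> s; rewrite in_itv => /= /andP[s0 sT]; apply: hd; rewrite !ltW.
- apply: continuous_in_subspaceT => s; rewrite inE /= in_itv => /= /hd [ds _].
  exact/differentiable_continuous/derivable1_diffP.
by rewrite in_itv => /= cT; rewrite subr0; exists c.
Qed.

Section Averaging.
Context (R : realType) (X : metricType R) (Phi : X * R -> X).
Context (Phi_flow : is_flow Phi) (X_compact : compact [set: X]).
Context (w : closed_form R X).
Local Notation A := (trajectory_integral Phi w).

Let A_cts : continuous (fun z : X * R => A z.1 z.2).
Proof. exact: (@trajectory_integral_continuous _ _ _ Phi_flow w). Qed.

Let A_ctsl t : continuous (fun x => A x t).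
Proof. exact: (@continuous_slicel _ _ _ (fun z : X * R => A z.1 z.2) t A_cts). Qed.

Let A_ctsr x : continuous (A x).
Proof. exact: (@continuous_slicer _ _ _ (fun z : X * R => A z.1 z.2) x A_cts). Qed.

Let PhiD x s t : Phi (Phi (x, s), t) = Phi (x, s + t).
Proof. by case: Phi_flow => _ _ ->. Qed.

Let Phi0 x : Phi (x, 0) = x. Proof. by case: Phi_flow => _ ->. Qed.

Lemma uniform_escape_time :
  (forall x, exists2 t : R, 1 <= t & A x t < - 1) ->
  exists2 T : R, 0 < T & forall x, exists2 t : R, 1 <= t <= T & A x t < - 1.
Proof.
move=> esc.
have [r r0 rP] : exists2 r : R, 0 < r &
    forall x, exists2 t : R, 1 <= t <= r^-1 & A x t < - 1.
  apply: (@compact_uniform _ _ (fun x r =>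
    exists2 t : R, 1 <= t <= r^-1 & A x t < - 1)) => //.
    move=> x r s /andP[s0 sr] [t /andP[t1 tr] At]; exists t => //.
    by rewrite t1 (le_trans tr) // lef_pV2 // posrE (lt_le_trans s0).
  move=> x; have [t t1 At] := esc x.
  have /nbhs_ballP[rho /= rho0 Arho] : \forall y \near x, A y t < - 1.
    exact: (@A_ctsl t x _ (lt_nbhsl At)).
  have t0 : 0 < t by rewrite (lt_le_trans ltr01).
  exists (Num.min rho t^-1); first by rewrite lt_min rho0 invr_gt0.
  move=> y xy; exists t; last by apply: Arho; apply: le_ball xy; rewrite ge_min lexx.
  rewrite t1 -[leLHS]invrK lef_pV2 ?posrE ?lt_min ?invr_gt0 ?rho0 //.
  by rewrite ge_min lexx orbT.
by exists r^-1; rewrite ?invr_gt0.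
Qed.

Lemma trajectory_integral_bounded (T : R) : 0 <= T ->
  exists2 M : R, 0 < M & forall x (s : R), 0 <= s <= T -> A x s <= M.
Proof.
move=> T0.
have [r r0 rP] : exists2 r : R, 0 < r &
    forall x (s : R), 0 <= s <= T -> A x s <= r^-1.
  apply: (@compact_uniform _ _ (fun x r => forall s : R, 0 <= s <= T -> A x s <= r^-1)) => //.
    move=> x r s /andP[s0 sr] Ar t /Ar Axt.
    by rewrite (le_trans Axt) // lef_pV2 // posrE (lt_le_trans s0).
  move=> x.
  have [|c _ cP] := @EVT_max R (A x) 0 T T0.
    by apply: continuous_subspaceT; exact: A_ctsr.
  pose B := Num.max (A x c) 0 + 1.
  have B0 : 0 < B by rewrite ltr_wpDl // le_max lexx orbT.
  have tube : \forall y \near x, forall s : R, 0 <= s <= T -> A y s < B.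
    apply: (@near_segment R R X (fun z : X * R => A z.1 z.2) x 0 T [set b | b < B]) => //.
    move=> s sT /=; rewrite (le_lt_trans (cP s _)) ?in_itv //.
    by rewrite ltr_pwDr // le_max lexx.
  move: tube => /nbhs_ballP[rho /= rho0 Arho].
  exists (Num.min rho B^-1); first by rewrite lt_min rho0 invr_gt0.
  move=> y xy s sT.
  have Ays : A y s < B.
    by apply: Arho => //; apply: le_ball xy; rewrite ge_min lexx.
  rewrite (le_trans (ltW Ays)) // -[leLHS]invrK.
  rewrite lef_pV2 ?posrE ?lt_min ?invr_gt0 ?rho0 //.
  by rewrite ge_min lexx orbT.
by exists r^-1; rewrite ?invr_gt0.
Qed.

(** An escape of duration [t <= Tm] lowers [A] by more than 1, hence by at least [t / Tm]: decay is
    linear up to the bound [M] on a last incomplete stretch. Since [1 <= t], induction on an integer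
    bound of the time terminates. *)
Lemma uniform_decay_time :
  (forall x, exists2 t : R, 1 <= t & A x t < - 1) ->
  exists2 T : R, 0 < T & forall x, A x T < 0.
Proof.
move=> /uniform_escape_time[Tm Tm0 esc].
have [M M0 AM] := trajectory_integral_bounded (ltW Tm0).
have H (n : nat) : forall x (S : R), 0 <= S -> S <= n%:R ->
    A x S <= M + 1 - S / Tm.
  have small x (S : R) : 0 <= S -> S <= Tm -> A x S <= M + 1 - S / Tm.
    move=> S0 ST; have := AM x S; rewrite S0 ST => /(_ isT).
    by have : S / Tm <= 1 by [rewrite ler_pdivrMr // mul1r]; lra.
  elim: n => [|n IH] x S S0 Sn; first by apply: small => //; lra.
  have [ST|ST] := leP S Tm; first exact: small.
  have [t /andP[t1 tT] At] := esc x.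
  have := trajectory_integralD Phi_flow w x t (S - t); rewrite subrKC => ->.
  have : A (Phi (x, t)) (S - t) <= M + 1 - (S - t) / Tm.
    by apply: IH; first lra; move: Sn; rewrite -natr1; lra.
  have : t / Tm <= 1 by rewrite ler_pdivrMr // mul1r.
  by rewrite mulrBl; lra.
(* At this time the bound [M + 1 - S / Tm] equals -1. *)
exists (Tm * (M + 2)); first by rewrite mulr_gt0 //; lra.
move=> x; have S0 : 0 <= Tm * (M + 2) by rewrite mulr_ge0 //; lra.
have := H (Num.bound `|Tm * (M + 2)|) x _ S0 (le_bound_norm _).
by rewrite mulrAC divff ?gt_eqF // mul1r; lra.
Qed.

(* The time average [f] of [A x s] over [0 <= s <= T] satisfies
   [T * (A x t + f (Phi (x, t))) = \int_t^(t + T) A x s ds], hence the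
   trajectory integral of [w + df] has derivative [A (Phi (x, t)) T / T]. *)
Lemma smooth_lyapunov_form (T : R) : 0 < T -> (forall x, A x T < 0) ->
  exists2 w', form_class w' = form_class w & forall x (t : R), exists2 d : R,
    d < 0 & is_derive t (1 : R) (trajectory_integral Phi w' x) d.
Proof.
move=> T0 AT.
have /choice[B BP] (x : X) : exists B : R -> R,
    forall t : R, - 1 < t -> is_derive t (1 : R) B (A x t).
  exact: continuous_antiderivative.
pose f x := (B x T - B x 0) / T.
have f_cts : continuous f.
  move=> x; apply/cvgrPdist_le => e e0.
  have tube : \forall y \near x, forall s : R, 0 <= s <= T -> `|A y s - A x s| < e.
    apply: (@near_segment R R X (fun z : X * R => A z.1 z.2 - A x z.2) x 0 T
      [set b | `|b| < e]).
    - move=> z; apply: cvgB; first exact: A_cts.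
      apply: (@continuous_comp _ _ _ snd (A x)); first exact: cvg_snd.
      exact: A_ctsr.
    - have -> : [set b : R | `|b| < e] = ball 0 e.
        by apply/seteqP; split=> b; rewrite /ball /= sub0r normrN.
      exact: ball_open.
    - by move=> s _; rewrite /= subrr normr0.
  apply: filterS tube => y Ay.
  (* By the mean value theorem the averages differ by a value of [A y s - A x s], which the tube
     bounds by [e]. *)
  have [|s sT] := @is_derive_increment R (fun s => B y s - B x s)
      (fun s => A y s - A x s) T (ltW T0).
    move=> s /andP[s0 sT]; have s1 : - 1 < s by lra.
    by apply: is_deriveB; exact: BP.
  move=> e1; rewrite distrC /f -mulrBl.
  rewrite (_ : B y T - _ - _ = (A y s - A x s) * T); last by rewrite -e1; lra.
  by rewrite mulfK ?gt_eqF // ltW // Ay.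
have fE x (t : R) : - 1 < t -> A x t + f (Phi (x, t)) = (B x (t + T) - B x t) / T.
  move=> t1.
  have [|s sT] := @is_derive_increment R
      (fun s => B (Phi (x, t)) s + A x t * s - B x (t + s)) (fun=> 0) T (ltW T0).
    move=> s /andP[s0 sT]; have s1 : - 1 < s by lra.
    have ts1 : - 1 < t + s by lra.
    have d1 := BP (Phi (x, t)) _ s1.
    have d2 := is_derive_translate (BP x _ ts1).
    have d3 : is_derive s (1 : R) (fun r => A x t * r) (A x t * 1).
      exact: is_deriveZ.
    apply: (is_derive_eq (is_deriveB (is_deriveD d1 d3) d2)).
    by rewrite (trajectory_integralD Phi_flow); lra.
  rewrite mul0r addr0 mulr0 => e1; rewrite /f.
  rewrite (_ : B (Phi (x, t)) T - _ = B x (t + T) - B x t - A x t * T); last by lra.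
  by rewrite mulrBl mulfK ?gt_eqF //; lra.
exists (shift_form w f_cts); first exact: shift_form_class.
have AfE x t : trajectory_integral Phi (shift_form w f_cts) x t =
    A x t + f (Phi (x, t)) - f x.
  have := integral_form_difference (@shift_form_difference _ _ w f f_cts)
    (@trajectory_path_continuous _ _ _ Phi_flow x t).
  by rewrite /trajectory_integral mul1r mul0r Phi0; lra.
(* The derivative is computed only at time 0, inside the domain of the formula [fE]; the cocycle
   identity then carries it to every [t]. *)
have derive0 x : is_derive (0 : R) (1 : R)
    (trajectory_integral Phi (shift_form w f_cts) x) (A x T / T).
  have d1 : is_derive (0 : R) (1 : R) (fun t => B x (T + t)) (A x T).
    by apply: is_derive_translate; rewrite addr0; apply: BP; lra.
  have d2 : is_derive (0 : R) (1 : R) (B x) (A x 0) by apply: BP; lra.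
  rewrite trajectory_integral0 // in d2.
  have d3 := is_deriveB (is_deriveZ T^-1 (is_deriveB d1 d2))
    (is_derive_cst (f x) (0 : R) (1 : R)).
  have {}d3 := is_derive_eq d3 (_ : _ = A x T / T).
  apply: near_eq_is_derive (d3 _); last by rewrite !subr0 mulrC.
  have H : \forall t \near (0 : R), - 1 < t by apply: lt_nbhsr; lra.
  apply: filterS H => t t1; rewrite AfE fE // [t + T]addrC.
  by rewrite [X in _ = X - _]mulrC.
move=> x t; exists (A (Phi (x, t)) T / T).
  by rewrite pmulr_llt0 ?invr_gt0.
pose Af := trajectory_integral Phi (shift_form w f_cts).
rewrite -/Af; have -> : Af x = (fun s => Af x t + Af (Phi (x, t)) (- t + s)).
  apply/funext => s; rewrite -(trajectory_integralD Phi_flow).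
  by rewrite addrA subrr add0r.
rewrite -[X in is_derive _ _ _ X]add0r; apply: is_deriveD.
by apply: is_derive_translate; rewrite addNr; exact: derive0.
Qed.

End Averaging.

Lemma negative_derivative_lt (R : realType) (a : R -> R) :
  (forall t : R, exists2 d : R, d < 0 & is_derive t (1 : R) a d) ->
  forall s t : R, s < t -> a t < a s.
Proof.
move=> ad s t st.
have der r : derivable a r 1 by have [d _ []] := ad r.
have neg r : derive1 a r < 0.
  by have [d d0 [_ da]] := ad r; rewrite derive1E da.
apply: (@ltr0_derive1_decr _ a s t) => //; apply: continuous_subspaceT => r.
exact/differentiable_continuous/derivable1_diffP.
Qed.

(** * Equivalence of the cycle condition with the existence of a Lyapunov form *)

Section LyapunovCriterion.
Context (R : realType) (X : metricType R) (Phi : X * R -> X).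
Context (Phi_flow : is_flow Phi) (X_compact : compact [set: X]).

(** By compactness a unit of time lowers the integral by at least some [c] everywhere, and the
    remaining time [t - n] can only lower it further. *)
Lemma lyapunov_linear_decay (w : closed_form R X) : is_lyapunov_form Phi w ->
  exists2 c, 0 < c & forall (n : nat) x (t : R), n%:R <= t ->
    trajectory_integral Phi w x t <= - c * n%:R.
Proof.
move=> lyap; pose A := trajectory_integral Phi w.
have [r r0 rP] : exists2 r : R, 0 < r & forall x, A x 1 <= - r.
  apply: (@compact_uniform _ _ (fun x r => A x 1 <= - r)) => //.
    by move=> x r s /andP[s0 sr] Ax; lra.
  move=> x; have Ax1 : A x 1 < A x 1 / 2.
    by have := lyap x 1 ltr01; rewrite -/A; lra.
  have /nbhs_ballP[rho /= rho0 Arho] : \forall y \near x, A y 1 < A x 1 / 2.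
    exact: (@continuous_slicel _ _ _ (fun z : X * R => A z.1 z.2) 1
      (@trajectory_integral_continuous _ _ _ Phi_flow w) x _ (lt_nbhsl Ax1)).
  exists (Num.min rho (- (A x 1 / 2))).
    by rewrite lt_min rho0; have := lyap x 1 ltr01; rewrite -/A; lra.
  move=> y xy.
  have Ay : A y 1 < A x 1 / 2.
    by apply: Arho; apply: le_ball xy; rewrite ge_min lexx.
  rewrite lerNr ge_min; apply/orP; right.
  by rewrite lerN2 ltW.
exists r => //; elim=> [|n IH] x t nt.
  rewrite mulr0; move: nt; rewrite le_eqVlt => /predU1P[<-|t0].
    by rewrite trajectory_integral0.
  by rewrite ltW // lyap.
have := trajectory_integralD Phi_flow w x 1 (t - 1); rewrite subrKC => ->.
have := rP x; have := IH (Phi (x, 1)) (t - 1).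
by move: nt; rewrite /A -[n.+1%:R]natr1 => nt H1 H2; have := H1 ltac:(lra); lra.
Qed.

Lemma lyapunov_escape (w : closed_form R X) : is_lyapunov_form Phi w ->
  forall x, exists2 t : R, 1 <= t & trajectory_integral Phi w x t < - 1.
Proof.
move=> /lyapunov_linear_decay[c c0 cP] x.
pose n := (Num.bound `|2 / c|).+1.
exists n%:R; first by rewrite ler1n.
rewrite (le_lt_trans (cP n x _ (lexx _))) // mulNr ltrN2.
rewrite -ltr_pdivrMl // mulr1 (lt_le_trans _ (_ : 2 / c <= _)) //.
  by rewrite -[ltLHS]mul1r ltr_pM2r ?invr_gt0 // ltr1n.
by rewrite (le_trans (le_bound_norm _)) // ler_nat.
Qed.

Lemma is_lyapunov_smooth (w : closed_form R X) :
  (forall x (t : R), exists2 d : R, d < 0 &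
     is_derive t (1 : R) (trajectory_integral Phi w x) d) ->
  is_lyapunov_form Phi w.
Proof.
move=> wd x t t0; rewrite -(trajectory_integral0 Phi_flow w x).
exact: (negative_derivative_lt (wd x)).
Qed.

Lemma lyapunov_condition_i (w : closed_form R X) (eps delta0 : R) :
  is_scale (form_class w) eps delta0 -> is_lyapunov_form Phi w ->
  R_xi Phi (form_class w) eps delta0 = set0 /\
  exists delta T : R, 0 < delta /\ 1 < T /\
    forall x t, is_delta_cycle Phi delta T x t ->
      forall z, associated_cycle Phi eps x t z -> pairing (form_class w) z <= - 1.
Proof.
move=> [eps0 delta00 wball scale] lyap.
have [c c0 cP] := lyapunov_linear_decay lyap.
have [r r0 rP] := small_path_integral X_compact eps0 ltr01 wball.
(* From this time on the trajectory contributes at most -2, which leaves room for a closing path of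
   integral at most 1. *)
pose n := (Num.bound `|2 / c|).+1.
have cn x t : n.+1%:R <= t -> trajectory_integral Phi w x t <= - 2.
  move=> nt; rewrite (le_trans (cP n x t _)) //.
    by rewrite (le_trans _ nt) // ler_nat.
  rewrite mulNr lerN2 -ler_pdivrMl // mulrC (le_trans (le_bound_norm _)) //.
  by rewrite ler_nat.
have step x t y (g : R -> X) b : n.+1%:R <= t -> is_path g (Phi (x, t)) y ->
    g @` `[0, 1] `<=` ball b eps -> mdist (Phi (x, t)) y < r ->
    trajectory_integral Phi w x t + integral w g <= - 1.
  move=> nt gP gb xy; have := cn x t nt; have := rP b _ _ g gP gb xy.
  by rewrite ler_norml; lra.
split; last first.
  exists r, n.+1%:R; split => //; split; first by rewrite ltr1n.
  move=> x t [nt xt] z /(associated_pairing w)[sig [sigP ->]].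
  rewrite big_ord1; have [gP [b gb]] := sigP 0%N isT.
  by apply: step gP gb _ => //; rewrite metric_sym.
apply/seteqP; split => // x.
(* Below [delta0], as [R_xi] requires and so that closing paths exist, and below [r], so that their
   integrals are at most 1. Each of the [N] steps then contributes at most -1, which contradicts a
   zero pairing. *)
pose delta' := Num.min (delta0 / 2) (r / 2).
have d0 : 0 < delta' by rewrite lt_min !divr_gt0.
have d1 : delta' < delta0 by rewrite /delta' gt_min; apply/orP; left; lra.
have d2 : delta' < r by rewrite /delta' gt_min; apply/orP; right; lra.
move=> /(_ delta' n.+1%:R d0 d1); rewrite ltr1n => /(_ isT).
move=> [N [xs [ts [[N0 xs0 xsN chP] zP]]]].
have [||z zas] := @associated_exists _ _ _ Phi_flow eps N xs ts.
- by rewrite xs0 xsN.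
- move=> i iN; have [_ xi] := chP i iN.
  have [g [b gb]] := scale _ _ (lt_trans xi d1).
  by exists g, b.
have := zP z zas.
have [sig [sigP ->]] := associated_pairing w zas => sum0.
have : \sum_(i < N) (trajectory_integral Phi w (xs i) (ts i.+1) +
    integral w (sig i)) <= \sum_(i < N) (- 1).
  apply: ler_sum => i _; have [gP [b gb]] := sigP i (ltn_ord i).
  have [nt xi] := chP i (ltn_ord i).
  by apply: step gP gb _ => //; exact: lt_trans d2.
rewrite sum0 sumr_const card_ord mulNrn oppr_ge0 lern0 => /eqP Nle0.
by rewrite Nle0 in N0.
Qed.

(** For close ends the closing path contributes at most 1/2 in absolute value, so a pairing at most
    -1 forces the trajectory integral down to -1/2. *)
Lemma recurrent_decay (w : closed_form R X) (eps delta0 delta T : R) :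
  is_scale (form_class w) eps delta0 -> 0 < delta ->
  (forall x t, chain_recurrent Phi x -> is_delta_cycle Phi delta T x t ->
    forall z, associated_cycle Phi eps x t z -> pairing (form_class w) z <= - 1) ->
  exists2 rho, 0 < rho & forall x t, chain_recurrent Phi x ->
    is_delta_cycle Phi rho T x t -> trajectory_integral Phi w x t <= - 2^-1.
Proof.
move=> [eps0 delta00 wball scale] d0 cyc.
have half0 : 0 < 2^-1 :> R by rewrite invr_gt0.
have [r r0 rP] := small_path_integral X_compact eps0 half0 wball.
pose rho := Num.min delta (Num.min delta0 r).
have rho1 : rho <= delta by rewrite /rho ge_min lexx.
have rho2 : rho <= delta0 by rewrite /rho !ge_min lexx orbT.
have rho3 : rho <= r by rewrite /rho !ge_min lexx !orbT.
exists rho; first by rewrite !lt_min d0 delta00.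
move=> x t xR [Tt xt].
have [||z zas] := @associated_exists _ _ _ Phi_flow eps 1 (fun=> x) (fun=> t) => //.
  move=> i _; have [|g [b gb]] := scale (Phi (x, t)) x.
    by rewrite metric_sym (lt_le_trans xt).
  by exists g, b.
have := cyc x t xR (conj Tt (lt_le_trans xt rho1)) z zas.
have [sig [sigP ->]] := associated_pairing w zas.
rewrite big_ord1; have [gP [b gb]] := sigP 0%N isT.
have := rP b _ _ _ gP gb; rewrite metric_sym => /(_ (lt_le_trans xt rho3)).
by rewrite ler_norml; lra.
Qed.

Lemma nonzero_class_inhabited (xi : cech1 X R) : xi <> cech0 X R -> exists x : X, True.
Proof.
move=> xi0; apply: contrapT => X0; apply: xi0.
rewrite -[LHS]cech_class_repr; apply/cech_classP/cohomologousP.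
by exists (fun _ _ _ => 0); split=> [U V _ _ x|U V U' V' x]; case: X0; exists x.
Qed.

(* If no form represented [xi], every pairing would have the junk value 0. *)
Lemma condition_i_form (xi : cech1 X R) (eps delta0 delta T : R) :
  xi <> cech0 X R -> is_scale xi eps delta0 -> 0 < delta ->
  (forall x t, chain_recurrent Phi x -> is_delta_cycle Phi delta T x t ->
    forall z, associated_cycle Phi eps x t z -> pairing xi z <= - 1) ->
  exists w : closed_form R X, form_class w = xi.
Proof.
move=> /nonzero_class_inhabited[x _] [eps0 delta00 _ scale] d0 cyc.
have [y yR] := chain_recurrent_orbit Phi_flow X_compact x.
pose rho := Num.min delta delta0.
have rho0 : 0 < rho / 2 by rewrite divr_gt0 // lt_min d0.
have rho1 : rho <= delta by rewrite /rho ge_min lexx.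
have rho2 : rho <= delta0 by rewrite /rho ge_min lexx orbT.
have [p pP] := flow_returns Phi X_compact y rho0.
have [s [_ _ ps]] := pP 0; have [s' [ss' _ ps']] := pP (s + T).
have PhiD u a b : Phi (Phi (u, a), b) = Phi (u, a + b) by case: Phi_flow => _ _ ->.
have dist : mdist (Phi (y, s)) (Phi (Phi (y, s), s' - s)) < rho.
  rewrite PhiD subrKC (le_lt_trans (metric_triangle _ p _)) // (splitr rho).
  by rewrite ltrD // metric_sym.
have [||z zas] := @associated_exists _ _ _ Phi_flow eps 1
  (fun=> Phi (y, s)) (fun=> s' - s) => //.
  move=> i _; have [|g [b gb]] := scale (Phi (Phi (y, s), s' - s)) (Phi (y, s)).
    by rewrite metric_sym (lt_le_trans dist).
  by exists g, b.
apply: (pairing_form (z := z)) => z0.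
have := cyc (Phi (y, s)) (s' - s) (yR s) _ z zas.
rewrite z0 /is_delta_cycle => /(_ ltac:(split; [lra | exact: lt_le_trans rho1])).
by lra.
Qed.

Lemma condition_i_lyapunov (xi : cech1 X R) (eps delta0 delta T : R) :
  xi <> cech0 X R -> is_scale xi eps delta0 -> 0 < delta ->
  (forall x t, chain_recurrent Phi x -> is_delta_cycle Phi delta T x t ->
    forall z, associated_cycle Phi eps x t z -> pairing xi z <= - 1) ->
  exists w : closed_form R X, is_lyapunov_form Phi w /\ form_class w = xi.
Proof.
move=> xi0 scale d0 cyc.
have [w wxi] := condition_i_form xi0 scale d0 cyc.
move: scale cyc; rewrite -wxi => scale cyc.
have [rho rho0 decay] := recurrent_decay scale d0 cyc.
have esc := escape_of_recurrent_decay Phi_flow X_compact rho0 decay.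
have [T0 T00 AT] := uniform_decay_time Phi_flow X_compact esc.
have [w' w'w w'd] := smooth_lyapunov_form Phi_flow T00 AT.
by exists w'; split => //; exact: is_lyapunov_smooth.
Qed.

End LyapunovCriterion.

(** * The circle and its fundamental class *)

Lemma continuous_affine2 (R : realType) (T : topologicalType) (f g : T -> R)
    (x : T) (a b c : R) : {for x, continuous f} -> {for x, continuous g} ->
  {for x, continuous (fun y => f y * a + g y * b + c)}.
Proof.
move=> cf cg; apply: cvgD; last exact: cvg_cst.
by apply: cvgD; (apply: cvgM; last exact: cvg_cst).
Qed.

Lemma continuous_sub_at (R : realType) (T : topologicalType) (f g : T -> R) (x : T) :
  {for x, continuous f} -> {for x, continuous g} ->
  {for x, continuous (fun y => f y - g y)}.
Proof. by move=> cf cg; exact: cvgB. Qed.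

Section CirclePoints.
Context (R : realType).
Implicit Types (t s : R) (z : circle R).

Definition cx z : R := complex.Re (val z : R[i]).
Definition cy z : R := complex.Im (val z : R[i]).

Lemma cx_cy_norm z : cx z ^+ 2 + cy z ^+ 2 = 1.
Proof.
have : `|val z : R[i]| = 1 by exact: (set_mem (valP z)).
rewrite normc_def => -[/(congr1 (fun x => x ^+ 2))].
by rewrite sqr_sqrtr ?expr1n // addr_ge0 // sqr_ge0.
Qed.

Lemma circle_ext z z' : cx z = cx z' -> cy z = cy z' -> z = z'.
Proof.
move=> ex ey; apply: val_inj; apply/eqP.
by rewrite (@eq_complex R (val z) (val z')); apply/andP; split; apply/eqP.
Qed.

Lemma expi_circle t : expi (2 * pi * t) \in circle R.
Proof.
apply/mem_set; rewrite /circle /= /expi normc_def /=.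
by rewrite cos2Dsin2 sqrtr1.
Qed.

(** Angles are counted in turns, so that two branches differ by integers, as values of an integral
    cocycle do. *)
Definition turn t : circle R := exist _ (expi (2 * pi * t)) (expi_circle t).

Lemma cx_turn t : cx (turn t) = cos (2 * pi * t). Proof. by []. Qed.
Lemma cy_turn t : cy (turn t) = sin (2 * pi * t). Proof. by []. Qed.

Lemma Cplx_real_gt0 (e : Cplx R) : 0 < e -> exists2 r : R, 0 < r & e = (r%:C)%C.
Proof.
case: e => a b; rewrite (@ltcE R 0 (Complex a b)) /= => /andP[/eqP b0 a0].
by exists a => //; rewrite b0.
Qed.

Lemma cx_continuous : continuous cx.
Proof.
move=> z.
have cRe : continuous (fun x : Cplx R => complex.Re (x : R[i])).
  move=> x U /nbhs_ballP[e /= e0 eU]; apply/nbhs_ballP.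
  exists ((e%:C)%C : Cplx R); first by rewrite /= ltcR.
  move=> y xy; apply: eU; rewrite /ball /= -ltcR.
  apply: le_lt_trans xy.
  have -> : complex.Re (x : R[i]) - complex.Re (y : R[i]) = complex.Re (x - y : R[i]).
    by case: (x) (y) => a b [c d].
  exact: normc_ge_Re.
apply: (@continuous_comp _ _ _ (set_val : circle R -> Cplx R) _ z).
  exact: initial_continuous.
exact: cRe.
Qed.

Lemma cy_continuous : continuous cy.
Proof.
move=> z.
have cIm : continuous (fun x : Cplx R => complex.Im (x : R[i])).
  move=> x U /nbhs_ballP[e /= e0 eU]; apply/nbhs_ballP.
  exists ((e%:C)%C : Cplx R); first by rewrite /= ltcR.
  move=> y xy; apply: eU; rewrite /ball /= -ltcR.
  apply: le_lt_trans xy.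
  have -> : complex.Im (x : R[i]) - complex.Im (y : R[i]) = complex.Im (x - y : R[i]).
    by case: (x) (y) => a b [c d].
  by rewrite normc_def lecR -sqrtr_sqr; apply: ler_wsqrtr; rewrite lerDr sqr_ge0.
apply: (@continuous_comp _ _ _ (set_val : circle R -> Cplx R) _ z).
  exact: initial_continuous.
exact: cIm.
Qed.

Lemma circle_continuous (T : topologicalType) (f : T -> circle R) :
  continuous (cx \o f) -> continuous (cy \o f) -> continuous f.
Proof.
move=> cxf cyf; apply: continuous_comp_initial => t.
move=> U /nbhs_ballP[e /= /Cplx_real_gt0[r r0 ->] rU].
have r2 : 0 < r / 2 by rewrite divr_gt0.
have /cvgrPdist_lt/(_ _ r2) Hx := cxf t.
have /cvgrPdist_lt/(_ _ r2) Hy := cyf t.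
apply: filterS2 Hx Hy => s /= sx sy; apply: rU; rewrite /ball /=.
have -> : val (f t) - val (f s) =
    (Complex (cx (f t) - cx (f s)) (cy (f t) - cy (f s)) : Cplx R).
  by rewrite /cx /cy; case: (val (f t)) (val (f s)) => a b [c d].
rewrite (@normc_def R (Complex _ _)) ltcR /=.
apply: le_lt_trans (_ : `|cx (f t) - cx (f s)| + `|cy (f t) - cy (f s)| < r); last first.
  by rewrite (splitr r) ltrD.
move: (cx (f t) - _) (cy (f t) - _) => a b.
have -> : `|a| + `|b| = Num.sqrt ((`|a| + `|b|) ^+ 2).
  by rewrite sqrtr_sqr [RHS]ger0_norm ?addr_ge0.
apply: ler_wsqrtr; rewrite sqrrD !real_normK ?num_real // addrAC lerDl.
by rewrite mulrn_wge0 // mulr_ge0.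
Qed.

Lemma turn_continuous : continuous turn.
Proof.
have c2 : continuous (fun t => 2 * pi * t).
  by move=> t; apply: cvgM; [exact: cvg_cst | exact: cvg_id].
apply: circle_continuous => t.
  apply: (@continuous_comp _ _ _ (fun t => 2 * pi * t) cos); first exact: c2.
  exact: continuous_cos.
apply: (@continuous_comp _ _ _ (fun t => 2 * pi * t) sin); first exact: c2.
exact: continuous_sin.
Qed.

Lemma turnD1 t : turn (t + 1) = turn t.
Proof.
have e : 2 * pi * (t + 1) = 2 * pi * t + pi *+ 2 by rewrite -mulr_natl; lra.
by apply: circle_ext; rewrite /cx /cy /= e ?cosD2pi ?sinD2pi.
Qed.

Lemma turnDn t (n : nat) : turn (t + n%:R) = turn t.
Proof.
elim: n => [|n IH]; first by rewrite addr0.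
by rewrite -natr1 addrA turnD1.
Qed.

Lemma turnDz t (n : int) : turn (t + n%:~R) = turn t.
Proof.
case: n => n; first exact: turnDn.
by rewrite NegzE mulrNz -(turnDn (t - _) n.+1) subrK.
Qed.

(** The addition formula gives a difference whose cosine is 1. Its fractional part [r], or [1 - r]
    when [r] exceeds 1/2, falls in the range where [acos] inverts [cos], which forces [r = 0]. *)
Lemma turn_eq s t : turn s = turn t -> s - t \is a Num.int.
Proof.
move=> st; pose d := s - t.
have cd : cos (2 * pi * d) = 1.
  have -> : 2 * pi * d = 2 * pi * s - 2 * pi * t by rewrite /d; lra.
  rewrite cosB -!cx_turn -!cy_turn st -!expr2; exact: cx_cy_norm.
pose r := d - (Num.floor d)%:~R.
have /andP[r0 r1] : 0 <= r < 1.
  by have := floor_itv d; rewrite -[(_ + 1)%:~R]/((_ + 1%:Z)%:~R) intrD /r; lra.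
have cr : cos (2 * pi * r) = 1.
  by rewrite -cx_turn /r -mulrNz turnDz cx_turn.
have p0 := pi_gt0 R.
suff r00 : r = 0.
  by rewrite -/d (_ : d = (Num.floor d)%:~R) ?intr_int //; rewrite /r in r00; lra.
have [rh|rh] := leP r 2^-1.
  have : acos (cos (2 * pi * r)) = 2 * pi * r.
    apply: cosK; rewrite in_itv /=; apply/andP; split; first by rewrite !mulr_ge0 // ltW.
    by rewrite mulrAC -[leRHS]mul1r ler_pM2r //; lra.
  rewrite cr acos1 => /esym/eqP; rewrite !mulf_eq0 (gt_eqF p0) pnatr_eq0 /=.
  by move/eqP.
have : acos (cos (2 * pi * (1 - r))) = 2 * pi * (1 - r).
  apply: cosK; rewrite in_itv /=; apply/andP; split.
    by rewrite !mulr_ge0 ?ltW //; lra.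
  by rewrite mulrAC -[leRHS]mul1r ler_pM2r //; lra.
have -> : cos (2 * pi * (1 - r)) = 1.
  rewrite (_ : 2 * pi * (1 - r) = - (2 * pi * r) + pi *+ 2); last first.
    by rewrite -mulr_natl; lra.
  by rewrite cosD2pi cosN.
rewrite acos1 => /esym/eqP; rewrite !mulf_eq0 (gt_eqF p0) pnatr_eq0 /=.
by move=> /eqP; lra.
Qed.

(** [arc_cos] and [arc_sin] are the coordinates of [z] rotated back by [t] turns, so [arc t] is the
    open half-circle centred at [turn t]. *)
Definition arc_cos t z := cx z * cos (2 * pi * t) + cy z * sin (2 * pi * t).
Definition arc_sin t z := cy z * cos (2 * pi * t) - cx z * sin (2 * pi * t).
Definition arc t : set (circle R) := [set z | 0 < arc_cos t z].

(* The branch on [arc t] of the argument, counted in turns. *)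
Definition lift t z : R := t + asin (arc_sin t z) / (2 * pi).

Lemma arc_cos_sin t z : arc_cos t z ^+ 2 + arc_sin t z ^+ 2 = 1.
Proof.
have := cx_cy_norm z; have := cos2Dsin2 (2 * pi * t).
rewrite /arc_cos /arc_sin; set a := cos _; set b := sin _ => e1 e2.
transitivity ((cx z ^+ 2 + cy z ^+ 2) * (a ^+ 2 + b ^+ 2)); first by ring.
by rewrite e1 e2 mulr1.
Qed.

Lemma arc_sin_lt1 t z : arc t z -> -1 < arc_sin t z < 1.
Proof.
rewrite /arc /= => c0; have e := arc_cos_sin t z.
have : arc_sin t z ^+ 2 < 1 by rewrite -e ltrDr exprn_gt0.
by rewrite -[ltLHS]real_normK ?num_real // expr_lt1 // ltr_norml.
Qed.

Lemma turn_lift t z : arc t z -> turn (lift t z) = z.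
Proof.
move=> zt; have /andP[s1 s2] := arc_sin_lt1 zt; have e := arc_cos_sin t z.
have p0 := pi_gt0 R.
have angle : 2 * pi * lift t z = 2 * pi * t + asin (arc_sin t z).
  rewrite /lift mulrDr mulrCA divff ?mulr1 //.
  by rewrite mulf_neq0 // gt_eqF.
have sE : sin (asin (arc_sin t z)) = arc_sin t z.
  by apply: asinK; rewrite in_itv /= !ltW.
have cE : cos (asin (arc_sin t z)) = arc_cos t z.
  rewrite cos_asin ?ltW // (_ : 1 - _ = arc_cos t z ^+ 2) ?sqrtr_sqr ?gtr0_norm //.
  by rewrite -e addrK.
have e1 := cos2Dsin2 (2 * pi * t).
apply: circle_ext.
  rewrite cx_turn angle cosD sE cE /arc_cos /arc_sin.
  transitivity (cx z * (cos (2 * pi * t) ^+ 2 + sin (2 * pi * t) ^+ 2)); first by ring.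
  by rewrite e1 mulr1.
rewrite cy_turn angle sinD sE cE /arc_cos /arc_sin.
transitivity (cy z * (cos (2 * pi * t) ^+ 2 + sin (2 * pi * t) ^+ 2)); first by ring.
by rewrite e1 mulr1.
Qed.

Lemma turn_arc t : arc t (turn t).
Proof.
by rewrite /arc /= /arc_cos cx_turn cy_turn -!expr2 cos2Dsin2.
Qed.

Lemma arc_cover z : exists t, arc t z.
Proof.
have e := cx_cy_norm z.
have [x0|x0|x0] := ltgtP (cx z) 0.
- exists 2^-1; rewrite /arc /= /arc_cos (_ : 2 * pi * 2^-1 = pi); last by lra.
  by rewrite cospi sinpi mulr0 addr0 mulrN1 oppr_gt0.
- by exists 0; rewrite /arc /= /arc_cos mulr0 cos0 sin0 mulr0 addr0 mulr1.
have [y0|y0|y0] := ltgtP (cy z) 0.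
- exists (- 4^-1); rewrite /arc /= /arc_cos.
  rewrite (_ : 2 * pi * - 4^-1 = - (pi / 2)); last by lra.
  by rewrite cosN sinN cos_pihalf sin_pihalf mulr0 add0r mulrN1 oppr_gt0.
- exists 4^-1; rewrite /arc /= /arc_cos.
  rewrite (_ : 2 * pi * 4^-1 = pi / 2); last by lra.
  by rewrite cos_pihalf sin_pihalf mulr0 add0r mulr1.
- by move: e; rewrite x0 y0 !expr0n /= addr0 => /eqP; rewrite eq_sym oner_eq0.
Qed.

Lemma turn_surj z : exists t, turn t = z.
Proof. by have [t zt] := arc_cover z; exists (lift t z); exact: turn_lift. Qed.

Lemma arc_open t : open (arc t).
Proof.
have c : continuous (arc_cos t).
  have -> : arc_cos t =
      fun z => cx z * cos (2 * pi * t) + cy z * sin (2 * pi * t) + 0.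
    by apply/funext => z; rewrite addr0.
  by move=> z; apply: continuous_affine2; [exact: cx_continuous | exact: cy_continuous].
exact: (open_comp (fun z _ => c z) (@open_gt R 0)).
Qed.

Lemma lift_continuous t z : arc t z -> {for z, continuous (lift t)}.
Proof.
move=> zt.
have c : {for z, continuous (arc_sin t)}.
  have -> : arc_sin t =
      fun z => cy z * cos (2 * pi * t) + cx z * - sin (2 * pi * t) + 0.
    by apply/funext => z'; rewrite addr0 mulrN.
  by apply: continuous_affine2; [exact: cy_continuous | exact: cx_continuous].
have -> : lift t = fun z => asin (arc_sin t z) * (2 * pi)^-1 + 0 * 0 + t.
  by apply/funext => z'; rewrite mulr0 addr0 addrC.
apply: continuous_affine2; last exact: cst_continuous.
exact: (continuous_comp c (continuous_asin (arc_sin_lt1 zt))).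
Qed.

Lemma lift_itv t z : arc t z -> `|lift t z - t| < 4^-1.
Proof.
move=> /arc_sin_lt1/andP[s1 s2]; have p0 := pi_gt0 R.
have h1 := @asin_ltpi2 R (arc_sin t z); rewrite s2 ltW // in h1.
have h2 := @asin_gtNpi2 R (arc_sin t z); rewrite s1 ltW // in h2.
rewrite /lift addrAC subrr add0r ltr_norml.
rewrite ltr_pdivlMr ?ltr_pdivrMr ?mulr_gt0 //.
by have := h1 isT; have := h2 isT; lra.
Qed.

End CirclePoints.

Lemma int_near_eq (R : realType) (T : topologicalType) (f : T -> R) (x : T) :
  {for x, continuous f} -> f x \is a Num.int ->
  (\forall y \near x, f y \is a Num.int) -> \forall y \near x, f y = f x.
Proof.
move=> /cvgrPdist_lt/(_ 1 ltr01) cf fx; apply: filterS2 cf => y fxy fy.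
apply/eqP; rewrite eq_sym -subr_eq0; apply: contraTT fxy => fxy0.
by rewrite -leNgt norm_intr_ge1 // rpredB.
Qed.

Lemma turn_int (R : realType) (s t : R) : s - t \is a Num.int -> turn s = turn t.
Proof.
move=> /intrP[n nE]; have -> : s = t + n%:~R by rewrite -nE addrC subrK.
exact: turnDz.
Qed.

Section IntegralCochain.
Context (R : realType) (X : topologicalType) (w : closed_form R X).
Context (c : cocycle X int) (psi : set X -> X -> R).
Context (psiP : forall U x, ccover c U -> U x -> near_primitive w (psi U) x).
Context (psiE : forall U V x, ccover c U -> ccover c V -> U x -> V x ->
  (cval c U V x)%:~R = psi V x - psi U x).

Lemma cochain_transition U V x : ccover c U -> ccover c V -> U x -> V x ->
  psi V x - psi U x \is a Num.int.
Proof. by move=> *; rewrite -psiE // intr_int. Qed.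

(** Integrality of [psi U (h v) - b v] does not depend on [U], because the jumps are integers, and
    is locally constant in [v], because [psi U] and [b] have equal increments. So
    [locally_constant_cst] applies with values in [Prop]. *)
Lemma cochain_along_path (h : R -> X) (b : R -> R) U0 : continuous h ->
  (forall t0 W, fcover w W -> W (h t0) -> \forall t \near t0,
     b t - b t0 = fphi w W (h t) - fphi w W (h t0)) ->
  ccover c U0 -> U0 (h 0) -> psi U0 (h 0) - b 0 \is a Num.int ->
  forall t U, ccover c U -> U (h t) -> psi U (h t) - b t \is a Num.int.
Proof.
move=> ch bP cU0 U00 b0.
pose P v := forall U, ccover c U -> U (h v) -> psi U (h v) - b v \is a Num.int.
have PE v U : ccover c U -> U (h v) -> P v = (psi U (h v) - b v \is a Num.int).
  move=> cU Uv; apply/propext; split=> [|Pv V cV Vv]; first by apply.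
  rewrite -(subrKA (psi U (h v))) rpredD //.
  exact: cochain_transition.
move=> t; rewrite -/(P t); suff -> : P t = P 0 by rewrite (PE 0 U0).
apply: locally_constant_cst => v0.
have [U cU Uv0] := cocycle_cover c (h v0).
have [W cW Wv0] := form_cover w (h v0).
have Un : \forall v \near v0, U (h v) by exact: (ch v0 _ (cocycle_nbhs cU Uv0)).
have psin : \forall v \near v0, psi U (h v) - psi U (h v0) =
    fphi w W (h v) - fphi w W (h v0).
  exact: (ch v0 _ (psiP cU Uv0 cW Wv0)).
near=> u.
have Uu : U (h u) by near: u.
rewrite (PE u U) // (PE v0 U) //; congr (is_true (_ \is a _)).
have e1 : psi U (h u) - psi U (h v0) = fphi w W (h u) - fphi w W (h v0).
  by near: u.
have e2 : b u - b v0 = fphi w W (h u) - fphi w W (h v0).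
  by near: u; exact: bP.
lra.
Unshelve. all: by end_near. Qed.

End IntegralCochain.

(** * The angle form of a map to the circle *)

Section AngleForm.
Context (R : realType) (X : topologicalType) (p : continuousType X (circle R)).

Definition angle_cover : set (set X) := [set p @^-1` arc t | t in [set: R]].

(** A set is the preimage of several arcs, for instance of those at [t] and [t + 1]; any choice
    gives a branch of the angle. *)
Definition angle_index (U : set X) : R := xget 0 [set t | p @^-1` arc t = U].

Definition angle (U : set X) (x : X) : R := lift (angle_index U) (p x).

Lemma angle_arc U x : angle_cover U -> U x -> arc (angle_index U) (p x).
Proof.
move=> [t _ tU] Ux.
have := @xgetPex _ 0 [set t | p @^-1` arc t = U] (ex_intro _ t tU).
by rewrite -/(angle_index U) /= => e; move: Ux; rewrite -{1}e.
Qed.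

Lemma turn_angle U x : angle_cover U -> U x -> turn (angle U x) = p x.
Proof. by move=> cU Ux; apply: turn_lift; exact: angle_arc. Qed.

Lemma angle_cover_open : open_cover angle_cover.
Proof.
split.
  move=> _ [t _ <-]; apply: open_comp; last exact: arc_open.
  by move=> x _; exact: cts_fun.
apply/seteqP; split => // x _; have [t xt] := arc_cover (p x).
by exists (p @^-1` arc t) => //; exists t.
Qed.

Lemma angle_nbhs U x : angle_cover U -> U x -> nbhs x U.
Proof.
by move=> cU Ux; apply: open_nbhs_nbhs; split=> //; exact: angle_cover_open.1.
Qed.

Lemma angle_continuous U x : angle_cover U -> U x -> {for x, continuous (angle U)}.
Proof.
move=> cU Ux; apply: continuous_comp; first exact: cts_fun.
by apply: lift_continuous; exact: angle_arc.
Qed.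

Lemma angle_int U V x : angle_cover U -> angle_cover V -> U x -> V x ->
  angle U x - angle V x \is a Num.int.
Proof. by move=> cU cV Ux Vx; apply: turn_eq; rewrite !turn_angle. Qed.

Lemma near_angle_int (f : X -> R) U x : angle_cover U -> U x ->
  {for x, continuous f} -> (\forall y \near x, turn (f y) = p y) ->
  \forall y \near x, angle U y - f y = angle U x - f x.
Proof.
move=> cU Ux cf pf; apply: (@int_near_eq _ _ (fun y => angle U y - f y)).
- by apply: cvgB; [exact: angle_continuous | exact: cf].
- apply: turn_eq; rewrite turn_angle //; exact/esym/(nbhs_singleton pf).
- apply: filterS2 pf (angle_nbhs cU Ux) => y fy Uy.
  by apply: turn_eq; rewrite turn_angle.
Qed.

Lemma angle_locally_constant U V : angle_cover U -> angle_cover V ->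
  locally_constant (U `&` V) (fun x => angle U x - angle V x).
Proof.
move=> cU cV; apply: near_locally_constant => x [Ux Vx].
apply: near_angle_int => //; first exact: angle_continuous.
by apply: filterS (angle_nbhs cV Vx) => y Vy; rewrite turn_angle.
Qed.

Definition angle_form : closed_form R X :=
  ClosedForm angle_cover_open angle_continuous angle_locally_constant.

Definition angle_val (U V : set X) (x : X) : int := Num.floor (angle V x - angle U x).

Lemma angle_valE U V x : angle_cover U -> angle_cover V -> U x -> V x ->
  (angle_val U V x)%:~R = angle V x - angle U x.
Proof. by move=> *; rewrite floorK // angle_int. Qed.

Lemma angle_val_locally_constant U V : angle_cover U -> angle_cover V ->
  locally_constant (U `&` V) (angle_val U V).
Proof.
move=> cU cV x [Ux Vx]; apply: filterS (angle_locally_constant cV cU (conj Vx Ux)).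
by move=> y e [Uy Vy]; rewrite /angle_val e.
Qed.

Lemma angle_val_cocycle U V W x : angle_cover U -> angle_cover V ->
  angle_cover W -> U x -> V x -> W x ->
  angle_val U V x + angle_val V W x = angle_val U W x.
Proof.
move=> *; apply: (@intr_inj R).
by rewrite intrD !angle_valE // addrC subrKA.
Qed.

Definition angle_cocycle : cocycle X int :=
  Cocycle angle_cover_open angle_val_locally_constant angle_val_cocycle.

Lemma angle_form_class :
  form_class angle_form = cech_class (cocycle_real R angle_cocycle).
Proof.
apply/form_classP; exists angle; split=> [U x cU Ux|U V x cU cV Ux Vx].
  by apply: (@near_primitiveW _ _ angle_form _ _ U) => //; near=> y.
exact: angle_valE.
Unshelve. all: by end_near. Qed.

(** The cochain [angle V x - psi U x] is integral, being a difference of two branches of the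
    argument of [p]. This is how classes are recognized as pullbacks of the class of the circle. *)
Lemma cohomologous_angle_cocycle (c : cocycle X int) (psi : set X -> X -> R) :
  (forall U x, ccover c U -> U x -> {for x, continuous (psi U)}) ->
  (forall U x, ccover c U -> U x -> turn (psi U x) = p x) ->
  (forall U V x, ccover c U -> ccover c V -> U x -> V x ->
     (cval c U V x)%:~R = psi V x - psi U x) ->
  cohomologous c angle_cocycle.
Proof.
move=> psi_cts psi_turn psiE; apply/cohomologousP.
exists (fun U V x => Num.floor (angle V x - psi U x)).
have psi_int U V x : ccover c U -> angle_cover V -> U x -> V x ->
    angle V x - psi U x \is a Num.int.
  by move=> cU cV Ux Vx; apply: turn_eq; rewrite turn_angle // psi_turn.
split=> [U V cU cV|U V U' V' x cU cV cU' cV' Ux Vx U'x V'x].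
  apply: near_locally_constant => x [Ux Vx].
  have := near_angle_int cV Vx (psi_cts U x cU Ux).
  have : \forall y \near x, turn (psi U y) = p y.
    by apply: filterS (cocycle_nbhs cU Ux) => y Uy; exact: psi_turn.
  by move=> h /(_ h); apply: filterS => y ->.
apply: (@intr_inj R).
rewrite !intrB [X in X - _ = _](angle_valE cU' cV' U'x V'x).
rewrite [X in _ - X = _](psiE U V x cU cV Ux Vx) !floorK ?psi_int //; lra.
Qed.

Lemma angle_primitive (T : topologicalType) (h : T -> X) (b : T -> R) (t : T) U :
  {for t, continuous h} -> {for t, continuous b} ->
  (forall s, turn (b s) = p (h s)) -> angle_cover U -> U (h t) ->
  \forall s \near t, b s - b t = angle U (h s) - angle U (h t).
Proof.
move=> ch cb bh cU Ut.
have H : \forall s \near t, angle U (h s) - b s = angle U (h t) - b t.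
  apply: (@int_near_eq _ _ (fun s => angle U (h s) - b s)).
  - apply: cvgB; last exact: cb.
    apply: (@continuous_comp _ _ _ h (angle U)) => //.
    exact: angle_continuous.
  - by apply: turn_eq; rewrite turn_angle // bh.
  - have Un : \forall s \near t, U (h s) by exact: (ch _ (angle_nbhs cU Ut)).
    apply: filterS Un => s Us.
    by apply: turn_eq; rewrite turn_angle // bh.
by apply: filterS H => s; lra.
Qed.

End AngleForm.

Section FundamentalClass.
Context (R : realType).

Definition circle_id : continuousType (circle R) (circle R) :=
  mkcts (fun x : circle R => @cvg_id _ (nbhs x)).

Definition circle_class : cech1 (circle R) int := cech_class (angle_cocycle circle_id).

Lemma pullback_circle_class (X : topologicalType) (p : continuousType X (circle R)) :
  cech_pullback p circle_class = cech_class (angle_cocycle p).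
Proof.
rewrite cech_pullback_class; apply/cech_classP.
pose c := cocycle_pullback p (angle_cocycle circle_id).
pose psi V x : R := angle circle_id (pull_index p (angle_cocycle circle_id) V) (p x).
apply: (@cohomologous_angle_cocycle _ _ p c psi).
- move=> V x cV Vx; apply: (@continuous_comp _ _ _ p); first exact: cts_fun.
  by apply: angle_continuous; [exact: (pull_indexP cV).1 | exact: pull_index_mem].
- move=> V x cV Vx.
  by rewrite turn_angle //; [exact: (pull_indexP cV).1 | exact: pull_index_mem].
- move=> U V x cU cV Ux Vx.
  by apply: angle_valE; solve [exact: (pull_indexP cU).1 | exact: (pull_indexP cV).1
    | exact: pull_index_mem].
Qed.

Lemma loop_simplex : exists s : simplex R (circle R) 1,
  forall t, 0 <= t <= 1 -> simplex_path s t = turn t.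
Proof.
apply: path_simplex; apply: continuous_subspaceT; exact: turn_continuous.
Qed.

(** Without a generator class, the condition in [fundamental_class] would select an arbitrary
    class. *)
Lemma loop_class : exists (z : H1 R (circle R)) (s : simplex R (circle R) 1),
  represented_by z << s >> /\ forall t, 0 <= t <= 1 -> simplex_path s t = turn t.
Proof.
have [s sP] := loop_simplex.
pose k (x : circle R) : simplex R (circle R) 0 := mkcts (@cst_continuous _ _ x).
have s0 : boundary (<< s >> : chain R (circle R) 1) == 0.
  rewrite (@boundary_path R _ s k) // !sP ?lexx ?ler01 //.
  have -> : turn 1 = turn 0 :> circle R by rewrite -(turnD1 0) add0r.
  by rewrite subrr.
pose cy : cycle1 R (circle R) := exist (fun c : chain R _ 1 => boundary c == 0) << s >> s0.
by exists (\pi_(H1 R (circle R))%qT cy), s; split => //; exists cy.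
Qed.

Lemma generator_pairing (w : closed_form R (circle R)) (z : H1 R (circle R)) :
  counterclockwise_generator z -> pairing (form_class w) z = integral w (@turn R).
Proof.
move=> [s zs sE]; rewrite (pairing_chain_integral _ zs) chain_integralE fglift1.
by apply: eq_integral_path => t t01; apply: val_inj; rewrite sE.
Qed.

Lemma circle_class_generator (z : H1 R (circle R)) :
  counterclockwise_generator z -> pairing (cech_real R circle_class) z = 1.
Proof.
move=> zg; rewrite cech_real_class -angle_form_class generator_pairing //.
rewrite (@path_primitive_integral _ _ _ _ id) ?subr0 //.
  by apply: continuous_subspaceT; exact: turn_continuous.
move=> t U _ cU Ut.
have := @angle_primitive _ _ circle_id R (@turn R) id t U (@turn_continuous R t)
  (@cvg_id _ _) (fun=> erefl) cU Ut.
by apply: filterS.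
Qed.

End FundamentalClass.

Lemma integral_cst (R : realType) (X : topologicalType) (w : closed_form R X) (x : X) :
  integral w (fun=> x) = 0.
Proof.
rewrite (@path_primitive_integral _ _ w (fun=> x) (fun=> 0)) ?subrr //.
  by apply: continuous_subspaceT; exact: cst_continuous.
by move=> t U _ _ _; near=> s => _; rewrite !subrr.
Unshelve. all: by end_near. Qed.

Section DegreeOne.
Context (R : realType) (w : closed_form R (circle R)).

(** The primitive, vanishing at 0, of [w] pulled back to the universal cover by [turn]. *)
Definition winding (v : R) : R := integral w (fun s => turn (v * s)).

Let F (z : R * R) : circle R := turn (z.1 * z.2).

Let F_continuous : continuous F.
Proof.
move=> z; apply: (@continuous_comp _ _ _ (fun z : R * R => z.1 * z.2) (@turn R)).
  by apply: cvgM; [exact: cvg_fst | exact: cvg_snd].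
exact: turn_continuous.
Qed.

Lemma winding_continuous : continuous winding.
Proof. exact: (@integral_param_continuous _ _ w _ F F_continuous). Qed.

Lemma near_winding v0 U : fcover w U -> U (turn v0) ->
  \forall v \near v0,
    winding v - winding v0 = fphi w U (turn v) - fphi w U (turn v0).
Proof.
move=> cU Uv0; have [V cV V0] := form_cover w (turn 0).
have F1 v : F (v, 1) = turn v by rewrite /F /= mulr1.
have F0 v : F (v, 0) = turn 0 by rewrite /F /= mulr0.
have := @near_integral _ _ w _ F v0 U V F_continuous cU.
rewrite F1 F0 => /(_ Uv0 cV V0); apply: filterS => v.
by rewrite F1 F0 subrr subr0.
Qed.

Lemma winding0 : winding 0 = 0.
Proof.
rewrite -[RHS](integral_cst w (turn 0)); congr (integral w).
by apply/funext => s; rewrite mul0r.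
Qed.

Lemma winding1 : winding 1 = integral w (@turn R).
Proof. by congr (integral w); apply/funext => s; rewrite mul1r. Qed.

Lemma windingD1 v : winding (v + 1) = winding v + integral w (@turn R).
Proof.
suff : winding (v + 1) - winding v = winding (0 + 1) - winding 0.
  by rewrite add0r winding0 winding1; lra.
apply: (@locally_constant_cst _ _ (fun v => winding (v + 1) - winding v)) => v0.
have [U cU Uv0] := form_cover w (turn v0).
have H := near_winding cU Uv0.
have H1 : \forall v \near v0,
    winding (v + 1) - winding (v0 + 1) = fphi w U (turn (v + 1)) - fphi w U (turn (v0 + 1)).
  have c1 : (fun v => v + 1) @ v0 --> v0 + 1.
    by apply: cvgD; [exact: cvg_id | exact: cvg_cst].
  have Uv1 : U (turn (v0 + 1)) by rewrite turnD1.
  exact: c1 _ (near_winding cU Uv1).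
by apply: filterS2 H H1 => u; rewrite !turnD1; lra.
Qed.

Context (w_degree : integral w (@turn R) = 1).

Lemma windingDz v (n : int) : winding (v + n%:~R) = winding v + n%:~R.
Proof.
have nat_case u (k : nat) : winding (u + k%:R) = winding u + k%:R.
  elim: k => [|k IH]; first by rewrite !addr0.
  by rewrite -natr1 !addrA windingD1 IH w_degree.
case: n => n; first exact: nat_case.
have := nat_case (v + (Negz n)%:~R) n.+1.
by rewrite NegzE mulrNz subrK => ->; rewrite addrK.
Qed.

Lemma degree_one_cohomologous (c : cocycle (circle R) int) :
  form_class w = cech_class (cocycle_real R c) ->
  cohomologous c (angle_cocycle (circle_id R)).
Proof.
move=> /form_classP[psi [psiP psiE]].
have [U0 cU0 U00] := cocycle_cover c (turn 0).
(* With this constant [psi U0 (turn 0) - g 0] is 0, so all [psi U (turn v) - g v] are integers. *)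
pose g v := winding v + psi U0 (turn 0).
have gz v (n : int) : g (v + n%:~R) = g v + n%:~R.
  by rewrite /g windingDz; lra.
have psiE' U V z : ccover c U -> ccover c V -> U z -> V z ->
    (cval c U V z)%:~R = psi V z - psi U z by exact: psiE.
have psi_g : forall v U, ccover c U -> U (turn v) ->
    psi U (turn v) - g v \is a Num.int.
  apply: (cochain_along_path psiP psiE' (@turn_continuous R) _ cU0 U00).
    move=> v0 W cW Wv0; apply: filterS (near_winding cW Wv0) => v; rewrite /g; lra.
  by rewrite /g winding0 add0r subrr int_num0.
(* [winding] commutes with integer translations, so [g t - t] descends to a
   function [f] on the circle; the functions [psi U - f] are then branches of the
   angle. *)
have /choice[s sP] (z : circle R) : exists t, turn t = z by exact: turn_surj.
pose f z := g (s z) - s z.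
have fE z t : turn t = z -> f z = g t - t.
  move=> tz; have /intrP[n nE] : s z - t \is a Num.int.
    by apply: turn_eq; rewrite sP tz.
  have sE : s z = t + n%:~R by rewrite -nE; lra.
  by rewrite /f sE gz; lra.
have f_cts : continuous f.
  move=> z; have [t zt] := arc_cover z.
  have H : \forall y \near z, g (lift t y) - lift t y = f y.
    have : nbhs z (arc t) by apply: open_nbhs_nbhs; split => //; exact: arc_open.
    by apply: filterS => y yt; rewrite (fE y (lift t y)) // turn_lift.
  have fz : f z = g (lift t z) - lift t z by apply: fE; exact: turn_lift.
  rewrite /continuous_at fz; apply: cvg_trans (near_eq_cvg H) _.
  have cl := lift_continuous zt.
  have cg : continuous g.
    by move=> u; apply: cvgD; [exact: winding_continuous | exact: cvg_cst].
  by apply: cvgB; [exact: (continuous_comp cl (cg _)) | exact: cl].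
apply: (@cohomologous_angle_cocycle _ _ _ c (fun U z => psi U z - f z)).
- move=> U z cU Uz.
  apply: continuous_sub_at; last exact: f_cts.
  exact: near_primitive_continuous (psiP U z cU Uz).
- move=> U z cU Uz; have [t tz] := turn_surj z.
  have /intrP[n nE] : psi U (turn t) - g t \is a Num.int.
    by apply: psi_g => //; rewrite tz.
  rewrite (fE z t) // -tz (_ : psi U (turn t) - (g t - t) = t + n%:~R).
    by rewrite turnDz.
  by rewrite -nE; lra.
- by move=> U V z cU cV Uz Vz; rewrite psiE' //; lra.
Qed.

End DegreeOne.

(** The pairing of the chosen class with the loop is 1, not the default 0, so a closed form
    represents that class; its integral along [turn] is 1, and [degree_one_cohomologous] identifies
    the class. *)
Lemma fundamental_classE (R : realType) : fundamental_class R = circle_class R.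
Proof.
rewrite /fundamental_class; set S := (X in xget _ X).
have SE : S (circle_class R) by move=> z; exact: circle_class_generator.
have : S (xget (cech0 _ _) S) by exact: (@xgetPex _ (cech0 _ _) S (ex_intro _ _ SE)).
set mu := xget _ _ => muS.
have [z [s [zs sE]]] := loop_class R.
have zg : counterclockwise_generator z.
  by exists s => // t t01; rewrite sE.
have mu1 := muS z zg.
have [|w wmu] := @pairing_form _ _ (cech_real R mu) z.
  by rewrite mu1; exact/eqP/oner_neq0.
rewrite -(cech_class_repr mu); apply/cech_classP.
apply: (@degree_one_cohomologous _ w _ (repr mu)) => //.
by rewrite -(generator_pairing w zg) wmu.
Qed.

(** * Fibrations over the circle *)

Section SetType.
Context (T X : topologicalType) (B : set X).

Lemma continuous_set_type_at (f : T -> B) (t : T) :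
  {for t, continuous (fun s => val (f s))} -> {for t, continuous f}.
Proof.
move=> cf U; rewrite nbhsE => -[_ [[V oV <-] Vt] VU].
have H : \forall s \near t, V (val (f s)) by exact: cf _ (open_nbhs_nbhs (conj oV Vt)).
by apply: filterS H => s Vs; exact: VU.
Qed.

Lemma continuous_val_comp (Y : topologicalType) (g : X -> Y) (x : B) :
  {for val x, continuous g} -> {for x, continuous (fun z : B => g (val z))}.
Proof.
by move=> cg; apply: (@continuous_comp _ _ _ (set_val : B -> X) g) => //;
  exact: initial_continuous.
Qed.

Lemma continuous_pair_at (Y Z : topologicalType) (f : T -> Y) (g : T -> Z) (t : T) :
  {for t, continuous f} -> {for t, continuous g} ->
  {for t, continuous (fun s => (f s, g s))}.
Proof. by move=> cf cg; apply: cvg_pair => /=; [exact: cf | exact: cg]. Qed.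

End SetType.

(** * The flow reparametrized by a Lyapunov form *)

Section HittingTime.
Context (R : realType) (X : metricType R) (Phi : X * R -> X).
Context (Phi_flow : is_flow Phi) (X_compact : compact [set: X]).
Context (w : closed_form R X) (w_lyapunov : is_lyapunov_form Phi w).
Local Notation A := (trajectory_integral Phi w).

Let PhiD x s t : Phi (Phi (x, s), t) = Phi (x, s + t).
Proof. by case: Phi_flow => _ _ ->. Qed.

Let A_cts : continuous (fun z : X * R => A z.1 z.2).
Proof. exact: (@trajectory_integral_continuous _ _ _ Phi_flow w). Qed.

Lemma trajectory_integral_decr x (s t : R) : s < t -> A x t < A x s.
Proof.
move=> st; have := trajectory_integralD Phi_flow w x s (t - s).
rewrite subrKC => ->; have ts : 0 < t - s by rewrite subr_gt0.
by have := w_lyapunov (Phi (x, s)) ts; lra.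
Qed.

Lemma trajectory_integral_inj x : injective (A x).
Proof.
move=> s t e; have [st|st|//] := ltgtP s t.
  by have := trajectory_integral_decr x st; rewrite e ltxx.
by have := trajectory_integral_decr x st; rewrite e ltxx.
Qed.

Lemma trajectory_integralN x t : A (Phi (x, t)) (- t) = - A x t.
Proof.
have := trajectory_integralD Phi_flow w x t (- t).
by rewrite subrr (trajectory_integral0 Phi_flow); lra.
Qed.

(** Linear decay from [x], and from [Phi (x, - n)] read backwards through [trajectory_integralN],
    puts [c] between the values at [n] and [- n]; the intermediate value theorem concludes. *)
Lemma trajectory_integral_surj (z : X * R) : exists t, A z.1 t = z.2.
Proof.
case: z => x c /=; have [r r0 rP] := lyapunov_linear_decay Phi_flow X_compact w_lyapunov.
pose n := Num.bound `| (`|c| / r) |.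
have cn : `|c| <= r * n%:R.
  by rewrite mulrC -ler_pdivrMr //; exact: le_bound_norm.
have hi := rP n x n%:R (lexx _).
have lo := rP n (Phi (x, - n%:R)) n%:R (lexx _).
have := trajectory_integralN x (- n%:R); rewrite opprK => lo'.
have [|||t _ tc] := @IVT R (A x) (- n%:R) n%:R c.
- by rewrite (@le_trans _ _ 0) // ?oppr_le0.
- apply: continuous_subspaceT.
  exact: (@continuous_slicer _ _ _ (fun z : X * R => A z.1 z.2) x A_cts).
- rewrite ge_min le_max; move: cn; rewrite ler_norml => /andP[c1 c2].
  apply/andP; split; apply/orP; [right | left].
    by apply: le_trans hi _; lra.
  by lra.
by exists t.
Qed.

Definition hit (z : X * R) : R := sval (cid (trajectory_integral_surj z)).

Lemma hitP x c : A x (hit (x, c)) = c.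
Proof. exact: (svalP (cid (trajectory_integral_surj (x, c)))). Qed.

Lemma hit_unique x c t : A x t = c -> hit (x, c) = t.
Proof. by move=> e; apply: (@trajectory_integral_inj x); rewrite hitP. Qed.

(** By monotonicity the hitting time stays within [e] of [t0] as long as [A x (t0 - e) - c] and
    [A x (t0 + e) - c] keep their signs, which is an open condition. *)
Lemma hit_continuous : continuous hit.
Proof.
move=> [x0 c0]; apply/cvgrPdist_lt => e e0.
pose t0 := hit (x0, c0).
have near_sign t : continuous (fun z : X * R => A z.1 t - z.2).
  move=> z; apply: (@continuous_sub_at _ _ (fun z : X * R => A z.1 t) snd);
    last exact: cvg_snd.
  apply: (@continuous_comp _ _ _ fst (fun x => A x t)); first exact: cvg_fst.
  exact: (@continuous_slicel _ _ _ (fun z : X * R => A z.1 z.2) t A_cts).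
have lo : 0 < A x0 (t0 - e) - c0.
  rewrite -[X in _ - X](hitP x0 c0) subr_gt0; apply: trajectory_integral_decr.
  by rewrite -/t0; lra.
have hi : A x0 (t0 + e) - c0 < 0.
  rewrite -[X in _ - X](hitP x0 c0) subr_lt0; apply: trajectory_integral_decr.
  by rewrite -/t0; lra.
have Hlo : \forall z \near (x0, c0), 0 < A z.1 (t0 - e) - z.2.
  exact: (@near_sign (t0 - e) (x0, c0) _ (lt_nbhsr lo)).
have Hhi : \forall z \near (x0, c0), A z.1 (t0 + e) - z.2 < 0.
  exact: (@near_sign (t0 + e) (x0, c0) _ (lt_nbhsl hi)).
apply: filterS2 Hlo Hhi => -[x c] /= lo' hi'; rewrite -/t0 ltr_norml.
apply/andP; split; rewrite ltNge; apply/negP => le.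
  have : t0 + e <= hit (x, c) by lra.
  rewrite le_eqVlt => /predU1P[e1|/(trajectory_integral_decr x)].
    by move: hi'; rewrite e1 hitP; lra.
  by rewrite hitP; lra.
have : hit (x, c) <= t0 - e by lra.
rewrite le_eqVlt => /predU1P[e1|/(trajectory_integral_decr x)].
  by move: lo'; rewrite -e1 hitP; lra.
by rewrite hitP; lra.
Qed.

(** The flow with the integral of [w] as its clock; [pushK] says that opposite amounts cancel. *)
Definition push (z : X * R) : X := Phi (z.1, hit z).

Lemma push_continuous : continuous push.
Proof.
move=> z; apply: (@continuous_comp _ _ _ (fun z : X * R => (z.1, hit z)) Phi).
  apply: continuous_pair z; last exact: hit_continuous.
  by move=> z; exact: cvg_fst.
by case: Phi_flow => + _ _; apply.
Qed.

Lemma hit_push x c : hit (push (x, c), - c) = - hit (x, c).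
Proof. by apply: hit_unique; rewrite trajectory_integralN hitP. Qed.

Lemma pushK x c : push (push (x, c), - c) = x.
Proof.
rewrite {1}/push hit_push /= /push PhiD subrr.
by case: Phi_flow => _ ->.
Qed.

End HittingTime.

Section DecreasingArgument.
Context (R : realType) (X : metricType R) (Phi : X * R -> X).
Context (Phi_flow : is_flow Phi) (X_compact : compact [set: X]).
Context (p : continuousType X (circle R)) (p_arg : arg_decreasing Phi p).
Local Notation A := (trajectory_integral Phi (angle_form p)).

Let Phi_cts : continuous Phi. Proof. by case: Phi_flow. Qed.
Let Phi0 x : Phi (x, 0) = x. Proof. by case: Phi_flow => _ ->. Qed.
Let PhiD x s t : Phi (Phi (x, s), t) = Phi (x, s + t).
Proof. by case: Phi_flow => _ _ ->. Qed.

Let two_pi_gt0 : 0 < 2 * pi :> R. Proof. by rewrite mulr_gt0 // pi_gt0. Qed.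

Lemma arg_decreasing_turn x : exists b : R -> R,
  [/\ continuous b, forall t, turn (b t) = p (Phi (x, t)) &
      forall s t, s < t -> b t < b s].
Proof.
have [a [ca aE ad aneg]] := p_arg x.
exists (fun t => a t / (2 * pi)); split.
- by move=> t; apply: cvgM; [exact: ca | exact: cvg_cst].
- move=> t; apply: val_inj; rewrite aE /= mulrC divfK //.
  by rewrite gt_eqF.
- move=> s t st; rewrite ltr_pM2r ?invr_gt0 //.
  apply: (negative_derivative_lt _ st) => r; exists (derive1 a r); first exact: aneg.
  by rewrite derive1E; apply: DeriveDef => //; exact: ad.
Qed.

Lemma angle_trajectoryE x (b : R -> R) : continuous b ->
  (forall t, turn (b t) = p (Phi (x, t))) -> forall t, A x t = b t - b 0.
Proof.
move=> cb bE; apply: (trajectory_integral_unique Phi_flow) => t0 U cU Ux.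
apply: (@angle_primitive _ _ p R (fun t => Phi (x, t)) b t0 U) => //.
  exact: (@continuous_slicer _ _ _ Phi x Phi_cts t0).
exact: cb.
Qed.

Lemma angle_trajectory x s t : turn s = p x -> p (Phi (x, t)) = turn (s + A x t).
Proof.
move=> sx; have [b [cb bE _]] := arg_decreasing_turn x.
rewrite (angle_trajectoryE cb bE) -bE.
have /intrP[n nE] : s - b 0 \is a Num.int by apply: turn_eq; rewrite bE Phi0.
by rewrite (_ : s + (b t - b 0) = b t + n%:~R) ?turnDz // -nE; lra.
Qed.

Lemma angle_lyapunov : is_lyapunov_form Phi (angle_form p).
Proof.
move=> x t t0; have [b [cb bE b_decr]] := arg_decreasing_turn x.
by rewrite (angle_trajectoryE cb bE) subr_lt0 b_decr.
Qed.

Let pushp := push Phi_flow X_compact angle_lyapunov.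
Let hitp := hit Phi_flow X_compact angle_lyapunov.

Let push_cts : continuous pushp.
Proof. exact: push_continuous. Qed.

Let push_turn x s c : turn s = p x -> p (pushp (x, c)) = turn (s + c).
Proof. by move=> sx; rewrite (angle_trajectory _ sx) hitP. Qed.

Let pushpK x c : pushp (pushp (x, c), - c) = x.
Proof. exact: pushK. Qed.

Let pushpE x c : pushp (x, c) = Phi (x, hitp (x, c)).
Proof. by []. Qed.

(** Over the half-circle around [y], pushing a point by minus its angular offset [off] lands in the
    fibre over [y]; pushing back by the offset is the inverse. *)
Lemma arg_decreasing_locally_trivial : locally_trivial p.
Proof.
move=> y; have [t0 t0y] := turn_surj y.
exists (arc t0); split; [exact: arc_open | by rewrite -t0y; exact: turn_arc |].
pose F := p @^-1` [set y].
pose off (v : circle R) := lift t0 v - t0.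
have off_cts (v : circle R) : arc t0 v -> {for v, continuous off}.
  move=> vV; apply: (@continuous_sub_at _ _ (lift t0) (fun=> t0)); first exact: lift_continuous.
  exact: cst_continuous.
have fwdP (x : p @^-1` arc t0) : pushp (val x, - off (p (val x))) \in F.
  have xV : arc t0 (p (val x)) := set_mem (valP x).
  apply/mem_set; rewrite /F /= (@push_turn _ (lift t0 (p (val x)))) ?turn_lift //.
  by rewrite -t0y /off; congr turn; lra.
have fwdV (x : p @^-1` arc t0) : p (val x) \in arc t0.
  exact/mem_set/(set_mem (valP x)).
have bwdE (z : arc t0 * F) : p (pushp (val z.2, off (val z.1))) = val z.1.
  have kF : p (val z.2) = y := set_mem (valP z.2).
  have vV : arc t0 (val z.1) := set_mem (valP z.1).
  rewrite (@push_turn _ t0) ?kF // -[RHS](turn_lift vV) /off.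
  by congr turn; lra.
have bwdP (z : arc t0 * F) : pushp (val z.2, off (val z.1)) \in p @^-1` arc t0.
  by apply/mem_set; rewrite /= bwdE; exact: (set_mem (valP z.1)).
pose h (x : p @^-1` arc t0) : (arc t0 : Type) * F :=
  (exist _ (p (val x)) (fwdV x), exist _ (pushp (val x, - off (p (val x)))) (fwdP x)).
pose g (z : (arc t0 : Type) * F) : p @^-1` arc t0 :=
  exist _ (pushp (val z.2, off (val z.1))) (bwdP z).
exists F, h; split=> //; split.
  move=> x; apply: continuous_pair_at; apply: continuous_set_type_at => /=.
    by apply: continuous_val_comp; exact: cts_fun.
  apply: (@continuous_val_comp _ _ _ (fun x => pushp (x, - off (p x)))).
  apply: continuous_comp; last exact: push_cts.
  apply: continuous_pair_at; first exact: cvg_id.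
  apply: cvgN; apply: (@continuous_comp _ _ _ p off); first exact: cts_fun.
  exact/off_cts/(set_mem (fwdV x)).
exists g; split.
- move=> z; apply: continuous_set_type_at => /=.
  apply: continuous_comp; last exact: push_cts.
  apply: continuous_pair_at.
    apply: (@continuous_comp _ _ _ snd (set_val : F -> X)); first exact: cvg_snd.
    exact: set_val_continuous.
  apply: (@continuous_comp _ _ _ fst (fun v : arc t0 => off (val v))); first exact: cvg_fst.
  apply: (@continuous_val_comp _ _ _ off).
  exact/off_cts/(set_mem (valP z.1)).
- move=> x; apply: val_inj => /=.
  by rewrite -[X in pushp (_, X)]opprK pushpK.
- move=> z; rewrite [RHS]surjective_pairing; congr (_, _); apply: val_inj => /=;
    rewrite bwdE //.
Qed.

Lemma arg_decreasing_cross_section (theta : circle R) :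
  cross_section Phi (p @^-1` [set theta]).
Proof.
have [t0 t0y] := turn_surj theta.
pose K := p @^-1` [set theta].
split.
- have -> : p @^-1` [set theta] = (fun x => cx (p x)) @^-1` [set cx theta] `&`
      (fun x => cy (p x)) @^-1` [set cy theta].
    apply/seteqP; split=> x /=; first by move=> ->.
    by move=> [ex ey]; exact: circle_ext.
  apply: closedI; apply: closed_comp; try exact: closed_eq.
    move=> x _; apply: (@continuous_comp _ _ _ p); first exact: cts_fun.
    exact: cx_continuous.
  move=> x _; apply: (@continuous_comp _ _ _ p); first exact: cts_fun.
  exact: cy_continuous.
- move=> y; have [s sy] := turn_surj (p y).
  have kK : pushp (y, t0 - s) \in p @^-1` [set theta].
    by apply/mem_set; rewrite /= (push_turn _ sy) -t0y; congr turn; lra.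
  exists (exist _ (pushp (y, t0 - s)) kK, - hitp (y, t0 - s)) => /=.
  by rewrite PhiD subrr.
- set f := fun z : (p @^-1` [set theta] : set X) * R => Phi (val z.1, z.2).
  have f_cts : continuous f.
    move=> z; apply: continuous_comp; last exact: Phi_cts.
    apply: continuous_pair_at; last exact: cvg_snd.
    apply: (@continuous_comp _ _ _ fst (set_val : K -> X)); first exact: cvg_fst.
    exact: set_val_continuous.
  have A_cts : continuous (fun z : K * R => A (val z.1) z.2).
    move=> z; apply: (@continuous_comp _ _ _ (fun z : K * R => (val z.1, z.2))
      (fun z : X * R => A z.1 z.2)).
      apply: continuous_pair_at; last exact: cvg_snd.
      apply: (@continuous_comp _ _ _ fst (set_val : K -> X)); first exact: cvg_fst.
      exact: set_val_continuous.
    exact: (@trajectory_integral_continuous _ _ _ Phi_flow (angle_form p)).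
  have turnK (k : K) : turn t0 = p (val k).
    by rewrite t0y; exact/esym/(set_mem (valP k)).
  move=> z0; pose c0 := A (val z0.1) z0.2; pose t1 := t0 + c0.
  (* A trajectory from [K] meets the arc once per turn; staying within half a turn of [c0] selects
     one passage. There [t0 + A] and [lift t1] differ by an integer smaller than 1/2 + 1/4 in
     absolute value, so they agree. *)
  pose U : set (K * R) := [set z | arc t1 (p (f z)) /\ `|A (val z.1) z.2 - c0| < 2^-1].
  pose off (y : X) := lift t1 (p y) - t0.
  have UA z : U z -> A (val z.1) z.2 = off (f z).
    move=> [zV zA].
    have : t0 + A (val z.1) z.2 - lift t1 (p (f z)) \is a Num.int.
      by apply: turn_eq; rewrite turn_lift // /f (angle_trajectory _ (turnK z.1)).
    move=> zint; have := lift_itv zV; have := norm_intr_ge1 zint.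
    have [e _ _|ne /(_ isT)] := eqVneq (t0 + A (val z.1) z.2 - lift t1 (p (f z))) 0.
      by rewrite /off; lra.
    move: zA; rewrite /t1 ltr_norml => /andP[z1 z2] h1.
    rewrite ltr_norml => /andP[h2 h3]; exfalso.
    by move: h1; rewrite ler_normr => /orP[]; lra.
  have back_in y : pushp (y, - off y) \in K \/ ~ arc t1 (p y).
    have [yV|] := pselect (arc t1 (p y)); last by right.
    left; apply/mem_set; rewrite /K /= (@push_turn _ (lift t1 (p y))) ?turn_lift //.
    by rewrite -t0y /off; congr turn; lra.
  (* The local inverse: push [y] back into [K] and record the time of return, with the default [z0]
     away from the arc. *)
  have /choice[G GP] (y : X) : exists z : K * R, arc t1 (p y) ->
      val z.1 = pushp (y, - off y) /\ z.2 = - hitp (y, - off y).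
    case: (back_in y) => [yK|nyV]; last by exists z0.
    by exists (exist _ (pushp (y, - off y)) yK, - hitp (y, - off y)).
  have fG y : arc t1 (p y) -> f (G y) = y.
    by move=> yV; have [e1 e2] := GP y yV; rewrite /f e1 e2 PhiD subrr Phi0.
  have UG y : arc t1 (p y) -> U (G y).
    move=> yV; split; first by rewrite fG.
    have [-> ->] := GP y yV; rewrite (trajectory_integralN Phi_flow) hitP opprK.
    by have := lift_itv yV; rewrite /off /t1 !ltr_norml; lra.
  have fU : f @` U = p @^-1` arc t1.
    apply/seteqP; split=> [_ [z [zV _] <-] //|y yV].
    by exists (G y); [exact: UG | exact: fG].
  have oV : open (p @^-1` arc t1).
    by apply: open_comp; [move=> x _; exact: cts_fun | exact: arc_open].
  exists U; split.
  + have -> : U = (f @^-1` (p @^-1` arc t1)) `&`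
        ((fun z => A (val z.1) z.2) @^-1` ball c0 2^-1).
      by apply/seteqP; split=> z [h1 h2]; split=> //; move: h2; rewrite /ball /= distrC.
    apply: openI; first by apply: open_comp => // x _; exact: f_cts.
    by apply: open_comp; [move=> x _; exact: A_cts | exact: ball_open].
  + split; last by rewrite subrr normr0 invr_gt0.
    by rewrite /f (angle_trajectory _ (turnK z0.1)); exact: turn_arc.
  + by rewrite fU.
  + exists G; split.
    * exact: continuous_subspaceT.
    * rewrite fU; apply: continuous_in_subspaceT => y; rewrite inE /= => yV.
      have yn : nbhs y (p @^-1` arc t1) by exact: open_nbhs_nbhs.
      have off_cts : {for y, continuous (fun y => (y, - off y))}.
        apply: continuous_pair_at; first exact: cvg_id.
        apply: cvgN; apply: (@continuous_sub_at _ _ (lift t1 \o p) (fun=> t0)).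
          apply: continuous_comp; first exact: cts_fun.
          exact: lift_continuous.
        exact: cst_continuous.
      have [e1 e2] := GP y yV.
      have G1 : {for y, continuous (fun y => (G y).1)}.
        apply: continuous_set_type_at; rewrite /prop_for /continuous_at e1.
        have H : pushp (y', - off y') @[y' --> y] --> pushp (y, - off y).
          apply: (@continuous_comp _ _ _ (fun y => (y, - off y)) pushp).
            exact: off_cts.
          exact: push_cts.
        apply: cvg_trans H.
        by apply: near_eq_cvg; apply: filterS yn => y' /GP[-> _].
      have G2 : {for y, continuous (fun y => (G y).2)}.
        rewrite /prop_for /continuous_at e2.
        have hit_cts : continuous hitp by exact: hit_continuous.
        have H : - hitp (y', - off y') @[y' --> y] --> - hitp (y, - off y).
          apply: cvgN; apply: (@continuous_comp _ _ _ (fun y => (y, - off y)) hitp).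
            exact: off_cts.
          exact: hit_cts.
        apply: cvg_trans H.
        by apply: near_eq_cvg; apply: filterS yn => y' /GP[_ ->].
      have := continuous_pair_at G1 G2.
      have -> : (fun y => ((G y).1, (G y).2)) = G.
        by apply/funext => y'; rewrite -surjective_pairing.
      by apply.
    * move=> z Uz; have [zV _] := Uz; have [e1 e2] := GP _ zV.
      have hz : hitp (f z, - off (f z)) = - z.2.
        by apply: hit_unique; rewrite -(UA z Uz) (trajectory_integralN Phi_flow).
      rewrite [LHS]surjective_pairing [RHS]surjective_pairing; congr (_, _).
        apply: val_inj; rewrite e1 pushpE hz /f PhiD subrr; exact: Phi0.
      by rewrite e2 hz opprK.
Qed.

End DecreasingArgument.

(** The local primitives [psi] have integral jumps, so [turn] of them is a global map to the circle.
    Along a trajectory [2 * pi * b] is a branch of its argument, which inherits the negative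
    derivative of the integral of [w]. *)
Lemma lyapunov_fibration (R : realType) (X : metricType R) (Phi : X * R -> X)
    (w : closed_form R X) (xiZ : cech1 X int) : is_flow Phi ->
  (forall x (t : R), exists2 d : R, d < 0 &
     is_derive t (1 : R) (trajectory_integral Phi w x) d) ->
  form_class w = cech_real R xiZ ->
  exists p : continuousType X (circle R),
    arg_decreasing Phi p /\ cech_pullback p (circle_class R) = xiZ.
Proof.
move=> Phi_flow wd /form_classP[psi [psiP psiE]].
set c := repr xiZ in psiP psiE.
have psiE' U V x : ccover c U -> ccover c V -> U x -> V x ->
    (cval c U V x)%:~R = psi V x - psi U x by exact: psiE.
have /choice[W WP] (x : X) : exists W, ccover c W /\ W x.
  by have [W cW Wx] := cocycle_cover c x; exists W.
pose q x : circle R := turn (psi (W x) x).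
have qE U x : ccover c U -> U x -> turn (psi U x) = q x.
  move=> cU Ux; have [cW Wx] := WP x; apply: turn_int.
  exact: (cochain_transition psiE').
have psi_cts U x : ccover c U -> U x -> {for x, continuous (psi U)}.
  by move=> cU Ux; exact: near_primitive_continuous (psiP U x cU Ux).
have q_cts : continuous q.
  move=> x; have [cW Wx] := WP x.
  have H : \forall y \near x, turn (psi (W x) y) = q y.
    by apply: filterS (cocycle_nbhs cW Wx) => y Wy; exact: qE.
  apply: cvg_trans (near_eq_cvg H) _.
  apply: (@continuous_comp _ _ _ (psi (W x)) (@turn R)); first exact: psi_cts.
  exact: turn_continuous.
exists (mkcts q_cts : continuousType _ _); split.
  move=> x; have [cW Wx] := WP x.
  pose A := trajectory_integral Phi w.
  pose b t := psi (W x) x + A x t.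
  have Phi0 : Phi (x, 0) = x by case: Phi_flow => _ ->.
  have Ad t : derivable (A x) t 1 by have [d _ []] := wd x t.
  have bE t : q (Phi (x, t)) = turn (b t).
    have [U cU Ut] := cocycle_cover c (Phi (x, t)).
    rewrite -(qE U) //; apply: turn_int.
    apply: (cochain_along_path psiP psiE' (h := fun t => Phi (x, t)) (b := b)
      (U0 := W x)) => //.
    - by apply: continuous_slicer; case: Phi_flow.
    - move=> t0 V cV Vt; apply: filterS (trajectory_primitive Phi_flow cV Vt) => s.
      by rewrite /b /A; lra.
    - by rewrite Phi0.
    - by rewrite Phi0 /b /A (trajectory_integral0 Phi_flow) addr0 subrr int_num0.
  have bd t : exists2 d : R, d < 0 & is_derive t (1 : R) (fun t => 2 * pi * b t) d.
    have [d d0 Ad'] := wd x t; exists (2 * pi * d).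
      by rewrite pmulr_rlt0 // mulr_gt0 // pi_gt0.
    have bd' : is_derive t (1 : R) b d.
      by rewrite -[d]add0r; apply: is_deriveD.
    exact: (is_deriveZ (2 * pi) bd').
  have bder t : derivable (fun t => 2 * pi * b t) t 1 by have [d _ []] := bd t.
  exists (fun t => 2 * pi * b t); split => //.
  - by move=> t; exact/differentiable_continuous/derivable1_diffP.
  - by move=> t; have := congr1 val (bE t).
  - by move=> t; have [d d0 [_ e]] := bd t; rewrite derive1E e.
rewrite pullback_circle_class -[RHS]cech_class_repr; apply/cech_classP.
by apply: cohomologous_sym; apply: (@cohomologous_angle_cocycle R X _ c psi).
Qed.

Theorem corollary3 (R : realType) (X : metricType R) (Phi : X * R -> X)
    (xi : cech1 X R) (eps delta0 : R) :
  compact [set: X] -> locally_path_connected X -> is_flow Phi ->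
  xi <> cech0 X R -> is_scale xi eps delta0 ->
  let condition_i :=
    R_xi Phi xi eps delta0 = set0 /\
    exists delta T : R, 0 < delta /\ 1 < T /\
      forall (x : X) (t : R), is_delta_cycle Phi delta T x t ->
        C_xi Phi xi eps delta0 x ->
        forall z : H1 R X, associated_cycle Phi eps x t z ->
          pairing xi z <= -1 in
  let condition_ii :=
    exists w : closed_form R X, is_lyapunov_form Phi w /\ form_class w = xi in
  (condition_i <-> condition_ii) /\
  forall xiZ : cech1 X int, cech_real R xiZ = xi ->
    let fibration (p : continuousType X (circle R)) :=
      [/\ locally_trivial p, arg_decreasing Phi p
        & cech_pullback p (fundamental_class R) = xiZ] in
    [/\ condition_i <-> exists p, fibration p,
        condition_ii <-> exists p, fibration p
      & forall p, fibration p ->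
          forall theta : circle R, cross_section Phi (p @^-1` [set theta])].
Proof.
move=> X_compact _ Phi_flow xi0 scale condition_i condition_ii.
have i_ii : condition_i <-> condition_ii.
  split=> [[Rxi0 [delta [T [d0 [_ cyc]]]]]|[w [w_lyap wxi]]].
    apply: (condition_i_lyapunov (T := T) Phi_flow X_compact xi0 scale d0).
    (* As [R_xi] is empty, [C_xi] is the whole chain recurrent set. *)
    by move=> x t xR xt; apply: cyc => //; rewrite /C_xi Rxi0 setD0.
  move: scale; rewrite /condition_i -wxi => scale.
  have [-> [delta [T [d0 [T1 cyc]]]]] :=
    lyapunov_condition_i Phi_flow X_compact scale w_lyap.
  by split=> //; exists delta, T; do 2!split=> //; move=> x t xt _; exact: cyc.
split=> // xiZ xiZE fibration.
have ii_fib : condition_ii <-> exists p, fibration p.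
  split=> [[w [w_lyap wxi]]|[p [_ p_arg p_class]]].
    (* The integrals of [w] need not be differentiable in time, so [w] is first averaged within its
       class. *)
    have esc := lyapunov_escape Phi_flow X_compact w_lyap.
    have [T T0 AT] := uniform_decay_time Phi_flow X_compact esc.
    have [w' w'w w'd] := smooth_lyapunov_form Phi_flow T0 AT.
    have [|p [p_arg p_class]] := @lyapunov_fibration _ _ _ w' xiZ Phi_flow w'd.
      by rewrite w'w wxi.
    exists p; split=> //; last by rewrite fundamental_classE.
    exact: (arg_decreasing_locally_trivial Phi_flow X_compact).
  exists (angle_form p); split; first exact: angle_lyapunov.
  rewrite angle_form_class -cech_real_class -pullback_circle_class.
  by rewrite -fundamental_classE p_class.
split=> //; first exact: iff_trans i_ii ii_fib.
move=> p [_ p_arg _] theta.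
exact: (arg_decreasing_cross_section Phi_flow X_compact).
Qed.
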